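(* Let $V:\mathbb{R}^d\to\mathbb{R}$ be smooth with $\int_{\mathbb{R}^d} e^{-V(x)}\,\mathrm{d}x=1$, put $p_\infty = e^{-V}$, and assume that there is a constant $K>0$ with $D^2V(x)\ge K\,\mathbf{I}_d$ for every $x\in\mathbb{R}^d$. Fix $\alpha\in(0,\infty)$ and a smooth initial probability density $p_0$ on $\mathbb{R}^d$, $p_0\neq p_\infty$, which decays sufficiently fast at infinity (in the sense explained in the context). Let $p_t$ be the solution, with initial datum $p_0$, of the Fokker-Planck equation $$\partial_t p_t(x)=\operatorname{div}\big(p_t(x)\nabla V(x)\big)+\Delta p_t(x),\qquad x\in\mathbb{R}^d,\ t>0 .$$ Then there exist $\tau\ge 0$ and $C>0$ such that $$D_\alpha(p_t\,\|\,p_\infty)\le C\,D_\alpha(p_0\,\|\,p_\infty)\,e^{-2Kt}\qquad\text{for any } t\ge\tau,$$ where $\tau$ is given by $$\tau=\begin{cases}0, & \alpha\in(0,2],\\[2pt] \dfrac{1}{2K}\ln(\alpha-1), & \alpha\in(2,\infty),\end{cases}$$ and $C$ is given by $$C=\begin{cases}\dfrac{D_1(p_0\,\|\,p_\infty)}{D_\alpha(p_0\,\|\,p_\infty)}, & \alpha\in(0,1],\\[8pt] \dfrac{e^{D_2(p_0\,\|\,p_\infty)}-1}{D_\alpha(p_0\,\|\,p_\infty)}, & \alpha\in(1,2],\\[8pt] (\alpha-1)\,\dfrac{e^{D_2(p_0\,\|\,p_\infty)}-1}{D_\alpha(p_0\,\|\,p_\infty)}, & \alpha\in(2,\infty).\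end{cases}$$
   Context: Probability measures on $\mathbb{R}^d$ are identified with their densities with respect to Lebesgue measure, and all probability densities under consideration are assumed to be smooth. $D^2V$ is the Hessian of $V$, $\mathbf{I}_d$ is the $d\times d$ identity matrix, and $\ge$ between symmetric matrices is the Loewner order. For probability distributions $p\ll q$ and $\alpha\in(0,\infty)$ the Rényi divergence of order $\alpha$ is $$D_\alpha(p\,\|\,q)=\begin{cases}\dfrac{1}{\alpha-1}\ln\left(\displaystyle\int\Big(\frac{p}{q}\Big)^{\alpha}\,\mathrm{d}q\right), & \alpha\ne 1,\\[8pt] \displaystyle\int \frac{p}{q}\ln\Big(\frac{p}{q}\Big)\,\mathrm{d}q, & \alpha=1,\end{cases}$$ and $D_\alpha(p\,\|\,q)=\infty$ if $p$ is not absolutely continuous with respect to $q$. Thus $D_1$ is the relative entropy. ''Decays sufficiently fast at infinity'' is a regularity assumption on the initial datum: the Rényi divergences of $p_0$ appearing in the statement are finite, and, for the corresponding (smooth, positive for $t>0$) solution $p_t$ of the Fokker-Planck equation, which is a probability density for each $t$, differentiation in $t$ under the integral sign and integration by parts without boundary terms at infinity are justified for the integrals defining the Rényi divergences of $p_t$ relative to $p_\infty$. *)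

(* Defs.v *)
From HB Require Import structures.
From mathcomp Require Import all_boot all_order all_algebra.
From mathcomp Require Import all_classical all_reals all_analysis.

Set Implicit Arguments.
Unset Strict Implicit.
Unset Printing Implicit Defensive.

Import Order.TTheory GRing.Theory Num.Theory.
Import numFieldNormedType.Exports.

Local Open Scope classical_set_scope.
Local Open Scope ring_scope.

(* Row vectors carry the sigma-algebra generated by the coordinates, i.e. the
   Borel sigma-algebra of R^n. *)
Section measurable_rV.
Context {R : realType} (n : nat).

Definition coord_rV (i : 'I_n) (x : 'rV[R]_n) : measurableTypeR R := x ord0 i.

Let rV_set0 : g_sigma_preimage coord_rV set0.
Proof. exact: sigma_algebra0. Qed.

Let rV_setC A : g_sigma_preimage coord_rV A -> g_sigma_preimage coord_rV (~` A).
Proof. exact: sigma_algebraC. Qed.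

Let rV_bigcup (F : (set 'rV[R]_n)^nat) :
  (forall i, g_sigma_preimage coord_rV (F i)) ->
  g_sigma_preimage coord_rV (\bigcup_i (F i)).
Proof. exact: sigma_algebra_bigcup. Qed.

HB.instance Definition _ := @isMeasurable.Build default_measure_display
  'rV[R]_n (g_sigma_preimage coord_rV) rV_set0 rV_setC rV_bigcup.

End measurable_rV.

Section lebesgue_rV.
Context {R : realType}.

Definition cons_rV n (xy : 'rV[R]_n * measurableTypeR R) : 'rV[R]_n.+1 :=
  row_mx (xy.2 : R)%:M xy.1.

Lemma measurable_cons_rV n : measurable_fun setT (@cons_rV n).
Proof.
move=> _ Y mY; rewrite setTI.
suff : g_sigma_preimage (fun i => @coord_rV R n.+1 i \o @cons_rV n) `<=`
    @measurable _ ('rV[R]_n * measurableTypeR R)%type.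
  by rewrite g_sigma_preimage_comp; apply; exists Y => //; rewrite setTI.
apply: smallest_sub; first exact: sigma_algebra_measurable.
rewrite big_ord_recl subUset; split.
  move=> _ [B mB <-].
  rewrite (_ : @coord_rV R n.+1 ord0 \o @cons_rV n = snd).
    exact: measurable_snd.
  apply/funext => xy /=; rewrite /coord_rV /cons_rV.
  transitivity (row_mx (xy.2 : R)%:M xy.1 ord0 (lshift n (ord0 : 'I_1))).
    by congr (row_mx _ _ _ _); exact/val_inj.
  by rewrite row_mxEl mxE eqxx mulr1n.
apply: (big_ind (fun S => S `<=` _)) => //= [S T SX TX|i _].
  by rewrite subUset.
move=> _ [B mB <-].
rewrite (_ : @coord_rV R n.+1 (lift ord0 i) \o @cons_rV n =
    @coord_rV R n i \o fst).
  apply: (measurableT_comp _ measurable_fst) => //.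
  move=> _ C mC; apply: sub_sigma_algebra => /=.
  by rewrite -bigcup_seq /=; exists i => /=; [rewrite mem_index_enum|exists C].
apply/funext => xy /=; rewrite /coord_rV /cons_rV.
transitivity (row_mx (xy.2 : R)%:M xy.1 ord0 (rshift 1 i)).
  by congr (row_mx _ _ _ _); exact/val_inj.
by rewrite row_mxEr.
Qed.

Definition prod_lebesgue n (mu : {measure set 'rV[R]_n -> \bar R}) :=
  pushforward (mu \x lebesgue_measure)%E (@cons_rV n).

HB.instance Definition _ n (mu : {measure set 'rV[R]_n -> \bar R}) :=
  Measure.copy (prod_lebesgue mu)
    (measure_function_pushforward__canonical__measure_function_Measure
      (mu \x lebesgue_measure)%E (@measurable_cons_rV n)).

Fixpoint lebesgue_rV n : {measure set 'rV[R]_n -> \bar R} :=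
  match n with
  | 0 => \d_ (0 : 'rV[R]_0)
  | m.+1 => prod_lebesgue (lebesgue_rV m)
  end.

End lebesgue_rV.

Section calculus.
Context {R : realType}.

(* All iterated directional derivatives are Frechet differentiable on U; for W of
   finite dimension and U open this is C^oo on U. *)
Definition smooth_on (W : normedModType R) (U : set W) (f : W -> R) : Prop :=
  forall (vs : seq W) x, U x ->
    differentiable (foldr (fun v (g : W -> R) => 'D_v g) f vs) x.

Context {d : nat}.
Implicit Types (f : 'rV[R]_d -> R) (X : 'rV[R]_d -> 'rV[R]_d).

Definition partial (i : 'I_d) f : 'rV[R]_d -> R := 'D_(delta_mx ord0 i) f.

Definition grad f x : 'rV[R]_d := \row_i partial i f x.

Definition divergence X x : R := \sum_i partial i (fun y => X y ord0 i) x.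

Definition laplacian f : 'rV[R]_d -> R := divergence (grad f).

Definition hessian f x : 'M[R]_d := \matrix_(i, j) partial i (partial j f) x.

Definition dot (u v : 'rV[R]_d) : R := (u *m v^T) ord0 ord0.

(* Only used for symmetric matrices. *)
Definition loewner_le (A B : 'M[R]_d) : Prop :=
  forall v : 'rV[R]_d, 0 <= dot (v *m (B - A)) v.

End calculus.

Section renyi_divergence.
Context {R : realType} {d : nat}.
Implicit Types (p q : 'rV[R]_d -> R) (a : R).

Definition is_density p : Prop :=
  [/\ measurable_fun setT p, forall x, 0 <= p x &
      (\int[lebesgue_rV d]_x (p x)%:E = 1)%E].

Definition density_measure p (A : set 'rV[R]_d) : \bar R :=
  (\int[lebesgue_rV d]_(x in A) (p x)%:E)%E.

Definition renyi_gen a (r : R) : R := if a == 1 then r * ln r else r `^ a.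

Definition renyi_integrand a p q x : R := renyi_gen a (p x / q x) * q x.

(* For probability densities p << q the ratio p / q is the Radon-Nikodym
   derivative. *)
Definition renyi a p q : \bar R :=
  if `[< density_measure p `<< density_measure q >] then
    let I := (\int[lebesgue_rV d]_x (renyi_integrand a p q x)%:E)%E in
    if a == 1 then I else (((a - 1)^-1)%:E * lne I)%E
  else +oo%E.

End renyi_divergence.

Section fokker_planck.
Context {R : realType} {d : nat}.
Implicit Types (V : 'rV[R]_d -> R) (p : R -> 'rV[R]_d -> R).

Definition gibbs V x : R := expR (- V x).

Record fokker_planck_solution V (p0 : 'rV[R]_d -> R) p : Prop := {
  fp_init : p 0 = p0 ;
  fp_continuous : {within [set tx : R * 'rV[R]_d | 0 <= tx.1],
    continuous (fun tx => p tx.1 tx.2)} ;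
  fp_smooth : smooth_on [set tx : R * 'rV[R]_d | 0 < tx.1]
    (fun tx => p tx.1 tx.2) ;
  fp_density : forall t, 0 <= t -> is_density (p t) ;
  fp_gt0 : forall t x, 0 < t -> 0 < p t x ;
  fp_eq : forall t x, 0 < t ->
    derive1 (fun s => p s x) t =
    divergence (fun y => p t y *: grad V y) x + laplacian (p t) x }.

Definition derivable_under_integral (f : R -> 'rV[R]_d -> R) (t : R) : Prop :=
  let ft x := derive1 (fun s => f s x) t in
  (lebesgue_rV d).-integrable setT (EFin \o ft) /\
  is_derive t 1 (fun s => \int[lebesgue_rV d]_x f s x)
    (\int[lebesgue_rV d]_x ft x).

Definition integration_by_parts (w : 'rV[R]_d -> R)
    (X : 'rV[R]_d -> 'rV[R]_d) : Prop :=
  let wdivX x := w x * divergence X x in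
  let gradwX x := dot (grad w x) (X x) in
  [/\ (lebesgue_rV d).-integrable setT (EFin \o wdivX),
      (lebesgue_rV d).-integrable setT (EFin \o gradwX) &
      \int[lebesgue_rV d]_x wdivX x = - \int[lebesgue_rV d]_x gradwX x].

(* Regularity of the integrals of order b along the flow. Continuity at t = 0 is
   what relates the integrals for t > 0 to those of the initial datum.
   The Fokker-Planck equation reads d_t p = div J with J = p grad V + grad p, so
   the derivative in t of the integral is the integral of
   renyi_gen' (p / p_oo) * div J, the term to be integrated by parts. *)
Record renyi_regular V p (b : R) : Prop := {
  rr_integrable : forall t, 0 <= t -> (lebesgue_rV d).-integrable setT
    (EFin \o renyi_integrand b (p t) (gibbs V)) ;
  rr_cvg0 :
    (\int[lebesgue_rV d]_x renyi_integrand b (p t) (gibbs V) x) @[t --> 0^'+]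
    --> \int[lebesgue_rV d]_x renyi_integrand b (p 0) (gibbs V) x ;
  rr_derive : forall t, 0 < t ->
    derivable_under_integral (fun s => renyi_integrand b (p s) (gibbs V)) t ;
  rr_parts : forall t, 0 < t ->
    integration_by_parts
      (fun x => derive1 (renyi_gen b) (p t x / gibbs V x))
      (fun x => p t x *: grad V x + grad (p t) x) }.

(* The order, besides a, whose divergence enters the constant of the estimate. *)
Definition companion_order (a : R) : R := if a <= 1 then 1 else 2.

(* The intermediate orders matter for a > 2, where the order moves from 2 to a
   along the flow. *)
Record decays_fast V p (a : R) : Prop := {
  df_fin : renyi a (p 0) (gibbs V) \is a fin_num ;
  df_fin_companion :
    renyi (companion_order a) (p 0) (gibbs V) \is a fin_num ;
  df_regular : forall b,
    Num.min a (companion_order a) <= b <= Num.max a (companion_order a) ->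
    renyi_regular V p b }.

End fokker_planck.

(* Main.v *)
Require Import Defs.
From HB Require Import structures.
From mathcomp Require Import all_boot all_order all_algebra.
From mathcomp Require Import all_classical all_reals all_analysis.
From mathcomp Require Import measurable_realfun.
From mathcomp Require Import ring lra.

(** Write q for the stationary density and r_t = p_t / q. The Fokker-Planck
   equation says that p_t moves by the divergence of q grad r_t, so one
   integration by parts gives, for every phi,
     d/dt int phi(r_t) q = - int phi''(r_t) |grad r_t|^2 q       ([flow_derive]),
   and exponential decay is a matter of functional inequalities for q, which is
   strongly log-concave because D^2 V >= K.

   These are the logarithmic Sobolev inequality
     int f ln f q - E ln E <= (1 / 2K) int |grad f|^2 / f q,   E = int f q
   ([log_sobolev]) and its second-order expansion around the constants, the
   Poincare inequality ([poincare]). They come from the Prekopa-Leindler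
   inequality ([prekopa_leindler]), applied as by Bobkov and Ledoux to F^(1/t) q
   and q with t tending to 1: the strong convexity of V pays for the midpoint
   error, and comparing first-order terms in s = 1 - t gives the inequality for
   functions F that are bounded above and away from 0 and have second
   derivatives bounded above. Cutting off and passing to the limit removes these
   restrictions.

   With phi(y) = y ln y the first inequality gives decay of D_1 at the rate
   e^(-2Kt) ([entropy_decay]); with phi(y) = y^2 the second one gives the same
   for the chi-square divergence e^(D_2) - 1 ([chi_square_decay]). For
   alpha <= 1 one has D_alpha <= D_1, and for 1 < alpha <= 2 one has
   D_alpha <= D_2 <= e^(D_2) - 1.

   For alpha > 2 the flow is hypercontractive ([hypercontractive]): by the
   logarithmic Sobolev inequality for powers of r, the norm of r_(s+u) in
   L^b(q) with b = 1 + e^(2Ku) does not increase with u. It starts at b = 2 and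
   reaches b = alpha at u = tau, where e^(2K tau) = alpha - 1. Hence D_alpha at
   time s + tau is at most D_2 at time s, and the delay tau costs the factor
   alpha - 1 in the constant. *)

Set Implicit Arguments.
Unset Strict Implicit.
Unset Printing Implicit Defensive.

Import Order.TTheory GRing.Theory Num.Theory.
Import numFieldNormedType.Exports.

Local Open Scope classical_set_scope.
Local Open Scope ring_scope.

(** * Lebesgue measure on row vectors *)

Section lebesgue_measure_rV.
Context {R : realType}.

Lemma cons_rV0 n (x : 'rV[R]_n) (y : R) : cons_rV (x, y) ord0 ord0 = y.
Proof.
transitivity (row_mx (y%:M : 'rV_1) x ord0 (lshift n (ord0 : 'I_1))).
  by congr (row_mx _ _ _ _); exact/val_inj.
by rewrite row_mxEl mxE eqxx mulr1n.
Qed.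

Lemma cons_rVS n (x : 'rV[R]_n) (y : R) i :
  cons_rV (x, y) ord0 (lift ord0 i) = x ord0 i.
Proof.
transitivity (row_mx (y%:M : 'rV_1) x ord0 (rshift 1 i)).
  by congr (row_mx _ _ _ _); exact/val_inj.
by rewrite row_mxEr.
Qed.

Lemma measurable_coord_rV n (i : 'I_n) :
  measurable_fun setT (fun x : 'rV[R]_n => x ord0 i).
Proof.
move=> _ C mC; apply: sub_sigma_algebra => /=.
rewrite -bigcup_seq /=; exists i => /=; first by rewrite mem_index_enum.
by exists C.
Qed.

Lemma measurable_ball_rV n (c : 'rV[R]_n) e : measurable (ball c e).
Proof.
have [e0|e0] := ltP 0 e; last first.
  rewrite (_ : ball _ _ = set0)//; apply/seteqP; split => // x [+ _].
  by rewrite ltNge e0.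
have -> : ball c e = \bigcap_(i in [set: 'I_n])
    ((fun x : 'rV[R]_n => x ord0 i) @^-1` ball (c ord0 i) e).
  apply/seteqP; split => x; first by move=> [_ cx] i _ /=; exact: cx.
  move=> cx; split => // i j.
  by rewrite (ord1 i); exact: cx.
apply: fin_bigcap_measurable => // i _; rewrite -[X in measurable X]setTI.
by apply: measurable_coord_rV => //; exact: measurable_ball.
Qed.

Lemma lebesgue_rV_ball n (c : 'rV[R]_n) e : 0 < e ->
  lebesgue_rV n (ball c e) = ((2 * e) ^+ n)%:E.
Proof.
move=> e0; elim: n c => [|n ih] c.
  by rewrite /= diracE mem_set//; split => // i [].
pose c' : 'rV[R]_n := \row_i c ord0 (lift ord0 i).
rewrite /= /prod_lebesgue /pushforward.
have -> : cons_rV (n := n) @^-1` ball c e = ball c' e `*` ball (c ord0 ord0) e.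
  apply/seteqP; split => [[x y] [_ /= h]|[x y] [/= [_ hx] hy]].
    split => /=.
      split => // i j; rewrite !mxE (ord1 i).
      by have := h ord0 (lift ord0 j); rewrite cons_rVS.
    by have := h ord0 ord0; rewrite cons_rV0.
  split => // i j; rewrite (ord1 i).
  case: (unliftP ord0 j) => [k ->|->]; last by rewrite cons_rV0.
  by rewrite cons_rVS; have := hx ord0 k; rewrite mxE.
rewrite product_measure1E//; [|exact: measurable_ball_rV|exact: measurable_ball].
transitivity (((2 * e) ^+ n)%:E * (e *+ 2)%:E)%E; last first.
  by rewrite -EFinM exprSr -[e *+ 2]mulr_natl.
by congr (_ * _)%E; [exact: ih|exact: lebesgue_measure_ball (ltW e0)].
Qed.

Lemma sigma_finite_lebesgue_rV n : sigma_finite setT (@lebesgue_rV R n).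
Proof.
exists (fun k => ball 0 k.+1%:R).
  apply/seteqP; split => // x _.
  exists (Num.Def.archi_bound `|x|) => //.
  rewrite -ball_normE /ball_ /= sub0r normrN.
  apply: (lt_trans (archi_boundP _)) => //.
  by rewrite ltr_nat.
move=> k; split; first exact: measurable_ball_rV.
by rewrite lebesgue_rV_ball// ltry.
Qed.

(** The sigma-algebra is generated by coordinates; an open set belongs to it
   because it is a countable union of balls with rational centres and radii
   1 / (k + 1), and balls for the sup norm are boxes. *)
Lemma open_measurable_rV n (U : set 'rV[R]_n) : open U -> measurable U.
Proof.
move=> oU.
pose B (i : 'rV[rat]_n * nat) : set 'rV[R]_n :=
  if `[< ball (map_mx (@ratr R) i.1 : 'rV[R]_n) i.2.+1%:R^-1 `<=` U >] then
  ball (map_mx (@ratr R) i.1 : 'rV[R]_n) i.2.+1%:R^-1 else set0.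
rewrite (_ : U = \bigcup_i B i); last first.
  apply/seteqP; split => x; last first.
    by move=> [i _]; rewrite /B; case: asboolP => // + Bi; exact.
  move=> Ux.
  have /nbhs_ballP[e /= e0 eU] : nbhs x U by exact: open_nbhs_nbhs.
  pose k := Num.Def.archi_bound (2 / e).
  have k0 : 0 < k.+1%:R^-1 :> R by rewrite invr_gt0.
  have ke : k.+1%:R^-1 <= e / 2.
    rewrite -[leRHS]invrK lef_pV2 ?posrE ?invr_gt0 ?divr_gt0//.
    rewrite invf_div; apply/ltW; apply: (lt_trans (archi_boundP _)).
      by rewrite divr_ge0// ltW.
    by rewrite ltr_nat.
  have /choice[q qP] : forall j : 'I_n, exists q : rat,
      `|x ord0 j - ratr q| < k.+1%:R^-1.
    move=> j.
    have : x ord0 j - k.+1%:R^-1 < x ord0 j + k.+1%:R^-1.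
      by rewrite ltrD2l gtrN.
    move=> /rat_in_itvoo[q]; rewrite in_itv/= => /andP[q1 q2]; exists q.
    by rewrite distrC ltr_norml ltrBrDl q1 ltrBlDl.
  exists (\row_j q j, k) => //; rewrite /B /=; case: asboolP => [_|].
    split => // i j; rewrite !mxE (ord1 i).
    by rewrite -ball_normE /ball_ /= distrC.
  case; move=> y [_ hy]; apply: eU; split => // i j.
  rewrite (ord1 i).
  have := hy ord0 j; rewrite -ball_normE /ball_ !mxE /= => h1.
  have h2 := qP j.
  rewrite (le_lt_trans (ler_distD (ratr (q j)) _ _))//.
  by rewrite [e]splitr ltrD// (lt_le_trans _ ke).
apply: countable_bigcupT_measurable; first exact: countableP.
move=> i; rewrite /B; case: asboolP => // _; exact: measurable_ball_rV.
Qed.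

Lemma continuous_measurable_rV n (f : 'rV[R]_n -> R) :
  continuous f -> measurable_fun setT f.
Proof.
move=> cf; apply: (measurability _ (RGenOpens.measurableE R)) => //.
move=> _ [_ [a [b ->]] <-]; rewrite setTI; apply: open_measurable_rV.
by move/continuousP : cf; apply; exact: interval_open.
Qed.

Lemma lebesgue_rV_open_gt0 n (U : set 'rV[R]_n) x :
  open U -> U x -> (0 < lebesgue_rV n U)%E.
Proof.
move=> oU Ux.
have /nbhs_ballP[e /= e0 eU] : nbhs x U by exact: open_nbhs_nbhs.
apply: (@lt_le_trans _ _ (lebesgue_rV n (ball x e))).
  by rewrite lebesgue_rV_ball// lte_fin exprn_gt0// mulr_gt0.
by apply: le_measure => //; rewrite inE; [exact: measurable_ball_rV|exact: open_measurable_rV].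
Qed.

(** [lebesgue_rV n] is bundled as a mere measure; Tonelli's theorem needs the same
   function bundled with its sigma-finiteness. *)
Definition sigma_finite_pack d (T : measurableType d)
    (mu : {measure set T -> \bar R}) (h : sigma_finite setT mu) :
    {sigma_finite_measure set T -> \bar R} :=
  let H1 := isSFinite.Build _ _ _ _ (sfinite_measure_sigma_finite h) in
  let H2 := isSigmaFinite.Build _ _ _ _ h in
  HB.pack_for (SigmaFiniteMeasure.type T R) (Measure.sort mu) H1 H2.

Definition sfinite_lebesgue_rV n : {sigma_finite_measure set 'rV[R]_n -> \bar R} :=
  sigma_finite_pack (sigma_finite_lebesgue_rV n).

Section tonelli.
Local Open Scope ereal_scope.
Variables (n : nat) (f : 'rV[R]_n.+1 -> \bar R).
Hypotheses (mf : measurable_fun setT f) (f0 : forall x, 0 <= f x).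

Let mfc : measurable_fun setT (f \o @cons_rV R n).
Proof. exact: (measurableT_comp mf (@measurable_cons_rV R n)). Qed.

Lemma integral_lebesgue_rVS : \int[lebesgue_rV n.+1]_x f x =
  \int[lebesgue_rV n]_x \int[lebesgue_measure]_y f (cons_rV (x, y)).
Proof.
rewrite /= /prod_lebesgue.
rewrite (ge0_integral_pushforward (@measurable_cons_rV R n))//.
have := @fubini_tonelli1 _ _ _ _ _ (sfinite_lebesgue_rV n) lebesgue_measure _ mfc.
by move=> /(_ (fun _ => f0 _)).
Qed.

Lemma measurable_marginal : measurable_fun setT
  (fun x => \int[lebesgue_measure]_y f (cons_rV (x, y))).
Proof.
have := @measurable_fun_fubini_tonelli_F _ _ _ _ _ lebesgue_measure _ mfc.
by move=> /(_ (fun _ => f0 _)).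
Qed.

Lemma measurable_section (x : 'rV[R]_n) :
  measurable_fun setT (fun y : measurableTypeR R => f (cons_rV (x, y))).
Proof. exact: (measurableT_comp mfc (pair1_measurable x)). Qed.

End tonelli.

End lebesgue_measure_rV.

(** * Brunn-Minkowski on the line *)

Section one_dimensional.
Context {R : realType}.
Local Notation mR := (measurableTypeR R).
Local Notation leb := (@lebesgue_measure R).

Definition affine (c b : R) (x : mR) : mR := c * x + b.

Lemma measurable_affine c b : measurable_fun setT (affine c b).
Proof.
by apply: measurable_funD => //; exact: mulrl_measurable.
Qed.

(** Lebesgue measure is determined by its values on half-open intervals, which
   scale as stated. *)
Lemma lebesgue_measure_affine c b (A : set mR) : 0 < c -> measurable A ->
  leb A = (c%:E * leb (affine c b @^-1` A))%E.
Proof.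
move=> c0 mA.
pose c' : {nonneg R} := NngNum (ltW c0).
pose nu : {measure set mR -> \bar R} :=
  mscale c' (pushforward leb (affine c b)).
have mphi := measurable_affine c b.
pose nu' : {measure set mR -> \bar R} :=
  mscale c' (measure_function_pushforward__canonical__measure_function_Measure leb mphi).
suff: leb A = nu' A by [].
apply: lebesgue_measure_unique => // _ [[p q] _ <-].
rewrite /nu' /mscale /= /pushforward.
transitivity (c%:E * leb (affine c b @^-1` `]p, q]))%E; last by [].
have -> : affine c b @^-1` `]p, q] = `](p - b) / c, (q - b) / c]%classic.
  apply/seteqP; split => x /=; rewrite /affine !in_itv/= ltr_pdivrMr// ler_pdivlMr//
    ltrBlDr lerBrDr [x * c]mulrC //.
rewrite !lebesgue_measure_itv /= !lte_fin ltr_pM2r ?invr_gt0// ltrD2r.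
case: ifPn => _; last by rewrite mule0.
rewrite -!EFinD -EFinM; congr EFin.
field; exact: lt0r_neq0.
Qed.

(** Stands in for a maximum of [h] on [A], which need not be attained: cutting [A]
   at the value of [h] at a suitable point of [A] loses arbitrarily little mass.
   Either the maximum is attained, or the sublevel sets of values of [h]
   increasing to the supremum exhaust [A]. *)
Lemma exists_sublevel_measure_gt (A : set mR) (h : mR -> R) (m : \bar R) :
  measurable A -> measurable_fun setT h -> A !=set0 -> (m < leb A)%E ->
  exists2 a, A a & (m < leb (A `&` [set x | h x <= h a]%R))%E.
Proof.
move=> mA mh A0 mltA.
have [[a Aa amax]|nomax] := pselect (exists2 a, A a & forall x, A x -> h x <= h a).
  by exists a => //; rewrite (_ : _ `&` _ = A)//; apply/seteqP; split => x;
    [case|move=> Ax; split => //; exact: amax].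
have gtA a : A a -> exists2 x, A x & h a < h x.
  move=> Aa; apply: contrapT => H; apply: nomax; exists a => // x Ax.
  by rewrite leNgt; apply/negP => ha; apply: H; exists x.
pose S := h @` A.
have S0 : S !=set0 by case: A0 => a Aa; exists (h a), a.
have [u [u_ud [uS uA]]] : exists u : R^nat, {homo u : n m / (n <= m)%N >-> n <= m} /\
    (forall n, exists2 a, A a & u n < h a) /\ (forall x, A x -> exists n, h x <= u n).
  have [ubS|nubS] := pselect (has_ubound S).
    exists (fun n => sup S - n.+1%:R^-1); split.
      move=> n k nk; rewrite lerD2l lerN2 lef_pV2 ?posrE// ler_nat.
      by rewrite ltnS.
    split=> [n|x Ax].
      have n0 : 0 < n.+1%:R^-1 :> R by rewrite invr_gt0.
      have [_ [a Aa <-] ?] := sup_adherent n0 (conj S0 ubS).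
      by exists a.
    have [y Ay xy] := gtA _ Ax.
    have : h x < sup S by apply: (lt_le_trans xy); apply: ub_le_sup => //; exists y.
    rewrite -subr_gt0 => d0.
    exists (Num.Def.archi_bound (sup S - h x)^-1).
    rewrite lerBrDl -lerBrDr -[leRHS]invrK lef_pV2 ?posrE// ?invr_gt0//.
    apply/ltW; apply: (lt_trans (archi_boundP _)); first by rewrite invr_ge0 ltW.
    by rewrite ltr_nat.
  exists (fun n => n%:R); split; first by move=> n k nk; rewrite ler_nat.
  split=> [n|x Ax].
    apply: contrapT => H; apply: nubS; exists n%:R => _ [a Aa <-].
    by rewrite leNgt; apply/negP => ha; apply: H; exists a.
  exists (Num.Def.archi_bound `|h x|).
  by rewrite (le_trans (ler_norm _))// ltW// archi_boundP.
pose F n := A `&` [set x | h x <= u n].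
have mF n : measurable (F n).
  apply: measurableI => //.
  have := mh measurableT _ (measurable_itv `]-oo, u n]).
  by rewrite setTI; congr measurable; apply/seteqP; split => x /=; rewrite in_itv.
have UF : \bigcup_n F n = A.
  apply/seteqP; split => x; first by move=> [n _ []].
  by move=> Ax; have [n xn] := uA _ Ax; exists n.
have cF : leb \o F @ \oo --> leb A.
  rewrite -UF; apply: nondecreasing_cvg_mu => //; first by rewrite UF.
  move=> n k nk; apply/subsetPset => x [Ax /= hx]; split => //=.
  by rewrite (le_trans hx)// u_ud.
have [n mn] : exists n, (m < leb (F n))%E.
  apply: contrapT => H.
  have : (leb A <= m)%E.
    rewrite -(cvg_lim _ cF)//; apply: lime_le; first by apply/cvg_ex; eexists; exact: cF.
    apply: nearW => n; rewrite leNgt; apply/negP => mn; apply: H; exists n; exact: mn.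
  by rewrite leNgt mltA.
have [a Aa ua] := uS n.
exists a => //; apply: (lt_le_trans mn); apply: le_measure; rewrite ?inE//.
  apply: measurableI => //.
  have := mh measurableT _ (measurable_itv `]-oo, h a]).
  by rewrite setTI; congr measurable; apply/seteqP; split => x /=; rewrite in_itv.
move=> x [Ax /= hx]; split => //=; exact: le_trans (ltW ua).
Qed.

Variables (t s : R).
Hypotheses (t0 : 0 < t) (s0 : 0 < s) (ts1 : t + s = 1).

(** If a = max A and b = min B, then the sets t A + s b and t a + s B lie in C, on
   either side of t a + s b, so the sum of their measures is at most that of C.
   In general A and B are first cut at points a and b where almost nothing is
   lost. *)
Lemma brunn_minkowski1 (A B C : set mR) :
  measurable A -> measurable B -> measurable C -> A !=set0 -> B !=set0 ->
  (forall x y, A x -> B y -> C (t * x + s * y)) ->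
  (t%:E * leb A + s%:E * leb B <= leb C)%E.
Proof.
move=> mA mB mC A0 B0 ABC.
have key a b : A a -> B b -> (t%:E * leb (A `&` [set x | x <= a]%R) +
    s%:E * leb (B `&` [set x | - x <= - b]%R) <= leb C)%E.
  move=> Aa Bb.
  set A1 := A `&` _; set B1 := B `&` _.
  have mA1 : measurable A1.
    apply: measurableI => //.
    by have := measurable_itv `]-oo, a]; congr measurable; apply/seteqP;
       split => x /=; rewrite in_itv.
  have mB1 : measurable B1.
    apply: measurableI => //.
    by have := measurable_itv `[b, +oo[; congr measurable; apply/seteqP;
       split => x /=; rewrite in_itv/= lerN2 andbT.
  pose C1 := affine t^-1 (- (s * b / t)) @^-1` A1.
  pose C2 := affine s^-1 (- (t * a / s)) @^-1` B1.
  have mC1 : measurable C1.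
    by rewrite -[C1]setTI; apply: measurable_affine.
  have mC2 : measurable C2.
    by rewrite -[C2]setTI; apply: measurable_affine.
  have -> : (t%:E * leb A1 = leb C1)%E.
    rewrite (@lebesgue_measure_affine t^-1 (- (s * b / t)) A1) ?invr_gt0//.
    by rewrite muleA -EFinM mulfV ?mul1e// lt0r_neq0.
  have -> : (s%:E * leb B1 = leb C2)%E.
    rewrite (@lebesgue_measure_affine s^-1 (- (t * a / s)) B1) ?invr_gt0//.
    by rewrite muleA -EFinM mulfV ?mul1e// lt0r_neq0.
  pose p := t * a + s * b.
  have -> : leb C2 = leb (C2 `\ p).
    apply/eqP; rewrite eq_le; apply/andP; split; last first.
      by apply: le_measure; rewrite ?inE//; exact: measurableD.
    have {1}-> : C2 = (C2 `\ p) `|` (C2 `&` [set p]) by rewrite setUC setUIDK.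
    apply: (le_trans (measureU2 _ _ _)); [exact: measurableD|exact: measurableI|].
    rewrite -[leRHS]adde0 leeD2l//.
    have <- : leb [set p] = 0%E by rewrite lebesgue_measure_set1.
    by apply: le_measure; rewrite ?inE//; exact: measurableI.
  have mC2p : measurable (C2 `\ p) by exact: measurableD.
  rewrite -measureU//; last first.
    apply/seteqP; split => // z [[/= _ za] [[_ /= zb] zp]].
    apply: zp => /=.
    move: za zb; rewrite /affine lerN2 => za zb.
    have h1 : z <= t * a + s * b.
      move: za; rewrite -(ler_pM2l t0) mulrDr mulrA mulfV ?lt0r_neq0// mul1r.
      by rewrite mulrN mulrCA mulfV ?lt0r_neq0// mulr1 lerBlDr.
    have h2 : t * a + s * b <= z.
      move: zb; rewrite -(ler_pM2l s0) mulrDr mulrA mulfV ?lt0r_neq0// mul1r.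
      by rewrite mulrN mulrCA mulfV ?lt0r_neq0// mulr1 lerBrDr addrC.
    by apply/eqP; rewrite eq_le h1.
  apply: le_measure; rewrite ?inE//; first exact: measurableU.
  move=> z [[Az _]|[[Bz _] _]].
    have -> : z = t * (t^-1 * z - s * b / t) + s * b.
      by field; exact: lt0r_neq0.
    exact: ABC.
  have -> : z = t * a + s * (s^-1 * z - t * a / s).
    by field; exact: lt0r_neq0.
  exact: ABC.
have mN : measurable_fun setT (fun x : mR => - x : R) by exact: oppr_measurable.
have mI : measurable_fun setT (fun x : mR => x : R) by exact: measurable_id.
apply/lee_addgt0Pr => e e0.
have big (m : \bar R) : ((forall r : R, (r%:E < m)%E -> (r%:E <= leb C)%E) -> (m <= leb C)%E).
  case: m => [m| |] H.
  - apply/lee_subgt0Pr => d d0; apply: H; rewrite lte_fin; lra.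
  - by rewrite leye_eq; apply/eqP/eqyP => r r0; apply: H; rewrite ltry.
  - by rewrite leNye.
rewrite -[leLHS]adde0 leeD// ?lee_fin ?(ltW e0)//.
have LA := measure_ge0 leb A; have LB := measure_ge0 leb B.
apply: big => r.
move=> rlt.
have [r1 [r2 [r12 h1 h2]]] : exists r1 r2 : R, [/\ r <= t * r1 + s * r2,
    (r1%:E < leb A)%E & (r2%:E < leb B)%E].
  have noo (z : \bar R) : (0 <= z)%E -> (exists r, z = r%:E) \/ z = +oo%E.
    by case: z => [z| |]// _; [left; exists z|right].
  move: rlt; have [[x ->]|->] := noo _ LA; have [[y ->]|->] := noo _ LB.
  - rewrite -!EFinM -EFinD lte_fin => rlt.
    pose d := (t * x + s * y - r).
    have d0 : 0 < d by rewrite /d; lra.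
    exists (x - d), (y - d); rewrite !lte_fin; split; [|lra|lra].
    have -> : t * (x - d) + s * (y - d) = t * x + s * y - (t + s) * d by ring.
    by rewrite ts1 /d; lra.
  - move=> _; exists (x - 1), ((r - t * (x - 1)) / s); rewrite lte_fin ltry; split => //; last lra.
    by rewrite [s * _]mulrC divfK ?lt0r_neq0//; lra.
  - move=> _; exists ((r - s * (y - 1)) / t), (y - 1); rewrite lte_fin ltry; split => //; last lra.
    by rewrite [t * _]mulrC divfK ?lt0r_neq0//; lra.
  - move=> _; exists (r / t), 0; rewrite !ltry; split => //.
    by rewrite [t * _]mulrC divfK ?lt0r_neq0//; lra.
have [a Aa ha] := exists_sublevel_measure_gt mA mI A0 h1.
have [b Bb hb] := exists_sublevel_measure_gt mB mN B0 h2.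
apply: le_trans (key a b Aa Bb).
apply: (@le_trans _ _ (t%:E * r1%:E + s%:E * r2%:E)%E).
  by rewrite -!EFinM -EFinD lee_fin.
by apply: leeD; rewrite lee_pmul2l ?lte_fin// ltW.
Qed.

(** The layer-cake formula for levels below 1; these are the levels at which the
   superlevel sets of a function with supremum 1 are nonempty, as
   Brunn-Minkowski requires. *)
Lemma layer_cake_min (f : mR -> \bar R) :
  measurable_fun setT f -> (forall x, 0 <= f x)%E ->
  (\int[leb]_x mine 1 (f x) =
   \int[leb]_(l in `[0%R, 1%R[) leb [set x | (l%:E < f x)%E])%E.
Proof.
move=> mf f0.
pose E : set (mR * mR) := [set z | (z.2%:E < f z.1)%E] `&` (setT `*` `[0%R, 1%R[).
have mE : measurable E.
  apply: measurableI; last by apply: measurableX.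
  rewrite (_ : mkset _ = [set z | (0 < f z.1 - z.2%:E)%E]); last first.
    by apply/seteqP; split => z; rewrite /mkset sube_gt0.
  rewrite -[X in measurable X]setTI; apply: emeasurable_fun_o_infty => //.
  apply: emeasurable_funB; first exact: (measurableT_comp mf measurable_fst).
  by apply/measurable_EFinP; exact: measurable_snd.
have := indic_fubini_tonelli leb leb mE.
rewrite indic_fubini_tonelli_FE// indic_fubini_tonelli_GE//= => EFG.
transitivity (\int[leb]_x (leb \o xsection E) x)%E.
  apply: eq_integral => x _ /=.
  have [m [m0 -> EM]] : exists m : R, [/\ 0 <= m, mine 1%E (f x) = m%:E &
      forall l : R, (l < m) = ((l < 1) && (l%:E < f x)%E)].
    have := f0 x; case: (f x) => [r| |]//.
    - rewrite lee_fin => r0; exists (Num.min 1 r); split.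
      + by rewrite le_min ler01.
      + by rewrite -EFin_min.
      + by move=> l; rewrite lt_min lte_fin.
    - move=> _; exists 1; split => //; first by rewrite minEle leey.
      by move=> l; rewrite ltry andbT.
  have -> : xsection E x = `[0, m[%classic.
    apply/seteqP; split => l; rewrite /xsection /= in_itv/= ?inE /E /= ?in_itv/= EM.
      by move=> [-> [_ /andP[-> ->]]].
    by move=> /and3P[-> -> ->].
  rewrite lebesgue_measure_itv /= lte_fin.
  case: ifPn => [_|]; first by rewrite sube0.
  by rewrite -leNgt => m0'; congr EFin; apply/eqP; rewrite eq_le m0 m0'.
rewrite EFG [RHS]integral_mkcond; apply: eq_integral => l _ /=.
rewrite patchE; case: ifPn => [|/negP].
  rewrite inE /= => l01; congr (leb _); apply/seteqP; split => x; rewrite /ysection /= inE /E /=.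
    by case.
  by move=> lf; split.
rewrite inE /= => l01; rewrite (_ : ysection _ _ = set0) ?measure0//.
by apply/seteqP; split => x //; rewrite /ysection /= inE /E /= => -[_ []].
Qed.

End one_dimensional.

(** * The Prekopa-Leindler inequality *)

Lemma ln_le_sub1 {R : realType} (y : R) : 0 < y -> ln y <= y - 1.
Proof.
by move=> y0; rewrite -[y in ln y](subrKC 1) le_ln1Dx// ltrBrDl subrr.
Qed.

Section prekopa_leindler.
Context {R : realType}.
Local Notation mR := (measurableTypeR R).
Local Notation leb := (@lebesgue_measure R).
Variables (t s : R).
Hypotheses (t0 : 0 < t) (s0 : 0 < s) (ts1 : t + s = 1).

(** The logarithm lies below its tangent at t x + s y; add the two inequalities at
   [x] and [y] with weights t and s. *)
Lemma weighted_AMGM (x y : R) : 0 <= x -> 0 <= y -> x `^ t * y `^ s <= t * x + s * y.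
Proof.
rewrite le_eqVlt => /predU1P[<-|x0].
  by move=> y0; rewrite powR0 ?lt0r_neq0// mul0r mulr0 add0r mulr_ge0// ltW.
rewrite le_eqVlt => /predU1P[<-|y0].
  by rewrite powR0 ?lt0r_neq0// mulr0 mulr0 addr0 mulr_ge0// ltW.
set m := t * x + s * y.
have m0 : 0 < m by rewrite /m addr_gt0// mulr_gt0.
have lnle (z : R) : 0 < z -> ln z <= ln m + (z / m - 1).
  move=> z0; rewrite -lerBlDl -ln_div ?posrE//.
  by rewrite ln_le_sub1// divr_gt0.
rewrite /powR !gt_eqF// -expRD -[leRHS]lnK ?posrE// ler_expR.
apply: (@le_trans _ _ (t * (ln m + (x / m - 1)) + s * (ln m + (y / m - 1)))).
  by apply: lerD; rewrite ler_pM2l// lnle.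
have -> : t * (ln m + (x / m - 1)) + s * (ln m + (y / m - 1)) =
  (t + s) * ln m + ((t * x + s * y) / m - (t + s)).
  by field; exact: lt0r_neq0.
by rewrite ts1 mul1r -/m divff ?lt0r_neq0// subrr addr0.
Qed.

Lemma weighted_AMGM_ereal (x y : \bar R) : (0 <= x -> 0 <= y ->
  x `^ t * y `^ s <= t%:E * x + s%:E * y)%E.
Proof.
case: x => [x| |]//; case: y => [y| |]//.
- by rewrite !lee_fin => x0 y0; rewrite weighted_AMGM.
- move=> x0 _; rewrite [(s%:E * _)%E]gt0_muley ?lte_fin// addey ?leey//.
- move=> _ y0; rewrite [(t%:E * _)%E]gt0_muley ?lte_fin// addye ?leey//.
- by move=> _ _; rewrite [(s%:E * _)%E]gt0_muley ?lte_fin// addey ?leey// gt0_muley ?lte_fin.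
Qed.

(** Reduces a bound on X^t Y^s, where [X] or [Y] may be infinite, to finite values
   strictly below them. *)
Lemma poweR_mul_le_of_lt (X Y W : \bar R) : (0 <= X -> 0 <= Y -> 0 <= W ->
  (forall x y : R, (0 < x)%R -> (0 < y)%R -> x%:E < X -> y%:E < Y ->
     (x `^ t * y `^ s)%R%:E <= W) ->
  X `^ t * Y `^ s <= W)%E.
Proof.
move=> X0 Y0 W0 H.
have [->|XN0] := eqVneq X 0%E; first by rewrite poweR0r ?lt0r_neq0// mul0e.
have [->|YN0] := eqVneq Y 0%E; first by rewrite poweR0r ?lt0r_neq0// mule0.
have Xp : (0 < X)%E by rewrite lt0e XN0.
have Yp : (0 < Y)%E by rewrite lt0e YN0.
have pos (Z : \bar R) : (0 < Z)%E -> exists2 z : R, 0 < z & (z%:E < Z)%E.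
  case: Z => [z| |]//; last by exists 1 => //; rewrite ltry.
  by rewrite lte_fin => z0; exists (z / 2); rewrite ?lte_fin; lra.
case: W W0 H => [w| |]// w0 H; last by rewrite leey.
rewrite lee_fin in w0.
case: X X0 Xp XN0 H => [X| |]// X0 Xp XN0 H; last first.
  exfalso; have [y y0 yY] := pos _ Yp.
  have := H (((w + 1) / y `^ s) `^ t^-1) y.
  rewrite powR_gt0 ?divr_gt0 ?powR_gt0 ?ltr_wpDl// y0 ltry yY => /(_ isT isT isT isT).
  rewrite -powRrM mulVf ?lt0r_neq0// powRr1 ?divr_ge0 ?powR_ge0 ?addr_ge0//.
  by rewrite divfK ?lt0r_neq0 ?powR_gt0// lee_fin; lra.
case: Y Y0 Yp YN0 H => [Y| |]// Y0 Yp YN0 H; last first.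
  exfalso; have [x x0 xX] := pos _ Xp.
  have := H x (((w + 1) / x `^ t) `^ s^-1).
  rewrite x0 powR_gt0 ?divr_gt0 ?powR_gt0 ?ltr_wpDl// ltry xX => /(_ isT isT isT isT).
  rewrite -powRrM mulVf ?lt0r_neq0// powRr1 ?divr_ge0 ?powR_ge0 ?addr_ge0//.
  by rewrite mulrC divfK ?lt0r_neq0 ?powR_gt0// lee_fin; lra.
rewrite !poweR_EFin -EFinM lee_fin leNgt; apply/negP => wP.
move: Xp Yp; rewrite !lte_fin => Xp Yp.
set P := X `^ t * Y `^ s in wP.
have P0 : 0 < P by rewrite mulr_gt0// powR_gt0.
pose c := (P + w) / (2 * P).
have c0 : 0 < c by rewrite /c divr_gt0//; lra.
have c1 : c < 1 by rewrite /c ltr_pdivrMr//; lra.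
have cX : ((c * X)%:E < X%:E)%E by rewrite lte_fin gtr_pMl.
have cY : ((c * Y)%:E < Y%:E)%E by rewrite lte_fin gtr_pMl.
have := H _ _ (mulr_gt0 c0 Xp) (mulr_gt0 c0 Yp) cX cY.
rewrite (powRM _ (ltW c0) (ltW Xp)) (powRM _ (ltW c0) (ltW Yp)).
have -> : c `^ t * X `^ t * (c `^ s * Y `^ s) = (c `^ t * c `^ s) * P.
  by rewrite /P mulrACA.
rewrite -powRD ?(lt0r_neq0 c0) ?implybT// ts1 powRr1 ?(ltW c0)//.
have -> : c * P = (P + w) / 2 by rewrite /c; field; exact: lt0r_neq0.
rewrite lee_fin; lra.
Qed.

Lemma measurable_superlevel (f : mR -> \bar R) : measurable_fun setT f ->
  forall l : \bar R, measurable [set x | (l < f x)%E].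
Proof.
move=> mf l; rewrite -[X in measurable X]setTI.
exact: emeasurable_fun_o_infty.
Qed.

Lemma measurable_distribution (f : mR -> \bar R) : measurable_fun setT f ->
  measurable_fun setT (fun l : mR => leb [set x | (l%:E < f x)%E]).
Proof.
move=> mf.
pose E : set (mR * mR) := [set z | (z.2%:E < f z.1)%E].
have mE : measurable E.
  rewrite (_ : E = [set z | (0 < f z.1 - z.2%:E)%E]); last first.
    by apply/seteqP; split => z; rewrite /E /mkset sube_gt0.
  rewrite -[X in measurable X]setTI; apply: emeasurable_fun_o_infty => //.
  apply: emeasurable_funB; first exact: (measurableT_comp mf measurable_fst).
  by apply/measurable_EFinP; exact: measurable_snd.
rewrite (_ : (fun _ => _) = leb \o ysection E); first exact: measurable_fun_ysection.
apply/funext => l /=; congr (leb _); apply/seteqP; split => x; rewrite /ysection /= inE //.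
Qed.

(** When both suprema are 1, every level l < 1 has nonempty superlevel sets, and
   t {f > l} + s {g > l} is contained in {h > l}; integrate Brunn-Minkowski over
   the levels. *)
Lemma prekopa_leindler1_normalized (f g h : mR -> \bar R) :
  measurable_fun setT f -> measurable_fun setT g -> measurable_fun setT h ->
  (forall x, 0 <= f x <= 1)%E -> (forall x, 0 <= g x <= 1)%E -> (forall x, 0 <= h x)%E ->
  (forall l : R, l < 1 -> exists x, (l%:E < f x)%E) ->
  (forall l : R, l < 1 -> exists x, (l%:E < g x)%E) ->
  (forall x y, f x `^ t * g y `^ s <= h (t * x + s * y)%R)%E ->
  (t%:E * \int[leb]_x f x + s%:E * \int[leb]_x g x <= \int[leb]_x h x)%E.
Proof.
move=> mf mg mh f01 g01 h0 f1 g1 fgh.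
have lc (k : mR -> \bar R) : measurable_fun setT k -> (forall x, 0 <= k x <= 1)%E ->
   (\int[leb]_x k x = \int[leb]_(l in `[0%R, 1%R[) leb [set x | (l%:E < k x)%E])%E.
  move=> mk k01; rewrite -layer_cake_min// => [|x]; last by case/andP: (k01 x).
  by apply: eq_integral => x _; rewrite min_r//; case/andP: (k01 x).
have md (k : mR -> \bar R) : measurable_fun setT k ->
    measurable_fun (`[(0 : R), (1 : R)[%classic : set mR) (fun l : mR => leb [set x | (l%:E < k x)%E]).
  move=> mk; apply: measurable_funS (measurable_distribution mk) => //.
have hZ (c : R) (k : mR -> \bar R) : 0 <= c -> measurable_fun setT k ->
    (c%:E * \int[leb]_(l in `[0%R, 1%R[) leb [set x | l%:E < k x] =
    \int[leb]_(l in `[0%R, 1%R[) (c%:E * leb [set x | l%:E < k x]))%E.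
  by move=> c0 mk; rewrite ge0_integralZl_EFin//; exact: md.
rewrite (lc f mf f01) (lc g mg g01) (hZ t f (ltW t0) mf) (hZ s g (ltW s0) mg).
rewrite -ge0_integralD//; first last.
- exact: measurable_funeM (md _ mg).
- by move=> l _; rewrite mule_ge0// lee_fin ltW.
- exact: measurable_funeM (md _ mf).
- by move=> l _; rewrite mule_ge0// lee_fin ltW.
apply: (@le_trans _ _ (\int[leb]_x mine 1 (h x))%E); last first.
  apply: ge0_le_integral => //.
  - by move=> x _; rewrite le_min lee01 h0.
  - exact: measurable_mine.
  - by move=> x _; rewrite ge_min lexx orbT.
rewrite layer_cake_min//; apply: ge0_le_integral => //.
- by move=> l _; rewrite adde_ge0// mule_ge0// lee_fin ltW.
- by apply: emeasurable_funD; apply: measurable_funeM; exact: md.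
- exact: md.
move=> l /=; rewrite in_itv/= => /andP[l0 l1].
apply: brunn_minkowski1 => //; try exact: measurable_superlevel.
- exact: f1.
- exact: g1.
move=> x y /= lf lg; apply: lt_le_trans (fgh x y).
case/andP: (f01 x); case/andP: (g01 y).
move: lf lg; case: (f x) => [a| |]//; case: (g y) => [b| |]//.
rewrite !lte_fin !lee_fin => la lb b0 b1 a0 a1.
have -> : l = l `^ t * l `^ s.
  rewrite -powRD ?ts1 ?powRr1//.
  by rewrite gt_eqF.
by apply: ltr_pM; rewrite ?powR_ge0// gt0_ltr_powR ?nnegrE// ltW.
Qed.

(** Dividing [f] and [g] by their suprema reduces to the normalized case, whose
   additive conclusion is stronger than the multiplicative one by the weighted
   arithmetic-geometric inequality. *)
Lemma prekopa_leindler1_bounded (f g h : mR -> \bar R) (M : R) :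
  measurable_fun setT f -> measurable_fun setT g -> measurable_fun setT h ->
  (forall x, 0 <= f x <= M%:E)%E -> (forall x, 0 <= g x <= M%:E)%E ->
  (forall x, 0 <= h x)%E ->
  (forall x y, f x `^ t * g y `^ s <= h (t * x + s * y)%R)%E ->
  ((\int[leb]_x f x) `^ t * (\int[leb]_x g x) `^ s <= \int[leb]_x h x)%E.
Proof.
move=> mf mg mh f0M g0M h0 fgh.
have f0 x : (0 <= f x)%E by case/andP: (f0M x).
have g0 x : (0 <= g x)%E by case/andP: (g0M x).
have [fz|fnz] := pselect (forall x, f x = 0%E).
  under eq_integral do rewrite fz.
  by rewrite integral0 poweR0r ?lt0r_neq0// mul0e integral_ge0.
have [gz|gnz] := pselect (forall x, g x = 0%E).
  under [X in (_ * X `^ _)%E]eq_integral do rewrite gz.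
  by rewrite integral0 poweR0r ?(lt0r_neq0 s0)// mule0 integral_ge0.
have bsup (k : mR -> \bar R) : (forall x, 0 <= k x <= M%:E)%E -> ~ (forall x, k x = 0%E) ->
    exists a : R, [/\ 0 < a, (forall x, k x <= a%:E)%E &
      forall l : R, l < a -> exists x, (l%:E < k x)%E].
  move=> k0M knz.
  have kE x : k x = (fine (k x))%:E.
    by case/andP: (k0M x); case: (k x).
  have bS : has_ubound (range (fine \o k)).
    by exists M => _ [x _ <-]; rewrite /= -lee_fin -kE; case/andP: (k0M x).
  have ub x : fine (k x) <= sup (range (fine \o k)).
    by apply: ub_le_sup => //; exists x.
  exists (sup (range (fine \o k))); split.
  - have [x kx] : exists x, k x != 0%E.
      by apply: contrapT => H; apply: knz => x; apply: contrapT => /eqP kx; apply: H; exists x.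
    apply: lt_le_trans (ub x).
    rewrite -lte_fin -kE lt0e kx; by case/andP: (k0M x).
  - by move=> x; rewrite kE lee_fin.
  - move=> l lsup.
    have [|_ [x _ <-] xl] := sup_gt _ lsup; first by exists (fine (k 0)), 0.
    by exists x; rewrite kE lte_fin.
have [a [a0 fa af]] := bsup f f0M fnz.
have [b [b0 gb bg]] := bsup g g0M gnz.
pose A := (a^-1 `^ t * b^-1 `^ s).
have A0 : 0 < A by rewrite mulr_gt0// powR_gt0// invr_gt0.
have norm (k : mR -> \bar R) c : 0 < c -> (forall x, 0 <= k x)%E -> (forall x, k x <= c%:E)%E ->
    forall x, (0 <= c^-1%:E * k x <= 1)%E.
  move=> c0 k0 kc x; rewrite mule_ge0 ?lee_fin ?invr_ge0 ?(ltW c0)//=.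
  rewrite -[leRHS](_ : (c^-1%:E * c%:E)%E = 1%E); last by rewrite -EFinM mulVf ?lt0r_neq0.
  by rewrite lee_pmul2l// lte_fin invr_gt0.
have norms (k : mR -> \bar R) c : 0 < c ->
    (forall l : R, l < c -> exists x, (l%:E < k x)%E) ->
    forall l : R, l < 1 -> exists x, (l%:E < c^-1%:E * k x)%E.
  move=> c0 H l l1; have [|x lx] := H (c * l); first by rewrite gtr_pMr.
  exists x; rewrite -(@lte_pmul2l _ c%:E)// ?lte_fin//.
  by rewrite muleA -!EFinM mulfV ?lt0r_neq0// mul1e.
have := @prekopa_leindler1_normalized (fun x => a^-1%:E * f x)%E
  (fun x => b^-1%:E * g x)%E (fun x => A%:E * h x)%E
  (measurable_funeM _ mf) (measurable_funeM _ mg) (measurable_funeM _ mh)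
  (norm _ _ a0 f0 fa) (norm _ _ b0 g0 gb).
have Ah0 x : (0 <= A%:E * h x)%E by rewrite mule_ge0// lee_fin ltW.
move=> /(_ Ah0 (norms _ _ a0 af) (norms _ _ b0 bg)).
have cond x y : ((a^-1%:E * f x) `^ t * (b^-1%:E * g y) `^ s <= A%:E * h (t * x + s * y)%R)%E.
  rewrite !poweRM ?lee_fin ?invr_ge0 ?(ltW a0) ?(ltW b0)// !poweR_EFin.
  by rewrite muleACA -EFinM lee_pmul2l ?lte_fin// fgh.
move=> /(_ cond).
rewrite !ge0_integralZl_EFin ?invr_ge0 ?(ltW a0) ?(ltW b0) ?(ltW A0)// => H.
have If0 : (0 <= \int[leb]_x f x)%E by exact: integral_ge0.
have Ig0 : (0 <= \int[leb]_x g x)%E by exact: integral_ge0.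
rewrite -(@lee_pmul2l _ A%:E) ?lte_fin//.
apply: le_trans H.
apply: le_trans (weighted_AMGM_ereal _ _); last 2 first.
  by rewrite mule_ge0// lee_fin invr_ge0 ltW.
  by rewrite mule_ge0// lee_fin invr_ge0 ltW.
rewrite !poweRM ?lee_fin ?invr_ge0 ?(ltW a0) ?(ltW b0)// !poweR_EFin.
by rewrite muleACA -EFinM.
Qed.

(** Truncation at height n and monotone convergence. *)
Lemma prekopa_leindler1 (f g h : mR -> \bar R) :
  measurable_fun setT f -> measurable_fun setT g -> measurable_fun setT h ->
  (forall x, 0 <= f x)%E -> (forall x, 0 <= g x)%E -> (forall x, 0 <= h x)%E ->
  (forall x y, f x `^ t * g y `^ s <= h (t * x + s * y)%R)%E ->
  ((\int[leb]_x f x) `^ t * (\int[leb]_x g x) `^ s <= \int[leb]_x h x)%E.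
Proof.
move=> mf mg mh f0 g0 h0 fgh.
pose tr (k : mR -> \bar R) n x := mine (k x) n%:R%:E.
have mtr k n : measurable_fun setT k -> measurable_fun setT (tr k n).
  by move=> mk; exact: measurable_mine.
have tr0 k n : (forall x, 0 <= k x)%E -> forall x, (0 <= tr k n x)%E.
  by move=> k0 x; rewrite /tr le_min k0 lee_fin ler0n.
have trle k n x : (tr k n x <= k x)%E by rewrite ge_min lexx.
have trn k n x : (tr k n x <= n%:R%:E)%E by rewrite ge_min lexx orbT.
have trcvg k (r : R) : measurable_fun setT k -> (forall x, 0 <= k x)%E ->
    (r%:E < \int[leb]_x k x)%E -> \forall n \near \oo, (r%:E < \int[leb]_x tr k n x)%E.
  move=> mk k0 rk.
  have : (\int[leb]_x tr k n x @[n --> \oo] --> \int[leb]_x k x)%E.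
    have lk x : tr k n x @[n --> \oo] --> k x.
      have := k0 x; rewrite /tr; case: (k x) => [y| |]//.
        move=> _; apply: cvg_near_cst.
        exists (Num.Def.archi_bound `|y|) => // n /= yn.
        apply/eqP; rewrite min_l// lee_fin (le_trans (ler_norm _))// ltW//.
        by rewrite (lt_le_trans (archi_boundP _))// ler_nat.
      move=> _; under eq_fun do rewrite min_r ?leey//.
      by apply/cvgenyP.
    rewrite [X in _ --> X](_ : _ = \int[leb]_x limn (fun n => tr k n x))%E; last first.
      by apply: eq_integral => x _; apply/esym/cvg_lim.
    apply: cvg_monotone_convergence => //.
    - by move=> n; exact: mtr.
    - by move=> n x _; exact: tr0.
    - move=> x _ n m nm; rewrite le_min trle/= (le_trans (trn _ _ _))//.
      by rewrite lee_fin ler_nat.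
  move=> /(_ [set z | (r%:E < z)%E]) /=; apply.
  by apply: open_nbhs_nbhs; split => //; exact: open_ereal_gt_ereal.
apply: poweR_mul_le_of_lt; [exact: integral_ge0..|].
move=> x y x0 y0 xf yg.
near \oo => n.
have xn : (x%:E < \int[leb]_x tr f n x)%E by near: n; exact: trcvg.
have yn : (y%:E < \int[leb]_x tr g n x)%E by near: n; exact: trcvg.
have H : ((\int[leb]_x tr f n x) `^ t * (\int[leb]_x tr g n x) `^ s <=
    \int[leb]_x h x)%E.
  apply: (@prekopa_leindler1_bounded _ _ _ n%:R) => //.
  - exact: mtr.
  - exact: mtr.
  - by move=> z; rewrite tr0// trn.
  - by move=> z; rewrite tr0// trn.
  move=> z w; apply: le_trans (fgh z w).
  by apply: lee_pmul; rewrite ?poweR_ge0//; apply: gt0_ler_poweR;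
    rewrite ?(ltW t0) ?(ltW s0)// ?in_itv/= ?andbT ?leey ?tr0 ?f0 ?g0.
apply: le_trans H; rewrite EFinM -!poweR_EFin.
by apply: lee_pmul; rewrite ?poweR_ge0//; apply: gt0_ler_poweR;
  rewrite ?(ltW t0) ?(ltW s0)// ?in_itv/= ?andbT ?leey ?lee_fin ?(ltW x0) ?(ltW y0)//
    ?integral_ge0 ?(ltW xn) ?(ltW yn)// => ? _; exact: tr0.
Unshelve. all: end_near. Qed.

(** Induction on the dimension: for fixed first components the one-dimensional
   inequality says that the marginals of [f], [g], [h] satisfy the hypothesis
   again. *)
Lemma prekopa_leindler n (f g h : 'rV[R]_n -> \bar R) :
  measurable_fun setT f -> measurable_fun setT g -> measurable_fun setT h ->
  (forall x, 0 <= f x)%E -> (forall x, 0 <= g x)%E -> (forall x, 0 <= h x)%E ->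
  (forall x y, f x `^ t * g y `^ s <= h (t *: x + s *: y)%R)%E ->
  ((\int[lebesgue_rV n]_x f x) `^ t * (\int[lebesgue_rV n]_x g x) `^ s <=
    \int[lebesgue_rV n]_x h x)%E.
Proof.
elim: n f g h => [|n ih] f g h mf mg mh f0 g0 h0 fgh.
  rewrite /= !integral_dirac// !diracT !mul1e.
  by have := fgh 0 0; rewrite !scaler0 addr0.
rewrite !integral_lebesgue_rVS//.
apply: ih; try exact: measurable_marginal.
- by move=> x; apply: integral_ge0.
- by move=> x; apply: integral_ge0.
- by move=> x; apply: integral_ge0.
move=> x x'.
apply: prekopa_leindler1; rewrite ?t0 ?s0//; try exact: measurable_section.
move=> y y'; have := fgh (cons_rV (x, y)) (cons_rV (x', y')).
congr (_ <= h _)%E.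
apply/rowP => i; rewrite [LHS]mxE [X in X + _ = _]mxE [X in _ + X = _]mxE.
case: (unliftP ord0 i) => [k ->|->]; last by rewrite !cons_rV0.
rewrite !cons_rVS; apply/esym; rewrite [LHS]mxE.
by rewrite [X in X + _ = _]mxE [X in _ + X = _]mxE.
Qed.

End prekopa_leindler.

(** * Twice differentiable functions of a row vector *)

Section dot_product.
Context {R : realType} {d : nat}.
Implicit Types u v w : 'rV[R]_d.

Lemma dotE u v : dot u v = \sum_i u ord0 i * v ord0 i.
Proof. by rewrite /dot !mxE; apply: eq_bigr => i _; rewrite mxE. Qed.

Lemma dotC u v : dot u v = dot v u.
Proof. by rewrite !dotE; apply: eq_bigr => i _; rewrite mulrC. Qed.

Lemma dotDl u v w : dot (u + v) w = dot u w + dot v w.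
Proof. by rewrite !dotE -big_split; apply: eq_bigr => i _; rewrite mxE mulrDl. Qed.

Lemma dotZl (k : R) u v : dot (k *: u) v = k * dot u v.
Proof. by rewrite !dotE mulr_sumr; apply: eq_bigr => i _; rewrite mxE mulrA. Qed.

Lemma dotDr u v w : dot w (u + v) = dot w u + dot w v.
Proof. by rewrite dotC dotDl !(dotC w). Qed.

Lemma dotZr (k : R) u v : dot u (k *: v) = k * dot u v.
Proof. by rewrite dotC dotZl (dotC u). Qed.

Lemma dot_ge0 u : 0 <= dot u u.
Proof. by rewrite dotE sumr_ge0// => i _; rewrite -expr2 sqr_ge0. Qed.

Lemma dot_coord_le u i : u ord0 i ^+ 2 <= dot u u.
Proof.
rewrite dotE (bigD1 i)//= -expr2 lerDl sumr_ge0// => j _.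
by rewrite -expr2 sqr_ge0.
Qed.

End dot_product.

Section second_order_calculus.
Context {R : realType} {d : nat}.
Local Notation V := 'rV[R]_d.
Implicit Types (f g : V -> R) (u v w x z : V).

Lemma derive_dot f x v : differentiable f x -> 'D_v f x = dot (grad f x) v.
Proof.
move=> df; rewrite deriveE// {1}(row_sum_delta v) linear_sum /= dotE.
by apply: eq_bigr => i _; rewrite linearZ /= mxE /partial deriveE// mulrC.
Qed.

(** C^2 in terms of directional derivatives along all vectors, which is the form
   in which closure under products and composition is proved. *)
Definition C2 f := [/\ forall x, differentiable f x,
  forall v x, differentiable ('D_v f) x &
  forall v w, continuous ('D_w ('D_v f))].

Lemma smooth_C2 f : smooth_on setT f -> C2 f.
Proof.
move=> sf; split.
- by move=> x; exact: (sf [::]).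
- by move=> v x; exact: (sf [:: v]).
- by move=> v w x; apply: differentiable_continuous; exact: (sf [:: w; v]).
Qed.

Lemma C2_differentiable f x : C2 f -> differentiable f x.
Proof. by case. Qed.

Lemma C2_derivable f x v : C2 f -> derivable f x v.
Proof. by move=> [df _ _]; exact: diff_derivable. Qed.

Lemma C2_continuous f : C2 f -> continuous f.
Proof. by move=> [df _ _] x; apply: differentiable_continuous. Qed.

Lemma C2_derive_continuous f v : C2 f -> continuous ('D_v f).
Proof. by move=> [_ df _] x; apply: differentiable_continuous. Qed.

Lemma C2_cst (k : R) : C2 (fun=> k).
Proof.
have D0 (c : R) v : 'D_v (fun _ : V => c) = (fun _ : V => (0 : R)).
  by apply/funext => x; exact: derive_cst.
split=> [x|v x|v w]; first exact: differentiable_cst.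
  by rewrite D0; exact: differentiable_cst.
by rewrite !D0 => x; exact: cst_continuous.
Qed.

Lemma derive_coord (i : 'I_d) v x : 'D_v (fun x : V => x ord0 i) x = v ord0 i.
Proof.
have := @derive_mx _ _ _ _ id x v (@derivable_id _ _ x v).
by rewrite derive_id => /rowP/(_ i) ->; rewrite mxE.
Qed.

Lemma derive_mul f g x v : differentiable f x -> differentiable g x ->
  'D_v (fun x => f x * g x) x = f x * 'D_v g x + g x * 'D_v f x.
Proof. by move=> df dg; apply: deriveM; exact: diff_derivable. Qed.

Lemma derive_add f g x v : differentiable f x -> differentiable g x ->
  'D_v (fun x => f x + g x) x = 'D_v f x + 'D_v g x.
Proof. by move=> df dg; apply: deriveD; exact: diff_derivable. Qed.

Lemma continuous_add f g : continuous f -> continuous g -> continuous (fun x => f x + g x).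
Proof. by move=> cf cg x; exact: (@continuousD _ _ _ f g x (cf x) (cg x)). Qed.

Lemma continuous_mul f g : continuous f -> continuous g -> continuous (fun x => f x * g x).
Proof. by move=> cf cg x; exact: (@continuousM _ _ f g x (cf x) (cg x)). Qed.

Lemma differentiable_add f g x : differentiable f x -> differentiable g x ->
  differentiable (fun x => f x + g x) x.
Proof. exact: differentiableD. Qed.

Lemma differentiable_mul f g x : differentiable f x -> differentiable g x ->
  differentiable (fun x => f x * g x) x.
Proof. exact: differentiableM. Qed.

Lemma C2D f g : C2 f -> C2 g -> C2 (fun x => f x + g x).
Proof.
move=> Cf Cg; have [df ddf cf] := Cf; have [dg ddg cg] := Cg.
have DE v : 'D_v (fun x => f x + g x) = (fun x => 'D_v f x + 'D_v g x).
  by apply/funext => x; exact: derive_add.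
split=> [x|v x|v w].
- exact: differentiable_add.
- by rewrite DE; apply: (differentiable_add (f := 'D_v f)).
- have -> : 'D_w ('D_v (fun x => f x + g x)) =
      (fun x => 'D_w ('D_v f) x + 'D_w ('D_v g) x).
    by apply/funext => x; rewrite DE (derive_add (f := 'D_v f)).
  exact: continuous_add.
Qed.

Lemma C2M f g : C2 f -> C2 g -> C2 (fun x => f x * g x).
Proof.
move=> Cf Cg; have [df ddf cf] := Cf; have [dg ddg cg] := Cg.
have DE v : 'D_v (fun x => f x * g x) = (fun x => f x * 'D_v g x + g x * 'D_v f x).
  by apply/funext => x; exact: derive_mul.
have d1 v x : differentiable (fun x => f x * 'D_v g x) x.
  exact: differentiable_mul.
have d2 v x : differentiable (fun x => g x * 'D_v f x) x.
  exact: differentiable_mul.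
split=> [x|v x|v w].
- exact: differentiable_mul.
- by rewrite DE; exact: (differentiable_add (d1 v x) (d2 v x)).
- have -> : 'D_w ('D_v (fun x => f x * g x)) = (fun x =>
      (f x * 'D_w ('D_v g) x + 'D_v g x * 'D_w f x) +
      (g x * 'D_w ('D_v f) x + 'D_v f x * 'D_w g x)).
    apply/funext => x; rewrite DE (derive_add _ (d1 v x) (d2 v x)).
    by rewrite (derive_mul _ (df x) (ddg v x)) (derive_mul _ (dg x) (ddf v x)).
  have Df u : continuous ('D_u f) by exact: C2_derive_continuous.
  have Dg u : continuous ('D_u g) by exact: C2_derive_continuous.
  have cf0 := C2_continuous Cf; have cg0 := C2_continuous Cg.
  by apply: continuous_add; apply: continuous_add; apply: continuous_mul.
Qed.

Lemma derive_comp (phi phi1 : R -> R) f x v : differentiable f x ->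
  is_derive (f x) 1 phi (phi1 (f x)) ->
  'D_v (fun x => phi (f x)) x = phi1 (f x) * 'D_v f x.
Proof.
move=> df [dp Dp].
have dp' : differentiable phi (f x) by exact/derivable1_diffP.
rewrite (deriveE (f := phi \o f)); last exact: differentiable_comp.
rewrite diff_comp//= diff1E// derive1E Dp deriveE//.
by rewrite /GRing.scale /= mulrC.
Qed.

Lemma C2_comp (phi phi1 phi2 : R -> R) f : C2 f ->
  (forall x, is_derive (f x) 1 phi (phi1 (f x))) ->
  (forall x, is_derive (f x) 1 phi1 (phi2 (f x))) ->
  (forall x, {for f x, continuous phi2}) ->
  C2 (fun x => phi (f x)).
Proof.
move=> Cf d1 d2 c2; have [df ddf cf] := Cf.
have dp1 x : differentiable phi (f x) by apply/derivable1_diffP; case: (d1 x).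
have dp2 x : differentiable phi1 (f x) by apply/derivable1_diffP; case: (d2 x).
have DE v : 'D_v (fun x => phi (f x)) = (fun x => phi1 (f x) * 'D_v f x).
  by apply/funext => x; exact: derive_comp.
have dc x : differentiable (fun x => phi1 (f x)) x.
  by apply: (differentiable_comp (g := phi1)).
have cf0 := C2_continuous Cf.
split=> [x|v x|v w].
- by apply: (differentiable_comp (g := phi)).
- by rewrite DE; exact: (differentiable_mul (dc x) (ddf v x)).
- have -> : 'D_w ('D_v (fun x => phi (f x))) = (fun x => phi1 (f x) * 'D_w ('D_v f) x +
      'D_v f x * (phi2 (f x) * 'D_w f x)).
    apply/funext => x; rewrite DE (derive_mul _ (dc x) (ddf v x)).
    by rewrite (derive_comp _ (df x) (d2 x)).
  have Df u : continuous ('D_u f) by exact: C2_derive_continuous.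
  apply: continuous_add; apply: continuous_mul => //.
  + move=> x; apply: (continuous_comp (g := phi1)); first exact: cf0.
    exact: differentiable_continuous.
  + apply: continuous_mul; last exact: (Df w).
    by move=> x; apply: (continuous_comp (g := phi2)); [exact: cf0|exact: c2].
Qed.

Lemma is_derive_line f z v (th : R) : derivable f (z + th *: v) v ->
  is_derive th 1 (fun s : R => f (z + s *: v)) ('D_v f (z + th *: v)).
Proof.
move=> df.
have E : (fun h : R => h^-1 *: (((fun s : R => f (z + s *: v)) \o shift th) (h *: (1 : R)) -
      f (z + th *: v))) =
    (fun h : R => h^-1 *: ((f \o shift (z + th *: v)) (h *: v) - f (z + th *: v))).
  apply/funext => h /=; congr (_ *: (f _ - _)).
  by rewrite [h%:A]mulr1 scalerDl addrCA.
apply: DeriveDef; first by rewrite /derivable E.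
by rewrite /derive E.
Qed.

(** An upper bound on the second derivative alone gives the one-sided Taylor
   estimate, by two applications of the mean value theorem. *)
Lemma taylor2_le (phi phi1 phi2 : R -> R) (M : R) :
  (forall th : R, is_derive th 1 phi (phi1 th)) ->
  (forall th : R, is_derive th 1 phi1 (phi2 th)) ->
  (forall th : R, phi2 th <= M) ->
  phi 1 <= phi 0 + phi1 0 + M / 2.
Proof.
move=> d1 d2 hM.
have c1 (x : R) : {for x, continuous phi}.
  by apply: differentiable_continuous; apply/derivable1_diffP; case: (d1 x).
have c2 (x : R) : {for x, continuous phi1}.
  by apply: differentiable_continuous; apply/derivable1_diffP; case: (d2 x).
have bound (th : R) : 0 <= th -> phi1 th <= phi1 0 + M * th.
  move=> th0.
  have [c _] : exists2 c, c \in `[0, th]%R & phi1 th - phi1 0 = phi2 c * (th - 0).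
    by apply: MVT_segment => //; apply: continuous_subspaceT.
  rewrite subr0 => /(canRL (subrK _)) ->.
  by rewrite addrC lerD2l ler_wpM2r.
pose psi (th : R) := phi th - (phi1 0 * th + M / 2 * th ^+ 2).
have dpsi (th : R) : is_derive th 1 psi (phi1 th - (phi1 0 + M * th)).
  rewrite /psi.
  have h1 : is_derive th 1 (fun th => phi1 0 * th + M / 2 * th ^+ 2)
      (phi1 0 + M * th).
    apply: is_derive_eq.
    rewrite /GRing.scale /= !mulr1; lra.
  exact: is_deriveB.
have [c] : exists2 c, c \in `[0, 1]%R &
    psi 1 - psi 0 = (phi1 c - (phi1 0 + M * c)) * (1 - 0).
  apply: MVT_segment => //.
  apply: continuous_subspaceT => x; apply: differentiable_continuous.
  by apply/derivable1_diffP; case: (dpsi x).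
rewrite in_itv/= => /andP[c0 _].
have := bound c c0.
rewrite /psi subr0 mulr1 !mulr0 expr0n/= !mulr0 expr1n !mulr1; lra.
Qed.

Lemma second_order_le f M : C2 f ->
  (forall x v, 'D_v ('D_v f) x <= M * dot v v) ->
  forall x z, f x <= f z + dot (grad f z) (x - z) + M / 2 * dot (x - z) (x - z).
Proof.
move=> Cf HM x z; have [df ddf _] := Cf.
pose v := x - z.
have := @taylor2_le (fun th => f (z + th *: v)) (fun th => 'D_v f (z + th *: v))
  (fun th => 'D_v ('D_v f) (z + th *: v)) (M * dot v v).
have -> : z + 1 *: v = x by rewrite scale1r /v addrC subrK.
rewrite scale0r addr0 (derive_dot _ (df z)) -/v.
rewrite [M / 2 * _]mulrAC; apply.
- by move=> th; apply: is_derive_line; exact: diff_derivable.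
- by move=> th; apply: is_derive_line; exact: diff_derivable.
- by move=> th; exact: HM.
Qed.

Lemma derive2E f v x : C2 f ->
  'D_v ('D_v f) x = \sum_i \sum_j v ord0 i * (v ord0 j * partial i (partial j f) x).
Proof.
move=> Cf; have [df ddf _] := Cf.
rewrite derive_dot// dotE; apply: eq_bigr => i _.
rewrite mxE {1}/partial.
have -> : 'D_v f = \sum_j (v ord0 j *: partial j f).
  apply/funext => y; rewrite fct_sumE derive_dot// dotE.
  by apply: eq_bigr => j _; rewrite mxE mulrC.
rewrite derive_sum; last by move=> j; apply: derivableZ; apply: diff_derivable; exact: ddf.
rewrite mulrC mulr_sumr; apply: eq_bigr => j _.
by rewrite deriveZ//; apply: diff_derivable; exact: ddf.
Qed.

Lemma dot_hessian f v x (K : R) : C2 f -> loewner_le K%:M (hessian f x) ->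
  K * dot v v <= 'D_v ('D_v f) x.
Proof.
move=> Cf /(_ v); rewrite mulmxBr mul_mx_scalar.
rewrite dotDl -scaleNr dotZl mulNr subr_ge0 => /le_trans; apply.
rewrite derive2E// dotE exchange_big /=; apply: ler_sum => j _.
rewrite mxE mulr_suml; apply: ler_sum => i _.
rewrite mxE; lra.
Qed.

(** The second-order Taylor bound applied to [- f], whose second derivatives are
   at most [- K]. *)
Lemma strongly_convex_ge f (K : R) : C2 f -> (forall x, loewner_le K%:M (hessian f x)) ->
  forall x z, f z + dot (grad f z) (x - z) + K / 2 * dot (x - z) (x - z) <= f x.
Proof.
move=> Cf HK x z.
have Cn : C2 (fun x => (-1) * f x) := C2M (C2_cst (-1)) Cf.
have DN v y : 'D_v (fun x => (-1) * f x) y = - 'D_v f y.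
  have -> : (fun x => (-1) * f x) = - f by apply/funext => y'; rewrite mulN1r.
  by rewrite deriveN//; exact: C2_derivable.
have := @second_order_le _ (- K) Cn _ x z.
have -> : grad (fun x => (-1) * f x) z = (-1) *: grad f z.
  by apply/rowP => i; rewrite !mxE /partial DN mulN1r.
rewrite dotZl => H.
suff : -1 * f x <= -1 * f z + -1 * dot (grad f z) (x - z) +
  - K / 2 * dot (x - z) (x - z) by lra.
apply: H => y v.
have -> : 'D_v (fun x => (-1) * f x) = - 'D_v f by apply/funext => y'; rewrite DN.
rewrite deriveN; last by case: Cf => _ + _ => /(_ v y) /diff_derivable.
by rewrite mulNr lerN2 dot_hessian.
Qed.

Lemma bounded_of_support (h : V -> R) (rho : R) : continuous h ->
  (forall x, rho < dot x x -> h x = 0) -> exists2 B, 0 <= B & forall x, `|h x| <= B.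
Proof.
move=> ch h0.
pose A := [set x : V | forall i, x ord0 i \in `[(- (`|rho| + 1)), (`|rho| + 1)]].
have cA : compact A.
  apply: (@rV_compact _  _ (fun=> `[(- (`|rho| + 1)), (`|rho| + 1)]%classic)).
  by move=> _; exact: segment_compact.
have /compact_bounded [M [_ HM]] : compact (h @` A).
  by apply: continuous_compact => //; apply: continuous_subspaceT.
exists (`|M| + 1); first by rewrite addr_ge0.
move=> x; have [xr|xr] := ltP rho (dot x x); first by rewrite h0// normr0 addr_ge0.
apply: (HM (`|M| + 1)); first by rewrite (le_lt_trans (ler_norm _))// ltrDl.
exists x => // i; rewrite in_itv /= -ler_norml.
have := le_trans (dot_coord_le x i) xr.
rewrite -[_ ^+ 2]real_normK ?num_real// => H.
have [//|] := leP `|x ord0 i| (`|rho| + 1).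
move=> /[dup] /ltW h1 h2; exfalso.
have h3 := ler_norm rho.
have h4 : 0 <= `|rho| by [].
nra.
Qed.

Lemma C2_coord (i : 'I_d) : C2 (fun x : V => x ord0 i).
Proof.
have DE v : 'D_v (fun x : V => x ord0 i) = (fun=> v ord0 i).
  by apply/funext => x; exact: derive_coord.
split=> [x|v x|v w]; first exact: differentiable_coord.
  by rewrite DE; exact: differentiable_cst.
by rewrite DE; exact: C2_derive_continuous (C2_cst _).
Qed.

Lemma C2_dot : C2 (fun x : V => dot x x).
Proof.
have -> : (fun x : V => dot x x) = (fun x => \sum_i x ord0 i * x ord0 i).
  by apply/funext => x; rewrite dotE.
elim: (index_enum _) => [|i s ih].
  by rewrite (_ : (fun _ => _) = fun=> 0); [exact: C2_cst|apply/funext => x; rewrite big_nil].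
rewrite (_ : (fun _ => _) = fun x : V => x ord0 i * x ord0 i + \sum_(i <- s) x ord0 i * x ord0 i).
  exact: C2D (C2M (C2_coord i) (C2_coord i)) ih.
by apply/funext => x; rewrite big_cons.
Qed.

Lemma derive_dotxx v x : 'D_v (fun x : V => dot x x) x = 2 * dot x v.
Proof.
rewrite derive_dot; last exact: C2_differentiable C2_dot.
rewrite !dotE mulr_sumr; apply: eq_bigr => i _; rewrite mxE /partial.
have -> : (fun x : V => dot x x) = (fun x => \sum_j x ord0 j * x ord0 j).
  by apply/funext => y; rewrite dotE.
have -> : (fun x : V => \sum_j x ord0 j * x ord0 j) = \sum_j (fun x : V => x ord0 j * x ord0 j).
  by apply/funext => y; rewrite fct_sumE.
rewrite derive_sum; last by move=> j; apply: C2_derivable; apply: (C2M (C2_coord j) (C2_coord j)).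
rewrite (bigD1 i)//= big1 => [|j ji].
  rewrite derive_mul; try exact: differentiable_coord.
  by rewrite !derive_coord mxE !eqxx /=; ring.
rewrite derive_mul; try exact: differentiable_coord.
by rewrite derive_coord mxE (negbTE ji) andbF mulr0n; ring.
Qed.

Lemma derive_support (h : V -> R) (rho : R) v :
  (forall x, rho < dot x x -> h x = 0) -> forall x, rho < dot x x -> 'D_v h x = 0.
Proof.
move=> h0 x xr.
have : \forall y \near x, h y = (fun=> 0) y.
  have : \forall y \near x, rho < dot y y.
    have /(_ x) := C2_continuous C2_dot; move=> /cvgr_gt; exact.
  by apply: filterS => y; exact: h0.
by move=> /(near_eq_derive v) ->; exact: derive_cst.
Qed.

Lemma second_order_bound f rho : C2 f -> (forall x, rho < dot x x -> f x = 0) ->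
  exists2 M, 0 <= M & forall x v, 'D_v ('D_v f) x <= M * dot v v.
Proof.
move=> Cf f0; have [_ _ cf] := Cf.
have /choice[B HB] : forall ij : 'I_d * 'I_d, exists B : R,
    forall x, `|partial ij.1 (partial ij.2 f) x| <= B.
  move=> [i j] /=; have [B _ HB] := @bounded_of_support (partial i (partial j f)) rho
    (cf _ _) (@derive_support _ _ _ (@derive_support _ _ _ f0)).
  by exists B.
have B0 ij : 0 <= B ij by apply: le_trans (HB ij 0).
exists (\sum_i \sum_j B (i, j)); first by apply: sumr_ge0 => i _; exact: sumr_ge0.
move=> x v; rewrite derive2E// mulr_suml; apply: ler_sum => i _.
rewrite mulr_suml; apply: ler_sum => j _.
apply: (le_trans (ler_norm _)); rewrite mulrA normrM mulrC.
apply: ler_pM => //; first exact: (HB (i, j)).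
rewrite normrM.
have hi := dot_coord_le v i; have hj := dot_coord_le v j.
have := sqr_ge0 (`|v ord0 i| - `|v ord0 j|).
rewrite -[v ord0 i ^+ 2]real_normK ?num_real// in hi.
rewrite -[v ord0 j ^+ 2]real_normK ?num_real// in hj.
rewrite sqrrB; lra.
Qed.

End second_order_calculus.

(** * Integrals of real-valued functions *)

Section real_integrals.
Context {R : realType} d (T : measurableType d) (mu : {measure set T -> \bar R}).

Lemma Rintegral_linear (a b : R) (f g : T -> R) :
  mu.-integrable setT (EFin \o f) -> mu.-integrable setT (EFin \o g) ->
  mu.-integrable setT (EFin \o (fun x => a * f x + b * g x)) /\
  \int[mu]_x (a * f x + b * g x) = a * \int[mu]_x f x + b * \int[mu]_x g x.
Proof.
move=> fi gi; have i1 := integrableZl measurableT a fi.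
have i2 := integrableZl measurableT b gi.
split; first by have := integrableD measurableT i1 i2.
by rewrite RintegralD// !RintegralZl.
Qed.

Lemma Rdominated_convergence (f_ : nat -> T -> R) (f g : T -> R) :
  (forall n, measurable_fun setT (f_ n)) -> measurable_fun setT f ->
  (forall x, f_ n x @[n --> \oo] --> f x) ->
  mu.-integrable setT (EFin \o g) -> (forall n x, `|f_ n x| <= g x) ->
  mu.-integrable setT (EFin \o f) /\
  \int[mu]_x f_ n x @[n --> \oo] --> \int[mu]_x f x.
Proof.
move=> mf_ mf ff ig fg.
have [] := @dominated_convergence _ _ _ mu setT measurableT
  (fun n x => (f_ n x)%:E) (EFin \o f) (EFin \o g).
- by move=> n; apply/measurable_EFinP.
- exact/measurable_EFinP.
- by apply: aeW => x _; apply/fine_cvgP; split; [exact: nearW|exact: ff].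
- exact: ig.
- by apply: aeW => x n _; rewrite lee_fin.
move=> iff _ H; split => //.
have : (fine (\int[mu]_x (f_ n x)%:E) @[n --> \oo] --> fine (\int[mu]_x (f x)%:E))%E.
  apply: fine_cvg; rewrite fineK//; exact: integrable_fin_num.
by [].
Qed.

Lemma Rfatou (f_ : nat -> T -> R) (f : T -> R) (c_ : nat -> R) (c : R) :
  (forall n, mu.-integrable setT (EFin \o f_ n)) -> (forall n x, 0 <= f_ n x) ->
  (forall x, f_ n x @[n --> \oo] --> f x) ->
  mu.-integrable setT (EFin \o f) ->
  (forall n, \int[mu]_x f_ n x <= c_ n) -> c_ n @[n --> \oo] --> c ->
  \int[mu]_x f x <= c.
Proof.
move=> if_ f0 ff iff fc cc.
have mf n : measurable_fun setT (fun x => (f_ n x)%:E).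
  by have /integrableP[] := if_ n.
have H := @fatou _ _ _ mu setT measurableT (fun n x => (f_ n x)%:E) mf.
have {}H : (\int[mu]_x limn_einf (fun n => (f_ n x)%:E) <=
    limn_einf (fun n => \int[mu]_x (f_ n x)%:E))%E.
  by apply: H => n x _; rewrite lee_fin; exact: f0.
have E : (\int[mu]_x limn_einf (fun n => (f_ n x)%:E) = \int[mu]_x (f x)%:E)%E.
  apply: eq_integral => x _.
  have ffE : ((f_ n x)%:E @[n --> \oo] --> (f x)%:E)%E.
    by apply/fine_cvgP; split; [exact: nearW|exact: ff].
  rewrite is_cvg_limn_einfE; first exact: cvg_lim ffE.
  by apply/cvg_ex; exists (f x)%:E.
have ccE : ((c_ n)%:E @[n --> \oo] --> c%:E)%E.
  by apply/fine_cvgP; split; [exact: nearW|exact: cc].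
have H2 : (limn_einf (fun n => \int[mu]_x (f_ n x)%:E) <= c%:E)%E.
  rewrite limn_einf_lim -(cvg_lim _ ccE)//.
  apply: lee_lim; first exact: is_cvg_einfs.
    by apply/cvg_ex; exists c%:E.
  apply: nearW => n; apply: (le_trans (y := (\int[mu]_x (f_ n x)%:E)%E)).
    by apply: ereal_inf_lbound; exists n => /=.
  rewrite -[leLHS]fineK; last exact: integrable_fin_num (if_ n).
  by rewrite lee_fin; exact: fc.
have := le_trans H H2; rewrite E -[X in (X <= _)%E]fineK; last exact: integrable_fin_num iff.
by rewrite lee_fin.
Qed.

End real_integrals.

(** * Logarithmic Sobolev inequality for bounded semiconcave functions *)

Section strongly_log_concave.
Context {R : realType} {d : nat}.
Local Notation V := 'rV[R]_d.
Local Notation mu := (@lebesgue_rV R d).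

Lemma expR_le_inv (x : R) : x < 1 -> expR x <= (1 - x)^-1.
Proof.
move=> x1; rewrite -[expR x]invrK -expRN lef_pV2 ?posrE ?expR_gt0 ?subr_gt0//.
exact: expR_ge1Dx.
Qed.

(** Writing 1 / F as exp (- ln F) reduces to continuous functions. *)
Lemma measurable_inv_pos (F : V -> R) : (forall x, 0 < F x) ->
  measurable_fun setT F -> measurable_fun setT (fun x => (F x)^-1).
Proof.
move=> F0 mF.
rewrite (_ : (fun _ => _) = fun x => expR (- ln (F x))); last first.
  by apply/funext => x; rewrite expRN lnK ?posrE.
by do 2 apply: measurableT_comp => //; apply: measurableT_comp.
Qed.

(** The numerical end of the proof of [entropy_le_normalized]. There Ur, W, I and
   Ent are the integrals of F^(1/t), F e^(c N), |grad F|^2 / F and F ln F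
   against q, and Ur^t <= W is what Prekopa-Leindler gives for s = 1 - t. Both sides are 1 + O(s);
   the first-order terms compare Ent with I / 2K, and the errors of order s^2 are
   absorbed in the last constant. *)
Lemma entropy_bound_arith (s t c D K L N0 I Ent Ur W : R) :
  0 < s -> s <= 1 / 2 -> t = 1 - s -> D = 2 * (K * t - s * L) -> c = s / D ->
  0 < D -> 0 <= L -> 0 <= N0 -> 0 <= I -> 0 < Ent ->
  s * (2 * K + 2 * L + N0 + 2 * I) < 2 * K ->
  0 < 1 - c * N0 -> 0 <= Ur -> Ur `^ t <= W -> 1 + s / t * Ent <= Ur ->
  W <= 1 + c / (1 - c * N0) * I -> 1 <= W ->
  Ent * (2 * K - s * (2 * K + 2 * L + N0 + 2 * I)) <= I.
Proof.
move=> s0 s12 tE DE cE D0 L0 N00 I0 E0 sC P0 U0 UW U_ge W_le W_ge.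
have t0 : 0 < t by lra.
have sN : 0 <= s * N0 by rewrite mulr_ge0// ltW.
have sI : 0 <= s * I by rewrite mulr_ge0// ltW.
have sL : 0 <= s * L by rewrite mulr_ge0// ltW.
have sCE : s * (2 * K + 2 * L + N0 + 2 * I) =
  s * (2 * K) + 2 * (s * L) + s * N0 + 2 * (s * I) by ring.
have UW' : Ur <= W `^ t^-1.
  have := @ge0_ler_powR _ t^-1 _ (Ur `^ t) W _ _ UW.
  rewrite -powRrM mulfV ?lt0r_neq0// powRr1//; apply.
  - by rewrite invr_ge0 ltW.
  - by rewrite nnegrE powR_ge0.
  - by rewrite nnegrE; lra.
pose b := (W - 1) / t; pose b' := c * I / ((1 - c * N0) * t).
have bb' : b <= b'.
  rewrite /b /b' invfM mulrA ler_pM2r ?invr_gt0// lerBlDl.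
  by apply: (le_trans W_le); rewrite lerD2l mulrAC.
have b'1 : b' < 1.
  rewrite /b' ltr_pdivrMr ?mulr_gt0// mul1r.
  have -> : c * I = s * I / D by rewrite cE; ring.
  have -> : (1 - c * N0) * t = (D - s * N0) * t / D by rewrite cE; field; rewrite lt0r_neq0.
  rewrite ltr_pM2r ?invr_gt0//.
  have h : 2 * (s * I) < D - s * N0 by rewrite DE tE; move: sC; rewrite sCE; lra.
  have h2 : (2 * (s * I)) * t < (D - s * N0) * t by rewrite ltr_pM2r.
  apply: le_lt_trans h2.
  have : 1 / 2 <= t by rewrite tE; lra.
  nra.
have WtE : W `^ t^-1 <= (1 - b)^-1.
  apply: le_trans (expR_le_inv _); last lra.
  rewrite /powR gt_eqF ?(lt_le_trans _ W_ge)// ler_expR /b mulrC ler_pM2r ?invr_gt0//.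
  by rewrite ln_le_sub1// (lt_le_trans ltr01).
have b'E : (1 - b)^-1 <= (1 - b')^-1 
  by rewrite lef_pV2 ?posrE ?subr_gt0 ?lerD2l ?lerN2// (le_lt_trans bb').
have key : 1 + s / t * Ent <= (1 - b')^-1.
  exact: le_trans U_ge (le_trans UW' (le_trans WtE b'E)).
have key2 : (1 + s / t * Ent) * (1 - b') <= 1.
  have b'0 : 0 < 1 - b' by rewrite subr_gt0.
  by have := ler_wpM2r (ltW b'0) key; rewrite mulVf// lt0r_neq0.
have b'e : b' * ((1 - c * N0) * t) = c * I.
  by rewrite /b' divfK// lt0r_neq0// mulr_gt0.
have cD : c * D = s by rewrite cE divfK// lt0r_neq0.
have key3 : s * Ent * (1 - b') <= t * b'.
  have -> : s * Ent * (1 - b') = t * (((1 + s / t * Ent) * (1 - b')) - (1 - b')).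
    by field; rewrite lt0r_neq0.
  rewrite ler_pM2l//; lra.
have key4 : s * Ent * ((1 - c * N0) * t - c * I) <= t * (c * I).
  have := ler_wpM2r (ltW (mulr_gt0 P0 t0)) key3.
  have -> : s * Ent * (1 - b') * ((1 - c * N0) * t) =
    s * Ent * ((1 - c * N0) * t - b' * ((1 - c * N0) * t)) by ring.
  have -> : t * b' * ((1 - c * N0) * t) = t * (b' * ((1 - c * N0) * t)) by ring.
  by rewrite b'e.
have key5 : Ent * ((D - s * N0) * t - s * I) <= t * I.
  have := ler_wpM2r (ltW D0) key4.
  have -> : s * Ent * ((1 - c * N0) * t - c * I) * D =
    s * (Ent * ((D - (c * D) * N0) * t - (c * D) * I)) by ring.
  have -> : t * (c * I) * D = (c * D) * (t * I) by ring.
  by rewrite cD ler_pM2l.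
have key6 : Ent * ((2 * K - s * (2 * K + 2 * L + N0 + 2 * I)) * t) <= t * I.
  apply: le_trans key5; rewrite ler_pM2l//.
  rewrite sCE DE.
  have : s * I <= 2 * (s * I) * t by rewrite tE; nra.
  rewrite tE; lra.
by move: key6; rewrite mulrA [t * I]mulrC ler_pM2r.
Qed.

Variables (U : V -> R) (K : R) (gU : V -> V).
Hypotheses (K0 : 0 < K) (cU : continuous U).
Hypothesis convU : forall x z,
  U z + dot (gU z) (x - z) + K / 2 * dot (x - z) (x - z) <= U x.
Hypothesis normU : (\int[mu]_x (gibbs U x)%:E = 1)%E.
Local Notation q := (gibbs U).

Lemma gibbs_gt0 x : 0 < q x. Proof. exact: expR_gt0. Qed.

Lemma measurable_gibbs : measurable_fun setT q.
Proof.
apply: measurableT_comp => //; apply: measurableT_comp => //.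
exact: continuous_measurable_rV.
Qed.

Lemma integrable_gibbs : mu.-integrable setT (EFin \o q).
Proof.
apply/integrableP; split; first by apply/measurable_EFinP; exact: measurable_gibbs.
under eq_integral do rewrite /= ger0_norm ?(ltW (gibbs_gt0 _))//.
by rewrite normU ltry.
Qed.

Lemma integrable_mul_gibbs (k : V -> R) (B : R) : measurable_fun setT k ->
  (forall x, `|k x| <= B) -> mu.-integrable setT (EFin \o (fun x => k x * q x)).
Proof.
move=> mk kB; apply: (@le_integrable _ _ _ mu setT _ _ (EFin \o (fun x => B * q x))).
- exact: measurableT.
- by apply/measurable_EFinP; apply: measurable_funM => //; exact: measurable_gibbs.
- move=> x _ /=; rewrite lee_fin !normrM ler_wpM2r//.
  exact: le_trans (kB x) (ler_norm _).
- rewrite (_ : _ \o _ = fun x => (B%:E * (EFin \o q) x)%E).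
    by apply: integrableZl => //; exact: integrable_gibbs.
  by apply/funext => x /=; rewrite EFinM.
Qed.

(** The supporting paraboloids at the point t x + s y, evaluated at [x] and [y];
   the linear terms cancel. *)
Lemma strongly_convex_mean t s x y : 0 < t -> 0 < s -> t + s = 1 ->
  U (t *: x + s *: y) + K / 2 * (t * s) * dot (x - y) (x - y) <= t * U x + s * U y.
Proof.
move=> t0 s0 ts; set z := t *: x + s *: y.
have xz : x - z = s *: (x - y).
  rewrite /z scalerBr opprD addrA -{1}[x]scale1r -ts scalerDl.
  by rewrite [t *: x + _]addrC addrK.
have yz : y - z = - t *: (x - y).
  rewrite /z scaleNr scalerBr opprB opprD addrCA addrC.
  by rewrite -{1}[y]scale1r -ts scalerDl addrK.
have := convU x z; have := convU y z.
rewrite xz yz !dotZr !dotZl => h1 h2.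
have : s * (U z + - t * dot (gU z) (x - y) +
    K / 2 * (- t * (- t * dot (x - y) (x - y)))) <= s * U y by rewrite ler_pM2l.
have : t * (U z + s * dot (gU z) (x - y) +
    K / 2 * (s * (s * dot (x - y) (x - y)))) <= t * U x by rewrite ler_pM2l.
have -> : s = 1 - t by lra.
nra.
Qed.

Lemma integrable_entropy (F : V -> R) (G : V -> V) (e B L2 : R) : 0 < e ->
  measurable_fun setT F -> measurable_fun setT (fun x => dot (G x) (G x)) ->
  (forall x, e <= F x <= B) -> (forall x, dot (G x) (G x) <= L2) ->
  [/\ mu.-integrable setT (EFin \o (fun x => F x * q x)),
      mu.-integrable setT (EFin \o (fun x => F x * ln (F x) * q x)) &
      mu.-integrable setT (EFin \o (fun x => dot (G x) (G x) / F x * q x))].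
Proof.
move=> e0 mF mG FB GB.
have F0 x : 0 < F x by case/andP: (FB x) => + _; exact: lt_le_trans.
have FB' x : `|F x| <= B by rewrite gtr0_norm//; case/andP: (FB x).
split; first exact: (@integrable_mul_gibbs _ B).
- apply: (@integrable_mul_gibbs _ (B * (`|ln e| + `|ln B|))).
    by apply: measurable_funM => //; exact: measurableT_comp.
  move=> x; rewrite normrM; apply: ler_pM => //.
  have B0 : 0 < B by apply: lt_le_trans (FB' x); rewrite gtr0_norm.
  have h1 : ln e <= ln (F x) by rewrite ler_ln ?posrE//; case/andP: (FB x).
  have h2 : ln (F x) <= ln B by rewrite ler_ln ?posrE//; case/andP: (FB x).
  have := ler_norm (ln B); have := ler_norm (- ln e); rewrite normrN => h3 h4.
  have := normr_ge0 (ln B); have := normr_ge0 (ln e) => h5 h6.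
  rewrite ler_norml; lra.
- apply: (@integrable_mul_gibbs _ (L2 / e)).
    by apply: measurable_funM => //; exact: measurable_inv_pos.
  move=> x; rewrite ger0_norm ?divr_ge0 ?dot_ge0 ?(ltW (F0 x))//.
  apply: ler_pM; rewrite ?dot_ge0 ?invr_ge0 ?(ltW (F0 x))//.
  by rewrite lef_pV2 ?posrE//; case/andP: (FB x).
Qed.

Section core.
Variables (F : V -> R) (G : V -> V) (e B L2 M : R).
Hypotheses (e0 : 0 < e) (M0 : 0 <= M).
Hypotheses (mF : measurable_fun setT F) (mG : measurable_fun setT (fun x => dot (G x) (G x))).
Hypothesis FB : forall x, e <= F x <= B.
Hypothesis GB : forall x, dot (G x) (G x) <= L2.
Hypothesis FG : forall x z, F x <= F z + dot (G z) (x - z) + M / 2 * dot (x - z) (x - z).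
Hypothesis F1 : \int[mu]_x (F x * q x) = 1.

Let F0 x : 0 < F x. Proof. by case/andP: (FB x) => + _; exact: lt_le_trans. Qed.
Let L := M / e.
Let N x := dot (G x) (G x) / F x ^+ 2.
Let N0 := L2 / e ^+ 2.

Let Nge0 x : 0 <= N x.
Proof. by rewrite divr_ge0 ?dot_ge0// exprn_ge0// ltW. Qed.

Let NN0 x : N x <= N0.
Proof.
apply: ler_pM => //; first exact: dot_ge0.
  by rewrite invr_ge0 exprn_ge0// ltW.
have eF : e <= F x by case/andP: (FB x).
by rewrite lef_pV2 ?posrE ?exprn_gt0// lerXn2r// ?nnegrE ?(ltW e0) ?(ltW (F0 x)).
Qed.

Let mN : measurable_fun setT N.
Proof.
apply: measurable_funM => //.
apply: measurable_inv_pos; first by move=> x; rewrite exprn_gt0.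
exact: measurable_funX.
Qed.

(** The logarithm inherits the second-order upper bound of [F], with its constant
   divided by the lower bound [e]: ln F x - ln F z <= F x / F z - 1. *)
Let lnF_le x z : ln (F x) <= ln (F z) + dot ((F z)^-1 *: G z) (x - z) +
   L / 2 * dot (x - z) (x - z).
Proof.
have Fz := F0 z; have Fx := F0 x.
have h1 : ln (F x) <= ln (F z) + (F x / F z - 1).
  by rewrite -lerBlDl -ln_div ?posrE// ln_le_sub1// divr_gt0.
apply: (le_trans h1); rewrite -addrA lerD2l dotZl.
have -> : F x / F z - 1 = (F x - F z) / F z by field; exact: lt0r_neq0.
have h2 : F x - F z <= dot (G z) (x - z) + M / 2 * dot (x - z) (x - z).
  by rewrite lerBlDl addrA.
apply: (@le_trans _ _ ((dot (G z) (x - z) + M / 2 * dot (x - z) (x - z)) / F z)).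
  by rewrite ler_pM2r ?invr_gt0.
rewrite mulrDl mulrC lerD2l /L.
have -> : M / e / 2 * dot (x - z) (x - z) = M / 2 * dot (x - z) (x - z) * e^-1 by ring.
apply: ler_wpM2l; first by rewrite mulr_ge0 ?dot_ge0// divr_ge0.
by rewrite lef_pV2 ?posrE//; case/andP: (FB z).
Qed.

Let I := \int[mu]_x (dot (G x) (G x) / F x * q x).
Let Ent := \int[mu]_x (F x * ln (F x) * q x).
Let C1 := 2 * K + 2 * L + N0 + 2 * I.

Let L0 : 0 <= L. Proof. by rewrite divr_ge0// ltW. Qed.
Let N00 : 0 <= N0. Proof. exact: le_trans (Nge0 0) (NN0 0). Qed.
Let q0 x : 0 <= q x. Proof. exact: ltW (gibbs_gt0 x). Qed.
Let I0 : 0 <= I.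
Proof.
apply: Rintegral_ge0 => x _; rewrite mulr_ge0// divr_ge0 ?dot_ge0//; exact: ltW.
Qed.

Let B0 : 0 < B.
Proof. by case/andP: (FB 0) => eF; apply: lt_le_trans; exact: lt_le_trans eF. Qed.

Let integrable_pow t : 0 < t ->
  mu.-integrable setT (EFin \o (fun x => F x `^ t^-1 * q x)).
Proof.
move=> t0; apply: (@integrable_mul_gibbs _ (B `^ t^-1)).
  by apply: (measurableT_comp (measurable_powR _)).
move=> x; rewrite ger0_norm ?powR_ge0//.
rewrite ge0_ler_powR ?nnegrE ?invr_ge0 ?(ltW t0) ?(ltW (F0 x)) ?(ltW B0)//.
by case/andP: (FB x).
Qed.

Let integrable_tilt c : 0 <= c ->
  mu.-integrable setT (EFin \o (fun x => F x * expR (c * N x) * q x)).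
Proof.
move=> c0; apply: (@integrable_mul_gibbs _ (B * expR (c * N0))).
  apply: measurable_funM => //; apply: measurableT_comp => //.
  by apply: measurable_funM.
move=> x; rewrite ger0_norm ?mulr_ge0 ?expR_ge0 ?(ltW (F0 x))//.
apply: ler_pM; rewrite ?expR_ge0 ?(ltW (F0 x))//; first by case/andP: (FB x).
by rewrite ler_expR ler_wpM2l.
Qed.

(** Prekopa-Leindler with F^(1/t) q, q and F e^(cN) q, where N = |grad ln F|^2. At
   z = t x + s y the difference ln F x - ln F z is at most
   s <grad ln F z, w> + O(s^2) |w|^2 with w = x - y, while strong convexity of U
   gains K t s |w|^2 / 2. Completing the square in w leaves c N z with
   c = s / (2 (K t - s L)). *)
Let pl_step s t c : 0 < s -> 0 < t -> t + s = 1 -> 0 < K * t - s * L ->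
  c = s / (2 * (K * t - s * L)) ->
  (\int[mu]_x (F x `^ t^-1 * q x)) `^ t <= \int[mu]_x (F x * expR (c * N x) * q x).
Proof.
move=> s0 t0 ts kap0 cE0.
have c0 : 0 <= c by rewrite cE0 divr_ge0 ?(ltW s0)// mulr_ge0// ltW.
have iu := integrable_pow t0; have iw := integrable_tilt c0.
have := @prekopa_leindler R t s t0 s0 ts d
  (fun x => (F x `^ t^-1 * q x)%:E) (fun x => (q x)%:E)
  (fun x => (F x * expR (c * N x) * q x)%:E)
  (measurable_int _ iu) (measurable_int _ integrable_gibbs) (measurable_int _ iw).
rewrite normU poweR1r mule1.
rewrite -(fineK (integrable_fin_num measurableT iu)) -(fineK (integrable_fin_num measurableT iw)).
rewrite poweR_EFin lee_fin; apply.
- by move=> x; rewrite lee_fin mulr_ge0// powR_ge0.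
- by move=> x; rewrite lee_fin.
- by move=> x; rewrite lee_fin !mulr_ge0 ?expR_ge0// ltW.
move=> x y; set z := t *: x + s *: y.
rewrite !poweR_EFin -EFinM lee_fin.
rewrite powRM ?powR_ge0// -powRrM mulVf ?lt0r_neq0// powRr1 ?(ltW (F0 x))//.
rewrite /gibbs -!expRM.
rewrite -{1}[F x]lnK ?posrE// -{1}[F z]lnK ?posrE// -!expRD ler_expR.
have h1 := lnF_le x z.
have h2 := strongly_convex_mean x y t0 s0 ts.
have xz : x - z = s *: (x - y).
  rewrite /z scalerBr opprD addrA -{1}[x]scale1r -ts scalerDl.
  by rewrite [t *: x + _]addrC addrK.
rewrite xz !dotZr !dotZl -/z in h1 h2.
set w := x - y in h1 h2.
(* the square to be completed: |grad ln F z - (K t - s L) w|^2 >= 0 *)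
have h3 : 0 <= dot (((F z)^-1 *: G z) - (K * t - s * L) *: w)
    (((F z)^-1 *: G z) - (K * t - s * L) *: w) by exact: dot_ge0.
rewrite -scaleNr dotDl !dotDr !dotZl !dotZr (dotC w) in h3.
have NE : N z = (F z)^-1 * ((F z)^-1 * dot (G z) (G z)).
  by rewrite /N expr2 invfM; ring.
rewrite -NE in h3.
have cE : c * N z = s * (N z / (2 * (K * t - s * L))).
  by rewrite cE0; ring.
set kap := K * t - s * L in kap0 h3 cE.
set X := (F z)^-1 * dot (G z) w in h1 h3.
have h4 : X - kap / 2 * dot w w <= N z / (2 * kap).
  rewrite ler_pdivlMr ?mulr_gt0//.
  have -> : (X - kap / 2 * dot w w) * (2 * kap) = 2 * kap * X - kap * kap * dot w w by field.
  have : 0 <= N z - 2 * kap * X + kap * kap * dot w w.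
    have eX : (F z)^-1 * (- kap * dot (G z) w) = - kap * X by rewrite /X mulrCA.
    by move: h3; rewrite eX; lra.
  lra.
have h5 : s * (X - (K * t - s * L) / 2 * dot w w) <= s * (N z / (2 * kap)).
  by rewrite ler_pM2l.
rewrite cE; move: h1 h2 h5.
clear h3 h4; clearbody X.
move: (ln (F x)) (ln (F z)) (dot w w) (s * (N z / (2 * kap))) (U x) (U y) (U z) L.
by move=> a1 a2 a3 a4 a5 a6 a7 a8; lra.
Qed.

(** By convexity of y^(1/t), int F^(1/t) q >= 1 + (s/t) Ent; and since N <= N0,
   int F e^(cN) q <= 1 + c / (1 - c N0) I. Together with [pl_step] this is the
   input of [entropy_bound_arith]. *)
Let small_step s : 0 < s -> s <= 1 / 2 -> s * C1 < 2 * K -> 0 < Ent ->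
  Ent * (2 * K - s * C1) <= I.
Proof.
move=> s0 s12 sC E0.
have sL : 0 <= s * L by rewrite mulr_ge0// ltW.
have sN : 0 <= s * N0 by rewrite mulr_ge0// ltW.
have sI : 0 <= s * I by rewrite mulr_ge0// ltW.
have sCE : s * C1 = s * (2 * K) + 2 * (s * L) + s * N0 + 2 * (s * I) by rewrite /C1; ring.
have kap0 : 0 < K * (1 - s) - s * L.
  move: sC; rewrite sCE; lra.
have s1 : s < 1 by lra.
pose t := 1 - s; pose D := 2 * (K * t - s * L); pose c := s / D.
have t0 : 0 < t by rewrite /t; lra.
have D0 : 0 < D by rewrite /D /t mulr_gt0.
have c0 : 0 <= c by rewrite divr_ge0// ltW.
have := pl_step s0 t0 (subrK _ _) kap0 erefl; rewrite -/t -/D -/c.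
set Ur := \int[mu]_x _; set W := \int[mu]_x _ => UW.
have cN0 : c * N0 < 1.
  rewrite /c mulrAC ltr_pdivrMr// mul1r /D /t; move: sC; rewrite sCE; lra.
have P0 : 0 < 1 - c * N0 by rewrite subr_gt0.
have [iF iE iI] := integrable_entropy e0 mF mG FB GB.
have iu := integrable_pow t0; have iw := integrable_tilt c0.
have U_ge : 1 + s / t * Ent <= Ur.
  have [i1 E1] := Rintegral_linear 1 (s / t) iF iE.
  rewrite -F1 -[X in X + _]mul1r -E1; apply: le_Rintegral => // x _.
  rewrite mul1r mulrA -mulrDl ler_wpM2r//.
  have -> : F x `^ t^-1 = F x * expR (s / t * ln (F x)).
    have tE : t^-1 = 1 + s / t.
      by apply: (mulfI (lt0r_neq0 t0)); rewrite mulrDr mulrCA !divff ?lt0r_neq0// !mulr1 subrK.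
    rewrite /powR gt_eqF// [X in expR (X * _) = _]tE.
    by rewrite mulrDl mul1r expRD lnK ?posrE.
  have -> : F x + s / t * (F x * ln (F x)) = F x * (1 + s / t * ln (F x)) by ring.
  by rewrite ler_pM2l// expR_ge1Dx.
have W_le : W <= 1 + c / (1 - c * N0) * I.
  have [i1 E1] := Rintegral_linear 1 (c / (1 - c * N0)) iF iI.
  have -> : 1 + c / (1 - c * N0) * I = 1 * \int[mu]_x (F x * q x) + c / (1 - c * N0) * I.
    by rewrite F1 mul1r.
  rewrite -E1; apply: le_Rintegral => // x _.
  rewrite mul1r mulrA -mulrDl ler_wpM2r//.
  have -> : F x + c / (1 - c * N0) * (dot (G x) (G x) / F x) =
      F x * (1 + c * N x / (1 - c * N0)).
    by rewrite /N; field; rewrite !lt0r_neq0.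
  rewrite ler_pM2l//.
  have cN : c * N x <= c * N0 by rewrite ler_wpM2l.
  apply: (@le_trans _ _ (1 - c * N x)^-1); first by apply: expR_le_inv; lra.
  have Px : 0 < 1 - c * N x by lra.
  have -> : (1 - c * N x)^-1 = 1 + c * N x / (1 - c * N x) by field; rewrite lt0r_neq0.
  rewrite lerD2l; apply: ler_wpM2l; first by rewrite mulr_ge0.
  by rewrite lef_pV2 ?posrE// lerD2l lerN2.
have W_ge : 1 <= W.
  rewrite -F1; apply: le_Rintegral => // x _.
  rewrite ler_wpM2r// -[leLHS]mulr1 ler_pM2l//.
  by rewrite -expR0 ler_expR mulr_ge0.
have U0 : 0 <= Ur by apply: Rintegral_ge0 => x _; rewrite mulr_ge0 ?powR_ge0.
exact: (@entropy_bound_arith s t c D K L N0 I Ent Ur W).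
Qed.

(** If the inequality failed, [small_step] would be violated for s small compared
   with the gap. *)
Lemma entropy_le_normalized : Ent <= I / (2 * K).
Proof.
rewrite ler_pdivlMr ?mulr_gt0//.
have [E0|E0] := leP Ent 0.
  by apply: le_trans I0; rewrite mulr_le0_ge0// mulr_ge0// ltW.
rewrite leNgt; apply/negP => H.
have C10 : 0 < C1.
  have h1 : 0 < 2 * K by rewrite mulr_gt0.
  have h2 : 0 <= 2 * L by rewrite mulr_ge0.
  have h3 : 0 <= 2 * I by rewrite mulr_ge0.
  rewrite /C1; move: h1 h2 h3 N00.
  by move: (2 * K) (2 * L) (2 * I) N0 => a b c f; lra.
pose dl := Ent * (2 * K) - I.
have dl0 : 0 < dl by rewrite subr_gt0.
(* the three bounds on s: admissibility in [small_step], and half of the gap dl *)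
pose s := Num.min (1 / 2) (Num.min (K / C1) (dl / (2 * (Ent * C1)))).
have s0 : 0 < s.
  by rewrite !lt_min !divr_gt0//= mulr_gt0// mulr_gt0.
have s1 : s <= 1 / 2 by rewrite ge_min lexx.
have s2 : s <= K / C1 by rewrite /s minA [Num.min (1/2) _]minC -minA ge_min lexx.
have s3 : s <= dl / (2 * (Ent * C1)) by rewrite /s minA ge_min lexx orbT.
have h2 : s * C1 <= K by rewrite -ler_pdivlMr.
have h3 : s * (Ent * C1) <= dl / 2.
  by rewrite -ler_pdivlMr ?mulr_gt0//; apply: (le_trans s3); rewrite invfM mulrA.
have := small_step s0 s1 _ E0; rewrite mulrBr => h.
have : Ent * (2 * K) - Ent * (s * C1) <= I.
  by apply: h; rewrite (le_lt_trans h2)// -[ltLHS]mul1r ltr_pM2r// ltr1n.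
rewrite (_ : Ent * (s * C1) = s * (Ent * C1)); last by ring.
move: dl0 h3; rewrite /dl subr_gt0.
by move: (Ent * (2 * K)) (s * (Ent * C1)) I => a b c; lra.
Qed.

End core.

End strongly_log_concave.

(** * Cut-off functions *)

Section real_lemmas.
Context {R : realType}.

(** The second-order term x^2 / 2 is what turns an entropy into a variance in
   [poincare_compact]. The difference of the two sides has the derivative
   ln (1 + x) - x + x^2 / 2, which has the sign of x. *)
Lemma xlnx_taylor3_ge (x : R) : -1 < x ->
  x + x ^+ 2 / 2 - x ^+ 3 / 6 <= (1 + x) * ln (1 + x).
Proof.
move=> x1.
pose chi (y : R) := ln (1 + y) - y + y ^+ 2 / 2.
pose psi (y : R) := (1 + y) * ln (1 + y) - y - y ^+ 2 / 2 + y ^+ 3 / 6.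
have dln (y : R) : -1 < y -> is_derive y 1 (fun y => ln (1 + y)) (1 + y)^-1.
  move=> y1.
  have y0 : 0 < 1 + y by lra.
  have h : is_derive y 1 (fun y : R => 1 + y) 1.
    by have := is_deriveD (is_derive_cst (1 : R) y 1) (is_derive_id y (1 : R)); rewrite add0r.
  have h2 := is_derive1_ln y0.
  have := is_derive1_comp h2 h.
  by rewrite mulr1.
have dchi (y : R) : -1 < y -> is_derive y 1 chi (y ^+ 2 / (1 + y)).
  move=> y1; have y0 : 1 + y != 0 by apply: lt0r_neq0; lra.
  have := dln y y1 => dl.
  rewrite /chi; apply: is_derive_eq.
  rewrite /GRing.scale /= ?mulr1 ?mulr0 ?add0r ?addr0; field.
  exact: y0.
have dpsi (y : R) : -1 < y -> is_derive y 1 psi (chi y).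
  move=> y1; have y0 : 1 + y != 0 by apply: lt0r_neq0; lra.
  have := dln y y1 => dl.
  rewrite /psi; apply: is_derive_eq.
  rewrite /chi /GRing.scale /= ?mulr1 ?mulr0 ?add0r ?addr0; field.
  exact: y0.
have chi0 : chi 0 = 0 by rewrite /chi addr0 ln1 expr2; lra.
have psi0 : psi 0 = 0 by rewrite /psi addr0 ln1 !exprS expr0; lra.
have cont (f df : R -> R) (a b : R) : (forall y : R, -1 < y -> is_derive y 1 f (df y)) -> -1 < a ->
    {within `[a, b], continuous f}.
  move=> H a1; apply: derivable_within_continuous => y; rewrite in_itv/= => /andP[ay _].
  by have [] := H y (lt_le_trans a1 ay).
suff : 0 <= psi x by rewrite /psi; lra.
have chi_ge (y : R) : 0 <= y -> 0 <= chi y.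
  move=> y0; have [c /andP[c0 _]] : exists2 c, c \in `[0, y]%R & chi y - chi 0 = c ^+ 2 / (1 + c) * (y - 0).
    apply: MVT_segment => //; last by apply: (@cont _ _ _ _ dchi); lra.
    by move=> z; rewrite in_itv/= => /andP[z0 _]; apply: dchi; lra.
  move: c0; rewrite bnd_simp chi0 !subr0 => c0 ->.
  by rewrite mulr_ge0// divr_ge0 ?sqr_ge0// addr_ge0.
have chi_le (y : R) : -1 < y -> y <= 0 -> chi y <= 0.
  move=> y1 y0; have [c /andP[c0 _]] : exists2 c, c \in `[y, 0]%R & chi 0 - chi y = c ^+ 2 / (1 + c) * (0 - y).
    apply: MVT_segment => //; last exact: (@cont _ _ _ _ dchi).
    by move=> z; rewrite in_itv/= => /andP[z0 _]; apply: dchi; lra.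
  move: c0; rewrite bnd_simp chi0 !sub0r => c0 /eqP.
  rewrite eqr_oppLR => /eqP ->; rewrite oppr_le0 mulr_ge0 ?oppr_ge0//.
  by rewrite divr_ge0 ?sqr_ge0//; lra.
have [x0|/ltW x0] := leP 0 x.
  have [c /andP[c0 _]] : exists2 c, c \in `[0, x]%R & psi x - psi 0 = chi c * (x - 0).
    apply: MVT_segment => //; last by apply: (@cont _ _ _ _ dpsi); lra.
    by move=> z; rewrite in_itv/= => /andP[z0 _]; apply: dpsi; lra.
  move: c0; rewrite bnd_simp psi0 !subr0 => c0 ->.
  by rewrite mulr_ge0// chi_ge.
have [c] : exists2 c, c \in `[x, 0]%R & psi 0 - psi x = chi c * (0 - x).
  apply: MVT_segment => //; last exact: (@cont _ _ _ _ dpsi).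
  by move=> z; rewrite in_itv/= => /andP[z0 _]; apply: dpsi; lra.
rewrite in_itv/= psi0 !sub0r => /andP[c1 c0] /eqP; rewrite eqr_oppLR => /eqP ->.
rewrite oppr_ge0 mulr_le0_ge0 ?oppr_ge0//.
by apply: chi_le => //; exact: lt_le_trans c1.
Qed.

(** Squared positive part: a C^1 function whose own square is C^2 and serves as
   profile of the cut-off. *)
Definition sqpos (y : R) : R := (Num.max 0 y) ^+ 2.

Lemma is_derive_sqpos (y : R) : is_derive y 1 sqpos (2 * Num.max 0 y).
Proof.
have [y0|y0|->] := ltgtP y 0.
- rewrite mulr0; apply: (@near_eq_is_derive _ _ _ (cst 0)).
  near=> z; rewrite /cst /sqpos (max_idPl _) ?expr0n//=.
  by apply: ltW; near: z; exact: lt_nbhsl.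
- apply: (@near_eq_is_derive _ R^o R^o (fun z : R => z ^+ 2)).
    near=> z; rewrite /sqpos (max_idPr _)//.
    by apply: ltW; near: z; exact: lt_nbhsr.
  apply: is_derive_eq; rewrite /GRing.scale /= ?mulr1; ring.
- rewrite ?maxxx mulr0.
  have lim0 : (fun h : R => h^-1 *: ((sqpos \o shift 0) (h *: 1) - sqpos 0)) @ 0^' --> (0 : R).
    apply/cvgrPdist_le => /= e e0; near=> h.
    have h0 : h != 0 by near: h; exact: nbhs_dnbhs_neq.
    have he : `|h| < e by near: h; exact: dnbhs0_lt.
    rewrite sub0r normrN /= addr0 /GRing.scale /= mulr1 {2}/sqpos maxxx expr0n subr0.
    rewrite /sqpos normrM normfV normrX.
    apply: le_trans (ltW he).
    rewrite ler_pdivrMl ?normr_gt0// -expr2.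
    rewrite lerXn2r ?nnegrE//.
    by have [_|_] := leP 0 h; rewrite ?normr0.
  apply: DeriveDef; first by apply/cvg_ex; exists 0.
  exact/cvg_lim.
Unshelve. all: by end_near. Qed.

Lemma le_at0_of_right (P : R -> R) (J e : R) : {for 0, continuous P} -> 0 < e ->
  (forall y, 0 < y -> y < e -> P y <= J) -> P 0 <= J.
Proof.
move=> cP e0 H; have cP' : P x @[x --> 0^'+] --> P 0.
  exact: (cvg_at_right_filter cP).
apply: (cvgr_to_le cP'); near=> y; apply: H; near: y.
  exact: nbhs_right_gt.
exact: nbhs_right_lt.
Unshelve. all: by end_near. Qed.

End real_lemmas.

Section cutoff.
Context {R : realType} {d : nat}.
Local Notation V := 'rV[R]_d.

Definition cutoff (n : nat) (x : V) : R :=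
  sqpos (1 - dot x x / n.+1%:R ^+ 2) ^+ 2.

Let N n : R := n.+1%:R ^+ 2.
Let N0 n : 0 < N n. Proof. by rewrite exprn_gt0. Qed.
Let a n (x : V) := 1 - dot x x / N n.
Let a1 n x : a n x <= 1.
Proof. by rewrite gerBl divr_ge0 ?dot_ge0// ltW. Qed.

Let max_a n x : 0 <= Num.max 0 (a n x) <= 1.
Proof. by rewrite le_max lexx/= ge_max ler01 a1. Qed.

Lemma cutoff_ge0 n x : 0 <= cutoff n x.
Proof. by rewrite exprn_ge0// exprn_ge0//; case/andP: (max_a n x). Qed.

Lemma cutoff_le1 n x : cutoff n x <= 1.
Proof. by rewrite !exprn_ile1 ?exprn_ge0//; case/andP: (max_a n x). Qed.

Lemma cutoff_support n x : n.+1%:R ^+ 2 < dot x x -> cutoff n x = 0.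
Proof.
move=> Nx; rewrite /cutoff /sqpos (max_idPl _) ?expr0n//= ?expr0n//.
by rewrite subr_le0 -/(N n) ler_pdivlMr// mul1r ltW.
Qed.

Let C2_a n : C2 (a n).
Proof.
rewrite (_ : a n = fun x => 1 + - (N n)^-1 * dot x x).
  exact: C2D (C2_cst _) (C2M (C2_cst _) C2_dot).
by apply/funext => x; rewrite /a mulNr mulrC.
Qed.

Let phi1 (y : R) := 4 * (sqpos y * Num.max 0 y).
Let dphi (y : R) : is_derive y 1 (fun y => sqpos y ^+ 2) (phi1 y).
Proof.
have := is_derive_sqpos y => h.
apply: is_derive_eq; rewrite /phi1 /GRing.scale /=; ring.
Qed.

Let phi1E : phi1 = fun y => 4 * (sqpos y * y).
Proof.
apply/funext => y; rewrite /phi1 /sqpos; congr (_ * _).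
by have [//|_] := leP 0 y; rewrite expr0n !mul0r.
Qed.

Let dphi1 (y : R) : is_derive y 1 phi1 (12 * sqpos y).
Proof.
have := is_derive_sqpos y => h; rewrite phi1E.
apply: is_derive_eq; rewrite /GRing.scale /= ?mulr1 /sqpos.
by have [_|_] := leP 0 y; rewrite ?expr2; ring.
Qed.

Lemma cutoff_C2 n : C2 (cutoff n).
Proof.
apply: (C2_comp (C2_a n) (phi := fun y => sqpos y ^+ 2) (phi1 := phi1)
  (phi2 := fun y => 12 * sqpos y)) => x.
- exact: dphi.
- exact: dphi1.
- apply: continuousM; first exact: cst_continuous.
  apply: differentiable_continuous; apply/derivable1_diffP.
  by case: (is_derive_sqpos (a n x)).
Qed.

Lemma grad_cutoff n x : grad (cutoff n) x = (- (2 * phi1 (a n x) / N n)) *: x.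
Proof.
apply/rowP => i; rewrite !mxE /partial.
have -> := derive_comp (delta_mx ord0 i) (@C2_differentiable _ _ (a n) x (C2_a n)) (dphi (a n x)).
have -> : 'D_(delta_mx ord0 i) (a n) x = - (2 * x ord0 i / N n).
  have aE : a n = fun x => 1 + - (N n)^-1 * dot x x.
    by apply/funext => y; rewrite /a mulNr mulrC.
  have dd : differentiable (fun x : V => dot x x) x by exact: C2_differentiable C2_dot.
  rewrite aE (derive_add (f := fun=> 1)); last 2 first.
    exact: differentiable_cst.
    by apply: differentiable_mul => //; exact: differentiable_cst.
  have d1 : differentiable (fun _ : V => - (N n)^-1) x by exact: differentiable_cst.
  rewrite (derive_mul _ d1 dd).
  rewrite !derive_cst derive_dotxx mulr0 addr0 add0r.
  rewrite dotE (bigD1 i)//= big1 ?addr0 => [|j ji]; rewrite !mxE ?eqxx ?(negbTE ji)/= ?andbF ?mulr0//.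
  by rewrite mulr1; ring.
ring.
Qed.

(** The factor [cutoff n x] on the right is what the limit in the logarithmic
   Sobolev inequality needs: with it |grad (cutoff f)|^2 / (cutoff f) is
   dominated by |grad f|^2 / f and f. *)
Lemma grad_cutoff_le n x :
  dot (grad (cutoff n) x) (grad (cutoff n) x) <= 64 * cutoff n x / n.+1%:R ^+ 2.
Proof.
rewrite -/(N n) grad_cutoff dotZl dotZr.
have [xN|xN] := ltP (N n) (dot x x).
  have -> : phi1 (a n x) = 0.
    rewrite /phi1 (max_idPl _) ?mulr0// subr_le0 ler_pdivlMr// mul1r ltW//.
  rewrite mulr0 mul0r oppr0 mul0r; apply: divr_ge0; last exact: ltW.
  by apply: mulr_ge0 => //; exact: cutoff_ge0.
set m := Num.max 0 (a n x).
have /andP[m0 m1] := max_a n x; rewrite -/m in m0 m1.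
have -> : cutoff n x = m ^+ 4 by rewrite /cutoff /sqpos -/(N n) -/(a n x) -/m; ring.
have -> : phi1 (a n x) = 4 * m ^+ 3 by rewrite /phi1 /sqpos -/m; ring.
have -> : - (2 * (4 * m ^+ 3) / N n) * (- (2 * (4 * m ^+ 3) / N n) * dot x x) =
  64 * m ^+ 4 / N n * (m ^+ 2 * (dot x x / N n)).
  by field; exact: lt0r_neq0.
apply: ler_piMr; first by rewrite divr_ge0 ?mulr_ge0 ?exprn_ge0// ltW.
apply: mulr_ile1; rewrite ?exprn_ge0 ?exprn_ile1 ?divr_ge0 ?dot_ge0 ?(ltW (N0 n))//.
by rewrite ler_pdivrMr// mul1r.
Qed.

Lemma cutoff_cvg x : cutoff n x @[n --> \oo] --> (1 : R).
Proof.
have H : dot x x / N n @[n --> \oo] --> (0 : R).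
  rewrite -(mulr0 (dot x x)); apply: cvgM; first exact: cvg_cst.
  apply: (@squeeze_cvgr _ _ _ _ (cst 0) (fun n => n.+1%:R^-1) (fun n => (N n)^-1)); last 2 first.
  - exact: cvg_cst.
  - exact: cvg_harmonic.
  apply: nearW => n /=; rewrite invr_ge0 ltW//= lef_pV2 ?posrE//.
  by rewrite /N expr2 ler_peMl// ler1n.
have cs : {for 1, continuous (fun y : R => sqpos y ^+ 2)}.
  apply: differentiable_continuous; apply/derivable1_diffP.
  by case: (dphi 1).
have E1 : sqpos (1 : R) ^+ 2 = 1 by rewrite /sqpos (max_idPr _) ?ler01// !expr1n.
rewrite -[X in _ --> X]E1.
apply: (@cvg_comp _ _ _ (fun n => a n x) (fun y : R => sqpos y ^+ 2) _ (nbhs (1 : R))); last exact: cs.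
have : a n x @[n --> \oo] --> (1 - 0 : R) by apply: cvgB => //; exact: cvg_cst.
by rewrite subr0.
Qed.

Lemma grad_cutoff_cvg x i : partial i (cutoff n) x @[n --> \oo] --> (0 : R).
Proof.
apply/cvgr0Pnorm_le => /= e e0.
have : \forall n \near \oo, 8 * n.+1%:R^-1 <= e :> R.
  have : 8 * n.+1%:R^-1 @[n --> \oo] --> (0 : R).
    by rewrite -(mulr0 (8 : R)); apply: cvgM; [exact: cvg_cst|exact: cvg_harmonic].
  by move=> /cvgr_le; exact.
apply: filterS => n; apply: le_trans.
rewrite -(@ler_pXn2r _ 2) ?nnegrE// ?divr_ge0//.
rewrite real_normK ?num_real//.
have := dot_coord_le (grad (cutoff n) x) i; rewrite mxE => /le_trans; apply.
apply: (le_trans (grad_cutoff_le n x)).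
rewrite exprMn exprVn ler_pM2r ?invr_gt0 ?exprn_gt0//.
have := cutoff_le1 n x; lra.
Qed.

End cutoff.

(** * Logarithmic Sobolev and Poincare inequalities *)

Section gradients.
Context {R : realType} {d : nat}.
Local Notation V := 'rV[R]_d.
Implicit Types f g : V -> R.

Lemma grad_mul f g x : C2 f -> C2 g ->
  grad (fun x => f x * g x) x = f x *: grad g x + g x *: grad f x.
Proof.
move=> Cf Cg; apply/rowP => i; rewrite !mxE /partial.
by rewrite derive_mul//; exact: C2_differentiable.
Qed.

Lemma grad_affine (a b : R) f x : C2 f -> grad (fun x => a + b * f x) x = b *: grad f x.
Proof.
move=> Cf; apply/rowP => i; rewrite !mxE /partial.
have dc (c : R) : differentiable (fun _ : V => c) x by exact: differentiable_cst.
have df : differentiable f x by exact: C2_differentiable.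
rewrite (derive_add _ (dc a) (differentiable_mul (dc b) df)) (derive_mul _ (dc b) df).
by rewrite !derive_cst mulr0 addr0 add0r.
Qed.

Lemma continuous_dot_grad f : C2 f -> continuous (fun x => dot (grad f x) (grad f x)).
Proof.
move=> Cf.
rewrite (_ : (fun _ => _) = fun x => \sum_i partial i f x * partial i f x); last first.
  by apply/funext => x; rewrite dotE; apply: eq_bigr => i _; rewrite !mxE.
elim: (index_enum _) => [|i s ih].
  rewrite (_ : (fun _ => _) = fun=> 0); last by apply/funext => x; rewrite big_nil.
  exact: cst_continuous.
rewrite (_ : (fun _ => _) = fun x => partial i f x * partial i f x + \sum_(i <- s) partial i f x * partial i f x).
  by apply: continuous_add => //; apply: continuous_mul; exact: C2_derive_continuous.
by apply/funext => x; rewrite big_cons.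
Qed.

Lemma dot_add_le (u v : V) : dot (u + v) (u + v) <= 2 * dot u u + 2 * dot v v.
Proof.
have := dot_ge0 (u - v); rewrite -scaleN1r !dotDl !dotDr !dotZl !dotZr (dotC v u); lra.
Qed.

(** The quantitative hypotheses of [entropy_le] hold for C^2 functions of compact
   support, by continuity of all derivatives involved. *)
Lemma compact_support_bounds f (rho : R) : C2 f -> (forall x, rho < dot x x -> f x = 0) ->
  exists B L M : R, [/\ 0 <= M, forall x, `|f x| <= B,
    forall x, dot (grad f x) (grad f x) <= L &
    forall x z, f x <= f z + dot (grad f z) (x - z) + M / 2 * dot (x - z) (x - z)].
Proof.
move=> Cf f0.
have [B B0 HB] := bounded_of_support (C2_continuous Cf) f0.
have g0 x : rho < dot x x -> dot (grad f x) (grad f x) = 0.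
  move=> xr; rewrite dotE big1// => i _; rewrite mxE /partial.
  by rewrite (derive_support _ f0 xr) mul0r.
have [L L0 HL] := bounded_of_support (continuous_dot_grad Cf) g0.
have [M M0 HM] := second_order_bound Cf f0.
exists B, L, M; split => // [x|x z]; first exact: le_trans (ler_norm _) (HL x).
exact: second_order_le.
Qed.

End gradients.

Lemma cvg_sumr {R : realType} (I : Type) (s : seq I) (u : I -> nat -> R) (l : I -> R) :
  (forall i, u i n @[n --> \oo] --> l i) ->
  \sum_(i <- s) u i n @[n --> \oo] --> \sum_(i <- s) l i.
Proof.
move=> ul; elim: s => [|i s ih].
  rewrite big_nil (_ : (fun _ => _) = fun=> 0); first exact: cvg_cst.
  by apply/funext => n; rewrite big_nil.
rewrite big_cons (_ : (fun _ => _) = fun n => u i n + \sum_(i <- s) u i n).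
  by apply: cvgD.
by apply/funext => n; rewrite big_cons.
Qed.

Lemma dot_grad_cutoff_cvg {R : realType} {d : nat} (f : 'rV[R]_d -> R) x :
  dot (cutoff n x *: grad f x + f x *: grad (cutoff n) x)
    (cutoff n x *: grad f x + f x *: grad (cutoff n) x) @[n --> \oo] -->
  dot (grad f x) (grad f x).
Proof.
rewrite dotE; under eq_fun do rewrite dotE.
suff gi i : (cutoff n x *: grad f x + f x *: grad (cutoff n) x) ord0 i @[n --> \oo] -->
    (grad f x) ord0 i by apply: cvg_sumr => i; apply: cvgM.
under eq_fun do rewrite !mxE.
have : cutoff n x * partial i f x + f x * partial i (cutoff n) x @[n --> \oo] -->
    1 * partial i f x + f x * 0.
  apply: cvgD; apply: cvgM; try exact: cvg_cst;
    [exact: cutoff_cvg|exact: grad_cutoff_cvg].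
by rewrite mul1r mulr0 addr0 mxE.
Qed.

Section functional_inequalities.
Context {R : realType} {d : nat}.
Local Notation V := 'rV[R]_d.
Local Notation mu := (@lebesgue_rV R d).
Variables (U : V -> R) (K : R) (gU : V -> V).
Hypotheses (K0 : 0 < K) (cU : continuous U).
Hypothesis convU : forall x z,
  U z + dot (gU z) (x - z) + K / 2 * dot (x - z) (x - z) <= U x.
Hypothesis normU : (\int[mu]_x (gibbs U x)%:E = 1)%E.
Local Notation q := (gibbs U).

Let q0 x : 0 < q x. Proof. exact: gibbs_gt0. Qed.
Let mq : measurable_fun setT q. Proof. exact: measurable_gibbs. Qed.

Lemma Rintegral_gibbs : \int[mu]_x q x = 1.
Proof. by rewrite /Rintegral normU. Qed.

Lemma Rintegral_gibbs_cst (c : R) : \int[mu]_x (c * q x) = c.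
Proof. by rewrite RintegralZl ?Rintegral_gibbs ?mulr1//; exact: integrable_gibbs. Qed.

(** Both sides of [entropy_le_normalized] are homogeneous of degree 1 in [F], once
   E ln E is subtracted from the left one. *)
Lemma entropy_le (F : V -> R) (G : V -> V) (e B L2 M E : R) :
  0 < e -> 0 <= M -> measurable_fun setT F ->
  measurable_fun setT (fun x => dot (G x) (G x)) ->
  (forall x, e <= F x <= B) -> (forall x, dot (G x) (G x) <= L2) ->
  (forall x z, F x <= F z + dot (G z) (x - z) + M / 2 * dot (x - z) (x - z)) ->
  E = \int[mu]_x (F x * q x) ->
  \int[mu]_x (F x * ln (F x) * q x) - E * ln E <=
  (\int[mu]_x (dot (G x) (G x) / F x * q x)) / (2 * K).
Proof.
move=> e0 M0 mF mG FB GB FG EE.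
have F0 x : 0 < F x by case/andP: (FB x) => + _; exact: lt_le_trans.
have [iF iE iI] := integrable_entropy cU normU e0 mF mG FB GB.
have E0 : 0 < E.
  apply: (lt_le_trans e0); rewrite EE -(Rintegral_gibbs_cst e).
  apply: le_Rintegral => //.
    apply: (integrable_mul_gibbs cU normU (B := `|e|)) => //.
  by move=> x _; rewrite ler_wpM2r ?(ltW (q0 x))//; case/andP: (FB x).
have En0 := lt0r_neq0 E0.
have := @entropy_le_normalized R d U K gU K0 cU convU normU
  (fun x => E^-1 * F x) (fun x => E^-1 *: G x) (e / E) (B / E) (L2 / E ^+ 2) (M / E).
have -> : \int[mu]_x (E^-1 * F x * q x) = 1.
  under eq_Rintegral do rewrite -mulrA.
  by rewrite RintegralZl// -EE mulVf.
have -> : \int[mu]_x (E^-1 * F x * ln (E^-1 * F x) * q x) =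
    E^-1 * (\int[mu]_x (F x * ln (F x) * q x) - E * ln E).
  have -> : (fun x => E^-1 * F x * ln (E^-1 * F x) * q x) =
      (fun x => E^-1 * (F x * ln (F x) * q x - ln E * (F x * q x))).
    apply/funext => x; rewrite lnM ?posrE ?invr_gt0// lnV ?posrE//; ring.
  have iE' : mu.-integrable setT (EFin \o (fun x => ln E * (F x * q x))).
    by have := integrableZl measurableT (ln E) iF.
  rewrite RintegralZl//; last by have := integrableB measurableT iE iE'.
  by rewrite RintegralB// RintegralZl// -EE [ln E * E]mulrC.
have -> : \int[mu]_x (dot (E^-1 *: G x) (E^-1 *: G x) / (E^-1 * F x) * q x) =
    E^-1 * \int[mu]_x (dot (G x) (G x) / F x * q x).
  rewrite -RintegralZl//; apply: eq_Rintegral => x _.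
  rewrite dotZl dotZr; field.
  by rewrite lt0r_neq0//=.
move=> H; rewrite -(@ler_pM2l _ E^-1) ?invr_gt0// mulrA; apply: H => //.
- exact: divr_gt0.
- by rewrite divr_ge0// ltW.
- exact: measurable_funM.
- rewrite (_ : (fun _ => _) = fun x => E^-1 * (E^-1 * dot (G x) (G x))).
    by apply: measurable_funM => //; exact: measurable_funM.
  by apply/funext => x; rewrite dotZl dotZr.
- by move=> x; rewrite ![E^-1 * _]mulrC !ler_pM2r ?invr_gt0.
- move=> x; rewrite dotZl dotZr mulrA -invfM -expr2 mulrC.
  by rewrite ler_pM2r// invr_gt0 exprn_gt0.
- move=> x z; rewrite dotZl.
  have -> : E^-1 * F z + E^-1 * dot (G z) (x - z) + M / E / 2 * dot (x - z) (x - z) =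
    E^-1 * (F z + dot (G z) (x - z) + M / 2 * dot (x - z) (x - z)) by field.
  by rewrite ler_pM2l ?invr_gt0.
Qed.

(** Domination of (1/(n+1) + cutoff f) ln (1/(n+1) + cutoff f) by quantities that
   are integrable when f and f ln f are; y plays the role of the approximant and
   z that of f. *)
Lemma xlnx_abs_le (y z : R) : 0 < y -> y <= 1 + z -> 0 < z ->
  `|y * ln y| <= 2 + 2 * z + 2 * `|z * ln z|.
Proof.
move=> y0 yz z0.
have lb : -1 <= y * ln y.
  have : ln y^-1 <= y^-1 - 1 by rewrite ln_le_sub1 ?invr_gt0.
  rewrite lnV ?posrE// => h.
  have : y * - ln y <= y * (y^-1 - 1) by rewrite ler_pM2l.
  rewrite mulrBr mulfV ?lt0r_neq0//; lra.
have n0 := normr_ge0 (z * ln z).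
rewrite ler_norml; apply/andP; split; first lra.
have [y1|y1] := leP y 1.
  apply: (@le_trans _ _ 0); last lra.
  by rewrite mulr_ge0_le0 ?ln_le0// ltW.
have ly : ln y <= ln (1 + z) by rewrite ler_ln ?posrE ?addr_gt0.
have ly0 : 0 <= ln y by rewrite ln_ge0// ltW.
have h1 : y * ln y <= (1 + z) * ln (1 + z).
  by apply: ler_pM => //; exact: ltW.
apply: (le_trans h1).
have l1z : 0 <= ln (1 + z) by rewrite ln_ge0// lerDl ltW.
have [z1|z1] := leP z 1.
  have : ln (1 + z) <= z by apply: le_ln1Dx; lra.
  nra.
have zz : ln (1 + z) <= 1 + ln z.
  have l2 : ln 2 <= 1 :> R by have := @ln_le_sub1 R 2 (ltr0n _ 2); lra.
  apply: (@le_trans _ _ (ln (2 * z))).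
    by rewrite ler_ln ?posrE ?addr_gt0 ?mulr_gt0//; lra.
  by rewrite lnM ?posrE// lerD2r.
have lz : 0 <= ln z by rewrite ln_ge0// ltW.
rewrite ger0_norm ?mulr_ge0 ?(ltW z0)//.
have : (1 + z) * ln (1 + z) <= (2 * z) * (1 + ln z).
  by apply: ler_pM => //; lra.
lra.
Qed.

Section log_sobolev.
Variable f : V -> R.
Hypotheses (Cf : C2 f) (f0 : forall x, 0 < f x).
Hypothesis if1 : mu.-integrable setT (EFin \o (fun x => f x * q x)).
Hypothesis if2 : mu.-integrable setT (EFin \o (fun x => f x * ln (f x) * q x)).
Hypothesis if3 : mu.-integrable setT (EFin \o (fun x => dot (grad f x) (grad f x) / f x * q x)).
Hypothesis E0 : 0 < \int[mu]_x (f x * q x).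

Let h n (x : V) := cutoff n x * f x.
Let F n (x : V) : R := n.+1%:R^-1 + 1 * h n x.
Let en0 n : 0 < n.+1%:R^-1 :> R. Proof. by rewrite invr_gt0. Qed.
Let Ch n : C2 (h n). Proof. exact: (C2M (cutoff_C2 n) Cf). Qed.
Let CF n : C2 (F n).
Proof. exact: (C2D (C2_cst _) (C2M (C2_cst _) (Ch n))). Qed.
Let mf : measurable_fun setT f.
Proof. exact: continuous_measurable_rV (C2_continuous Cf). Qed.
Let mF n : measurable_fun setT (F n).
Proof. exact: continuous_measurable_rV (C2_continuous (CF n)). Qed.
Let h0 n x : 0 <= h n x.
Proof. by rewrite mulr_ge0 ?cutoff_ge0 ?(ltW (f0 x)). Qed.
Let F0 n x : 0 < F n x.
Proof. by rewrite /F mul1r ltr_pwDl. Qed.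
Let gF n x : grad (F n) x = cutoff n x *: grad f x + f x *: grad (cutoff n) x.
Proof.
by rewrite (grad_affine _ _ x (Ch n)) scale1r (grad_mul x (cutoff_C2 n) Cf).
Qed.
Let hf n x : h n x <= f x.
Proof. by rewrite ler_piMl ?cutoff_le1// ltW. Qed.
Let FB n x : F n x <= 1 + f x.
Proof. by rewrite /F mul1r lerD// invf_le1// ler1n. Qed.

Let step n : \int[mu]_x (F n x * ln (F n x) * q x) -
    (\int[mu]_x (F n x * q x)) * ln (\int[mu]_x (F n x * q x)) <=
  (\int[mu]_x (dot (grad (F n) x) (grad (F n) x) / F n x * q x)) / (2 * K).
Proof.
have [|B [L [M [M0 HB HL HM]]]] := @compact_support_bounds _ _ (h n) (n.+1%:R ^+ 2) (Ch n).
  by move=> x xn; rewrite /h cutoff_support// mul0r.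
have gE x : grad (F n) x = grad (h n) x by rewrite (grad_affine _ _ x (Ch n)) scale1r.
apply: (@entropy_le (F n) (grad (F n)) n.+1%:R^-1 (1 + B) L M) => //.
- exact: continuous_measurable_rV (continuous_dot_grad (CF n)).
- move=> x; rewrite /F mul1r lerDl h0 /= lerD//.
    by rewrite invf_le1// ler1n.
  exact: le_trans (ler_norm _) (HB x).
- by move=> x; rewrite gE.
- by move=> x z; rewrite gE /F !mul1r -!addrA lerD2l !addrA.
Qed.

Let Fcvg x : F n x @[n --> \oo] --> f x.
Proof.
have : F n x @[n --> \oo] --> (0 + 1 * (1 * f x) : R).
  apply: cvgD; first exact: cvg_harmonic.
  apply: cvgM; first exact: cvg_cst.
  by apply: cvgM; [exact: cutoff_cvg|exact: cvg_cst].
by rewrite add0r !mul1r.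
Qed.

Let cvg1 : \int[mu]_x (F n x * q x) @[n --> \oo] --> \int[mu]_x (f x * q x).
Proof.
have [] := @Rdominated_convergence _ _ _ mu (fun n x => F n x * q x) (fun x => f x * q x)
  (fun x => q x + f x * q x) => //.
- by move=> n; exact: measurable_funM.
- exact: measurable_funM.
- by move=> x; apply: cvgM; [exact: Fcvg|exact: cvg_cst].
- by have := integrableD measurableT (integrable_gibbs cU normU) if1.
- move=> n x; rewrite ger0_norm ?mulr_ge0 ?(ltW (F0 n x)) ?(ltW (q0 x))//.
  by rewrite -{2}[q x]mul1r -mulrDl ler_pM2r.
Qed.

Let cvg2 : \int[mu]_x (F n x * ln (F n x) * q x) @[n --> \oo] -->
  \int[mu]_x (f x * ln (f x) * q x).
Proof.
have [] := @Rdominated_convergence _ _ _ mu (fun n x => F n x * ln (F n x) * q x)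
  (fun x => f x * ln (f x) * q x)
  (fun x => (2 * q x + 2 * (f x * q x)) + 2 * `|f x * ln (f x) * q x|) => //.
- move=> n; apply: measurable_funM => //; apply: measurable_funM => //.
  exact: measurableT_comp.
- apply: measurable_funM => //; apply: measurable_funM => //.
  exact: measurableT_comp.
- move=> x; apply: cvgM; last exact: cvg_cst.
  apply: cvgM; first exact: Fcvg.
  apply: (@cvg_comp _ _ _ (fun n => F n x) (@ln R) _ (nbhs (f x))); first exact: Fcvg.
  exact: continuous_ln.
- have i1 := integrableZl measurableT 2 (integrable_gibbs cU normU).
  have i2 := integrableZl measurableT 2 if1.
  have i3 := integrableZl measurableT 2 (integrable_norm if2).
  by have := integrableD measurableT (integrableD measurableT i1 i2) i3.
- move=> n x; rewrite normrM [`|q x|]ger0_norm ?(ltW (q0 x))// normrM.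
  rewrite normrM [`|q x|]ger0_norm ?(ltW (q0 x))// -normrM.
  have -> : 2 * q x + 2 * (f x * q x) + 2 * (`|f x * ln (f x)| * q x) =
    (2 + 2 * f x + 2 * `|f x * ln (f x)|) * q x by ring.
  rewrite ler_pM2r//; exact: xlnx_abs_le.
Qed.

Let cvg3 : \int[mu]_x (dot (grad (F n) x) (grad (F n) x) / F n x * q x) @[n --> \oo] -->
  \int[mu]_x (dot (grad f x) (grad f x) / f x * q x).
Proof.
have [] := @Rdominated_convergence _ _ _ mu
  (fun n x => dot (grad (F n) x) (grad (F n) x) / F n x * q x)
  (fun x => dot (grad f x) (grad f x) / f x * q x)
  (fun x => 2 * (dot (grad f x) (grad f x) / f x * q x) + 128 * (f x * q x)) => //.
- move=> n; apply: measurable_funM => //; apply: measurable_funM => //.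
    exact: continuous_measurable_rV (continuous_dot_grad (CF n)).
  exact: measurable_inv_pos.
- apply: measurable_funM => //; apply: measurable_funM => //.
    exact: continuous_measurable_rV (continuous_dot_grad Cf).
  exact: measurable_inv_pos.
- move=> x; apply: cvgM; last exact: cvg_cst.
  apply: cvgM; last by apply: cvgV; [rewrite lt0r_neq0|exact: Fcvg].
  by under eq_fun do rewrite gF; exact: dot_grad_cutoff_cvg.
- have i1 := integrableZl measurableT 2 if3.
  have i2 := integrableZl measurableT 128 if1.
  by have := integrableD measurableT i1 i2.
- move=> n x; rewrite ger0_norm; last first.
    by rewrite mulr_ge0 ?divr_ge0 ?dot_ge0 ?(ltW (F0 n x)) ?(ltW (q0 x)).
  have -> : 2 * (dot (grad f x) (grad f x) / f x * q x) + 128 * (f x * q x) =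
     (2 * (dot (grad f x) (grad f x) / f x) + 128 * f x) * q x by ring.
  rewrite ler_pM2r// ler_pdivrMr//.
  apply: (@le_trans _ _ ((2 * (dot (grad f x) (grad f x) / f x) + 128 * f x) * h n x)); last first.
    apply: ler_wpM2l.
      by rewrite addr_ge0// mulr_ge0// ?divr_ge0 ?dot_ge0// ltW.
    by rewrite /F mul1r lerDr ltW.
  rewrite gF; apply: (le_trans (dot_add_le _ _)).
  rewrite !dotZl !dotZr.
  have c0 := cutoff_ge0 n x; have c1 := cutoff_le1 n x.
  have gc := grad_cutoff_le n x.
  have n1 : cutoff n x / n.+1%:R ^+ 2 <= cutoff n x.
    by rewrite ler_piMr// invf_le1 ?exprn_gt0// exprn_ege1// ler1n.
  have -> : (2 * (dot (grad f x) (grad f x) / f x) + 128 * f x) * h n x =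
    2 * (cutoff n x * dot (grad f x) (grad f x)) + 2 * (f x * (f x * (64 * cutoff n x))).
    by rewrite /h; field; exact: lt0r_neq0.
  apply: lerD.
    by rewrite ler_pM2l// ler_wpM2l// ler_piMl// dot_ge0.
  do 3 (apply: ler_wpM2l; first by rewrite ?ler0n ?(ltW (f0 x))).
  by apply: (le_trans gc); rewrite -mulrA ler_wpM2l.
Qed.

(** [F n] = 1/(n+1) + cutoff n * f satisfies the bounds of [entropy_le], and all
   three integrals converge by dominated convergence. *)
Lemma log_sobolev E : E = \int[mu]_x (f x * q x) ->
  \int[mu]_x (f x * ln (f x) * q x) - E * ln E <=
  (\int[mu]_x (dot (grad f x) (grad f x) / f x * q x)) / (2 * K).
Proof.
move=> EE; rewrite {E}EE; set E := \int[mu]_x (f x * q x).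
apply: (ler_cvg_to (a := \oo) _ _ (nearW _ step)); last first.
  by apply: cvgM; [exact: cvg3|exact: cvg_cst].
apply: cvgB; first exact: cvg2.
apply: cvgM; first exact: cvg1.
apply: (@cvg_comp _ _ _ _ (@ln R) _ (nbhs E)); first exact: cvg1.
exact: continuous_ln.
Qed.

End log_sobolev.

(** Apply the logarithmic Sobolev inequality to F = 1 + y k with k = h - int h q.
   As y tends to 0 its left-hand side is y^2 / 2 int k^2 q + O(y^3), its
   right-hand side is y^2 / 2K int |grad h|^2 q + O(y^3). *)
Lemma poincare_compact (h : V -> R) (rho : R) : C2 h -> (forall x, rho < dot x x -> h x = 0) ->
  \int[mu]_x (h x ^+ 2 * q x) - (\int[mu]_x (h x * q x)) ^+ 2 <=
  (\int[mu]_x (dot (grad h x) (grad h x) * q x)) / K.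
Proof.
move=> Ch h0.
have [B [L [M [M0 HB HL HM]]]] := compact_support_bounds Ch h0.
have mh : measurable_fun setT h by exact: continuous_measurable_rV (C2_continuous Ch).
have mg : measurable_fun setT (fun x => dot (grad h x) (grad h x)).
  exact: continuous_measurable_rV (continuous_dot_grad Ch).
set m := \int[mu]_x (h x * q x).
set J := \int[mu]_x (dot (grad h x) (grad h x) * q x).
pose k x := h x - m.
pose Bk := B + `|m| + 1.
have B0 : 0 <= B by apply: le_trans (HB 0).
have Bk0 : 0 < Bk by rewrite /Bk ltr_wpDl// addr_ge0.
have kB x : `|k x| <= Bk.
  apply: (le_trans (ler_normB _ _)); rewrite /Bk -addrA lerD// lerDl//.
have mk : measurable_fun setT k by exact: measurable_funB.
have ih : mu.-integrable setT (EFin \o (fun x => h x * q x)).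
  exact: (integrable_mul_gibbs cU normU (B := B)).
have ikn n : mu.-integrable setT (EFin \o (fun x => k x ^+ n * q x)).
  apply: (integrable_mul_gibbs cU normU (B := Bk ^+ n)); first exact: measurable_funX.
  by move=> x; rewrite normrX lerXn2r ?nnegrE// ltW.
have ih2 : mu.-integrable setT (EFin \o (fun x => h x ^+ 2 * q x)).
  apply: (integrable_mul_gibbs cU normU (B := B ^+ 2)); first exact: measurable_funX.
  by move=> x; rewrite normrX lerXn2r ?nnegrE.
have iJ : mu.-integrable setT (EFin \o (fun x => dot (grad h x) (grad h x) * q x)).
  apply: (integrable_mul_gibbs cU normU (B := L)) => // x.
  by rewrite ger0_norm ?dot_ge0.
have iq := integrable_gibbs cU normU.
have k1 : \int[mu]_x (k x ^+ 1 * q x) = 0.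
  have [_ E] := Rintegral_linear 1 (- m) ih iq.
  transitivity (\int[mu]_x (1 * (h x * q x) + - m * q x)).
    by apply: eq_Rintegral => x _; rewrite /k expr1; ring.
  by rewrite E Rintegral_gibbs mul1r mulr1 subrr.
set A := \int[mu]_x (k x ^+ 2 * q x); set C := \int[mu]_x (k x ^+ 3 * q x).
have AE : A = \int[mu]_x (h x ^+ 2 * q x) - m ^+ 2.
  have [i1 E1] := Rintegral_linear (- (2 * m)) (m ^+ 2) ih iq.
  have [_ E2] := Rintegral_linear 1 1 ih2 i1.
  transitivity (\int[mu]_x (1 * (h x ^+ 2 * q x) + 1 * (- (2 * m) * (h x * q x) + m ^+ 2 * q x))).
    by apply: eq_Rintegral => x _; rewrite /k; ring.
  rewrite E2 E1 Rintegral_gibbs -/m; ring.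
rewrite -AE ler_pdivlMr//.
(* P y <= J is the inequality for F = 1 + y k, divided by y^2 and with 1 - y Bk as a
   lower bound of F *)
pose P (y : R) := (A / 2 - y * (C / 6)) * (1 - y * Bk) * (2 * K).
have -> : A * K = P 0 by rewrite /P; field.
apply: (@le_at0_of_right _ P J (1 / (2 * Bk))).
- apply: differentiable_continuous; rewrite /P.
  by apply/derivable1_diffP; apply: ex_derive.
- by rewrite divr_gt0// mulr_gt0.
move=> y y0 yB.
have yBk : y * Bk < 1 / 2 by rewrite -ltr_pdivlMr//; apply: (lt_le_trans yB); rewrite invfM mulrA.
have yk x : `|y * k x| <= y * Bk by rewrite normrM gtr0_norm// ler_pM2l.
have ykl x : - (1 / 2) <= y * k x <= 1 / 2.
  by rewrite -ler_norml (le_trans (yk x))// ltW.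
pose F x := (1 - y * m) + y * h x.
have FE x : F x = 1 + y * k x by rewrite /F /k; ring.
have CF : C2 F by exact: (C2D (C2_cst _) (C2M (C2_cst _) Ch)).
have mF : measurable_fun setT F by exact: continuous_measurable_rV (C2_continuous CF).
have gF x : grad F x = y *: grad h x by rewrite (grad_affine _ _ x Ch).
have FB x : 1 / 2 <= F x <= 3 / 2.
  by rewrite FE; have := ykl x; lra.
have F0 x : 0 < F x by have := FB x; lra.
have E1 : 1 = \int[mu]_x (F x * q x).
  have [_ E] := Rintegral_linear 1 y iq (ikn 1).
  transitivity (\int[mu]_x (1 * q x + y * (k x ^+ 1 * q x))).
    by rewrite E Rintegral_gibbs k1; ring.
  by apply: eq_Rintegral => x _; rewrite FE; ring.
have mgF : measurable_fun setT (fun x => dot (grad F x) (grad F x)).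
  exact: continuous_measurable_rV (continuous_dot_grad CF).
have gFL x : dot (grad F x) (grad F x) <= y ^+ 2 * L.
  by rewrite gF dotZl dotZr mulrA -expr2 ler_wpM2l// sqr_ge0.
have half0 : 0 < 1 / 2 :> R by rewrite divr_gt0.
have [_ iE iG] := integrable_entropy cU normU half0 mF mgF FB gFL.
have H : \int[mu]_x (F x * ln (F x) * q x) <=
    \int[mu]_x (dot (grad F x) (grad F x) / F x * q x) / (2 * K).
  rewrite -[leLHS]subr0 -(mulr0 1) -ln1.
  apply: (@entropy_le F (grad F) (1 / 2) (3 / 2) (y ^+ 2 * L) (y * M) 1) => //.
    by rewrite mulr_ge0// ltW.
  move=> x z; rewrite gF dotZl /F.
  have := ler_wpM2l (ltW y0) (HM x z); lra.
have lower : y ^+ 2 * (A / 2 - y * (C / 6)) <= \int[mu]_x (F x * ln (F x) * q x).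
  have [i1 E2] := Rintegral_linear (y ^+ 2 / 2) (- (y ^+ 3 / 6)) (ikn 2) (ikn 3).
  have [i2 E3] := Rintegral_linear y 1 (ikn 1) i1.
  have -> : y ^+ 2 * (A / 2 - y * (C / 6)) = y * \int[mu]_x (k x ^+ 1 * q x) +
      1 * (y ^+ 2 / 2 * \int[mu]_x (k x ^+ 2 * q x) + - (y ^+ 3 / 6) * \int[mu]_x (k x ^+ 3 * q x)).
    by rewrite k1 -/A -/C; field.
  rewrite -E2 -E3; apply: le_Rintegral => // x _.
  have -> : y * (k x ^+ 1 * q x) + 1 * (y ^+ 2 / 2 * (k x ^+ 2 * q x) +
     - (y ^+ 3 / 6) * (k x ^+ 3 * q x)) =
    (y * k x + (y * k x) ^+ 2 / 2 - (y * k x) ^+ 3 / 6) * q x by field.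
  rewrite ler_pM2r// FE; apply: xlnx_taylor3_ge.
  by have := ykl x; lra.
have d0 : 0 < 1 - y * Bk by lra.
have upper : \int[mu]_x (dot (grad F x) (grad F x) / F x * q x) <= y ^+ 2 / (1 - y * Bk) * J.
  have iJ' : mu.-integrable setT (EFin \o (fun x => y ^+ 2 / (1 - y * Bk) * (dot (grad h x) (grad h x) * q x))).
    by have := integrableZl measurableT (y ^+ 2 / (1 - y * Bk)) iJ.
  rewrite -RintegralZl//; apply: le_Rintegral => // x _.
  rewrite mulrA ler_pM2r// gF dotZl dotZr mulrA -expr2 mulrAC.
  apply: ler_wpM2r; first exact: dot_ge0.
  apply: ler_wpM2l; first exact: sqr_ge0.
  rewrite lef_pV2 ?posrE// FE lerD2l.
  by have := yk x; rewrite ler_norml => /andP[].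
have y20 : 0 < y ^+ 2 by rewrite exprn_gt0.
have : y ^+ 2 * (A / 2 - y * (C / 6)) <= y ^+ 2 / (1 - y * Bk) * J / (2 * K).
  apply: (le_trans lower); apply: (le_trans H).
  by rewrite ler_pM2r// invr_gt0 mulr_gt0.
have -> : y ^+ 2 / (1 - y * Bk) * J / (2 * K) =
    y ^+ 2 * (J / (1 - y * Bk) / (2 * K)).
  by rewrite !mulrA [y ^+ 2 * J / _]mulrAC.
rewrite ler_pM2l// => H3.
rewrite /P -mulrA [(1 - _) * _]mulrC mulrA.
rewrite -ler_pdivlMr// -ler_pdivlMr ?mulr_gt0//.
Qed.

(** Cut-off and dominated convergence. *)
Lemma poincare (f : V -> R) : C2 f ->
  mu.-integrable setT (EFin \o (fun x => f x * q x)) ->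
  mu.-integrable setT (EFin \o (fun x => f x ^+ 2 * q x)) ->
  mu.-integrable setT (EFin \o (fun x => dot (grad f x) (grad f x) * q x)) ->
  \int[mu]_x (f x ^+ 2 * q x) - (\int[mu]_x (f x * q x)) ^+ 2 <=
  (\int[mu]_x (dot (grad f x) (grad f x) * q x)) / K.
Proof.
move=> Cf if1 if2 if3.
pose h n (x : V) := cutoff n x * f x.
have Ch n : C2 (h n) by exact: (C2M (cutoff_C2 n) Cf).
have mf : measurable_fun setT f by exact: continuous_measurable_rV (C2_continuous Cf).
have mh n : measurable_fun setT (h n) by exact: continuous_measurable_rV (C2_continuous (Ch n)).
have gh n x : grad (h n) x = cutoff n x *: grad f x + f x *: grad (cutoff n) x.
  exact: (grad_mul x (cutoff_C2 n) Cf).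
have hcvg x : h n x @[n --> \oo] --> f x.
  have : h n x @[n --> \oo] --> (1 * f x : R).
    by apply: cvgM; [exact: cutoff_cvg|exact: cvg_cst].
  by rewrite mul1r.
have hf n x : `|h n x| <= `|f x|.
  by rewrite normrM ger0_norm ?cutoff_ge0// ler_piMl ?cutoff_le1.
have [_ c1] : mu.-integrable setT (EFin \o (fun x => f x * q x)) /\
    \int[mu]_x (h n x * q x) @[n --> \oo] --> \int[mu]_x (f x * q x).
  apply: (@Rdominated_convergence _ _ _ mu (fun n x => h n x * q x)
    (fun x => f x * q x) (fun x => `|f x * q x|)).
  - by move=> n; apply: measurable_funM.
  - exact: measurable_funM.
  - by move=> x; apply: cvgM => //; exact: cvg_cst.
  - exact: integrable_norm if1.
  - by move=> n x; rewrite normrM [leRHS]normrM ler_wpM2r// hf.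
have [_ c2] : mu.-integrable setT (EFin \o (fun x => f x ^+ 2 * q x)) /\
    \int[mu]_x (h n x ^+ 2 * q x) @[n --> \oo] --> \int[mu]_x (f x ^+ 2 * q x).
  apply: (@Rdominated_convergence _ _ _ mu (fun n x => h n x ^+ 2 * q x)
    (fun x => f x ^+ 2 * q x) (fun x => f x ^+ 2 * q x)).
  - by move=> n; apply: measurable_funM => //; apply: measurable_funX.
  - by apply: measurable_funM => //; apply: measurable_funX.
  - move=> x; apply: cvgM; last exact: cvg_cst.
    by rewrite expr2; apply: cvgM.
  - by [].
  - move=> n x; have h2 : h n x ^+ 2 <= f x ^+ 2.
      rewrite -[leRHS]real_normK ?num_real// -[leLHS]real_normK ?num_real//.
      by rewrite lerXn2r ?nnegrE// hf.
    rewrite ger0_norm; first by rewrite ler_pM2r.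
    by rewrite mulr_ge0 ?sqr_ge0 ?(ltW (q0 x)).
have [_ c3] : mu.-integrable setT (EFin \o (fun x => dot (grad f x) (grad f x) * q x)) /\
  \int[mu]_x (dot (grad (h n) x) (grad (h n) x) * q x) @[n --> \oo] -->
  \int[mu]_x (dot (grad f x) (grad f x) * q x).
  apply: (@Rdominated_convergence _ _ _ mu
    (fun n x => dot (grad (h n) x) (grad (h n) x) * q x)
    (fun x => dot (grad f x) (grad f x) * q x)
    (fun x => 2 * (dot (grad f x) (grad f x) * q x) + 128 * (f x ^+ 2 * q x))).
  - move=> n; apply: measurable_funM => //.
    exact: continuous_measurable_rV (continuous_dot_grad (Ch n)).
  - apply: measurable_funM => //.
    exact: continuous_measurable_rV (continuous_dot_grad Cf).
  - move=> x; apply: cvgM; last exact: cvg_cst.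
    by under eq_fun do rewrite gh; exact: dot_grad_cutoff_cvg.
  - have i1 := integrableZl measurableT 2 if3.
    have i2 := integrableZl measurableT 128 if2.
    by have := integrableD measurableT i1 i2.
  - move=> n x; rewrite ger0_norm; last by rewrite mulr_ge0 ?dot_ge0 ?(ltW (q0 x)).
    have -> : 2 * (dot (grad f x) (grad f x) * q x) + 128 * (f x ^+ 2 * q x) =
     (2 * dot (grad f x) (grad f x) + 128 * f x ^+ 2) * q x by ring.
    rewrite ler_pM2r// gh; apply: (le_trans (dot_add_le _ _)).
    rewrite !dotZl !dotZr.
    have c0 := cutoff_ge0 n x; have c1' := cutoff_le1 n x.
    have gc : dot (grad (cutoff n) x) (grad (cutoff n) x) <= 64.
      apply: (le_trans (grad_cutoff_le n x)).
      rewrite -mulrA ler_piMr// mulr_ile1// ?invr_ge0 ?exprn_ge0//.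
      by rewrite invf_le1 ?exprn_gt0// exprn_ege1// ler1n.
    have -> : 128 * f x ^+ 2 = 2 * (f x ^+ 2 * 64) by ring.
    apply: lerD; rewrite ler_pM2l//.
      rewrite mulrA ler_piMl ?dot_ge0// mulr_ile1//.
    by rewrite mulrA -expr2 ler_wpM2l// sqr_ge0.
have hs n x : n.+1%:R ^+ 2 < dot x x -> h n x = 0.
  by move=> xn; rewrite /h (cutoff_support xn) mul0r.
have step n := poincare_compact (Ch n) (hs n).
apply: (ler_cvg_to (a := \oo) _ _ (nearW _ step)).
  by apply: cvgB => //; rewrite expr2; apply: cvgM.
by apply: cvgM => //; exact: cvg_cst.
Qed.

End functional_inequalities.

(** * Dissipation along the Fokker-Planck flow *)

Section smooth_sections.
Context {R : realType} {d : nat}.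
Local Notation V := 'rV[R]_d.

(** A directional derivative in space of a section is a directional derivative of
   the joint function along (0, v), the two difference quotients being equal. *)
Lemma foldr_derive_section (P : R * V -> R) (t : R) (vs : seq V) :
  foldr (fun v (g : V -> R) => 'D_v g) (fun x => P (t, x)) vs =
  (fun x => foldr (fun v (g : R * V -> R) => 'D_v g) P
    [seq (0, v) | v <- vs] (t, x)).
Proof.
elim: vs => [|v vs IH] //=; rewrite IH; apply/funext => x.
set G := foldr _ P _; rewrite /derive; congr (lim (_ @ 0^')).
apply/funext => h /=; rewrite /shift /=.
have -> : h *: ((0, v) : R * V) + (t, x) = (t, h *: v + x).
  transitivity (h *: (0 : R) + t, h *: v + x); first by [].
  by rewrite scaler0 add0r.
by [].
Qed.

Lemma smooth_on_section (P : R * V -> R) (U : set (R * V)) (t : R) :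
  (forall x, U (t, x)) -> smooth_on U P -> smooth_on setT (fun x => P (t, x)).
Proof.
move=> Ut sP vs x _; rewrite foldr_derive_section.
set G := foldr _ _ _.
have dG : differentiable G (t, x) by exact: sP.
apply: (differentiable_comp (f := fun x => (t, x)) (g := G)) => //.
Qed.

Lemma derivable_section (P : R * V -> R) (t : R) (x : V) :
  differentiable P (t, x) -> derivable (fun s => P (s, x)) t 1.
Proof.
move=> dP; apply/derivable1_diffP.
apply: (differentiable_comp (f := fun s => (s, x)) (g := P)) => //.
Qed.

Lemma divergence_add (X Y : V -> V) x :
  (forall i, differentiable (fun y => X y ord0 i) x) ->
  (forall i, differentiable (fun y => Y y ord0 i) x) ->
  divergence (fun y => X y + Y y) x = divergence X x + divergence Y x.
Proof.
move=> dX dY; rewrite /divergence -big_split /=; apply: eq_bigr => i _.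
rewrite /partial -(derive_add _ (dX i) (dY i)); congr ('D_ _ _ _).
by apply/funext => y; rewrite mxE.
Qed.

Lemma grad_comp (phi phi1 : R -> R) (f : V -> R) x : differentiable f x ->
  is_derive (f x) 1 phi (phi1 (f x)) ->
  grad (fun x => phi (f x)) x = phi1 (f x) *: grad f x.
Proof.
by move=> df dphi; apply/rowP => i; rewrite !mxE /partial (derive_comp _ df dphi).
Qed.

End smooth_sections.

(** h(t) e^(ct) does not increase, and tends to h0 at 0. *)
Lemma gronwall_decay {R : realType} (h h' : R -> R) (h0 c : R) :
  (forall t : R, 0 < t -> is_derive t 1 h (h' t)) ->
  (forall t, 0 < t -> h' t <= - c * h t) ->
  h t @[t --> 0^'+] --> h0 ->
  forall t, 0 < t -> h t <= h0 * expR (- (c * t)).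
Proof.
move=> dh hle ch t t0.
pose g s := h s * expR (c * s).
have dg (s : R) : 0 < s -> is_derive s 1 g (h s * (c * expR (c * s)) + expR (c * s) * h' s).
  move=> s0; have := dh _ s0 => ?.
  have dE : is_derive s 1 (fun s => expR (c * s)) (c * expR (c * s)).
    have dl : is_derive s 1 (fun s => c * s) c.
      by apply: is_derive_eq; rewrite /GRing.scale /= mulr1 ?mulr0 ?addr0.
    have := @is_derive1_comp _ expR (fun s => c * s) s _ _ (is_derive_expR _) dl.
    by rewrite mulrC.
  by apply: is_derive_eq; rewrite /GRing.scale /=.
have mono (s u : R) : 0 < s -> s <= u -> g u <= g s.
  move=> s0; rewrite le_eqVlt => /predU1P[->//|su].
  have pos (z : R) : z \in `[s, u] -> 0 < z.
    by rewrite in_itv /= => /andP[sz _]; exact: lt_le_trans sz.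
  have pos' (z : R) : z \in `]s, u[ -> 0 < z.
    by rewrite in_itv /= => /andP[sz _]; exact: lt_trans sz.
  apply: (@ler0_derive1_nincr _ g s u) => //; last exact: ltW.
  - by move=> z /pos' z0; case: (dg _ z0).
  - move=> z /pos' z0; rewrite derive1E (@derive_val _ _ _ _ _ _ _ (dg _ z0)).
    have -> : h z * (c * expR (c * z)) + expR (c * z) * h' z =
      expR (c * z) * (h' z - - c * h z) by ring.
    by rewrite pmulr_rle0 ?expR_gt0// subr_le0 hle.
  - apply: derivable_within_continuous => z /pos z0.
    by case: (dg _ z0).
have gc : g s @[s --> 0^'+] --> h0 * expR (c * 0).
  apply: cvgM => //; apply: cvg_at_right_filter.
  have : continuous (fun s : R => expR (c * s)).
    move=> s; apply: (continuous_comp (g := expR)); last exact: continuous_expR.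
    exact: mulrl_continuous.
  exact.
have : g t <= h0.
  rewrite mulr0 expR0 mulr1 in gc.
  apply: (ler_cvg_to (a := 0^'+) (cvg_cst (g t)) gc).
  near=> s; apply: mono; near: s.
    exact: nbhs_right_gt.
  exact: nbhs_right_le.
rewrite /g expRN -ler_pdivlMr ?expR_gt0//.
Unshelve. all: by end_near. Qed.

Section renyi_gen.
Context {R : realType}.

Lemma is_derive_subr (f : R -> R) (x df c : R) : is_derive x 1 f df ->
  is_derive x 1 (fun s => f s - c) df.
Proof. by move=> dfx; apply: is_derive_eq; rewrite subr0. Qed.

Lemma is_derive_renyi_gen1 (y : R) : 0 < y ->
  is_derive y 1 (renyi_gen 1) (ln y + 1).
Proof.
move=> y0; have dl := is_derive1_ln y0.
have -> : renyi_gen 1 = (fun y : R => y * ln y).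
  by apply/funext => z; rewrite /renyi_gen eqxx.
apply: is_derive_eq; rewrite /GRing.scale /= mulfV ?gt_eqF// mulr1.
by rewrite addrC.
Qed.

Lemma is_derive_lnD1 (y : R) : 0 < y -> is_derive y 1 (fun y => ln y + 1) y^-1.
Proof. by move=> y0; have dl := is_derive1_ln y0; apply: is_derive_eq; rewrite addr0. Qed.

Lemma is_derive_renyi_gen (b y : R) : b != 1 -> 0 < y ->
  is_derive y 1 (renyi_gen b) (b * y `^ (b - 1)).
Proof.
move=> b1 y0; have -> : renyi_gen b = (fun z : R => z `^ b).
  by apply/funext => z; rewrite /renyi_gen (negbTE b1).
exact: is_derive1_powR.
Qed.

Lemma is_derive_powRZ (b c y : R) : 0 < y ->
  is_derive y 1 (fun y => b * y `^ c) (b * (c * y `^ (c - 1))).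
Proof.
move=> y0; have dl := is_derive1_powR c y0; apply: is_derive_eq.
by [].
Qed.

End renyi_gen.

Lemma integrable_density {R : realType} {d : nat} (p : 'rV[R]_d -> R) :
  is_density p ->
  (lebesgue_rV d).-integrable setT (EFin \o p) /\
  \int[lebesgue_rV d]_x p x = 1.
Proof.
case=> mp p0 ip; split; last by rewrite /Rintegral ip.
apply/integrableP; split; first exact/measurable_EFinP.
rewrite (_ : (\int[_]_x `|(EFin \o p) x|)%E =
    (\int[lebesgue_rV d]_x (p x)%:E)%E).
  by rewrite ip ltry.
by apply: eq_integral => x _; rewrite /= ger0_norm.
Qed.

Section flow.
Context {R : realType} {d : nat}.
Local Notation Vt := 'rV[R]_d.
Local Notation mu := (@lebesgue_rV R d).
Variables (V : Vt -> R) (p0 : Vt -> R) (p : R -> Vt -> R) (K : R).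
Hypothesis V_smooth : smooth_on setT V.
Hypothesis V_norm : (\int[mu]_x (gibbs V x)%:E = 1)%E.
Hypothesis K_gt0 : 0 < K.
Hypothesis V_convex : forall x, loewner_le K%:M (hessian V x).
Hypothesis p_sol : fokker_planck_solution V p0 p.
Local Notation q := (gibbs V).

Let CV : C2 V. Proof. exact: smooth_C2. Qed.
Let cV : continuous V. Proof. exact: C2_continuous. Qed.
Let convV x z := strongly_convex_ge CV V_convex x z.
Let q0 x : 0 < q x. Proof. exact: gibbs_gt0. Qed.

(** The function r_t of the introduction. *)
Definition rel_density (t : R) (x : Vt) : R := p t x / q x.
Local Notation r := rel_density.

Lemma rel_densityE t : r t = fun x => p t x * expR (V x).
Proof. by apply/funext => x; rewrite /r /gibbs expRN invrK. Qed.

Lemma C2_solution t : 0 < t -> C2 (p t).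
Proof.
move=> t0; apply: smooth_C2.
exact: (smooth_on_section (P := fun tx => p tx.1 tx.2) (t := t) _ (fp_smooth p_sol)).
Qed.

Lemma C2_expR_potential : C2 (fun x => expR (V x)).
Proof.
apply: (C2_comp (phi := expR) (phi1 := expR) (phi2 := expR)) => // x.
exact: continuous_expR.
Qed.

Lemma C2_rel_density t : 0 < t -> C2 (r t).
Proof.
by move=> t0; rewrite rel_densityE; exact: (C2M (C2_solution t0) C2_expR_potential).
Qed.

Lemma rel_density_gt0 t x : 0 < t -> 0 < r t x.
Proof. by move=> t0; rewrite divr_gt0// (fp_gt0 p_sol). Qed.

Lemma rel_densityK t x : r t x * q x = p t x.
Proof. by rewrite /r divfK// gt_eqF. Qed.

Lemma derivable_solution t x : 0 < t -> derivable (fun s => p s x) t 1.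
Proof.
move=> t0; apply: (derivable_section (P := fun tx => p tx.1 tx.2)).
exact: (fp_smooth p_sol [::]).
Qed.

(** This identity is p grad V + grad p = q grad (p / q): the equation is in
   divergence form relative to the stationary density. *)
Lemma flux_rel_density t x : 0 < t ->
  p t x *: grad V x + grad (p t) x = q x *: grad (r t) x.
Proof.
move=> t0; rewrite rel_densityE.
rewrite (grad_mul x (C2_solution t0) C2_expR_potential).
have dV : differentiable V x by exact: C2_differentiable.
rewrite (grad_comp (phi := expR) (phi1 := expR) dV (is_derive_expR _)).
have E1 : q x * expR (V x) = 1 by rewrite /gibbs expRN mulVf// gt_eqF// expR_gt0.
by rewrite scalerDr !scalerA mulrAC E1 mul1r scale1r.
Qed.

Lemma flux_divergence t x : 0 < t ->
  derive1 (fun s => p s x) t =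
  divergence (fun y => p t y *: grad V y + grad (p t) y) x.
Proof.
move=> t0; rewrite (fp_eq p_sol)// divergence_add// => i.
- have -> : (fun y => (p t y *: grad V y) ord0 i) = (fun y => p t y * partial i V y).
    by apply/funext => y; rewrite !mxE.
  apply: differentiable_mul; first exact: C2_differentiable (C2_solution t0).
  by have [_ + _] := CV; apply.
- have -> : (fun y => (grad (p t) y) ord0 i) = partial i (p t).
    by apply/funext => y; rewrite !mxE.
  by have [_ + _] := C2_solution t0; apply.
Qed.

(** Here [phi1] and [phi2] are the first two derivatives of [renyi_gen b]. The time
   derivative of the integrand is phi1(r) div (q grad r); integrating by parts
   and using grad phi1(r) = phi2(r) grad r gives the dissipation. *)
Lemma flow_derive (b : R) (phi1 phi2 : R -> R) : renyi_regular V p b ->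
  (forall y : R, 0 < y -> is_derive y 1 (renyi_gen b) (phi1 y)) ->
  (forall y : R, 0 < y -> is_derive y 1 phi1 (phi2 y)) ->
  forall t, 0 < t ->
  mu.-integrable setT
    (EFin \o (fun x => phi2 (r t x) * dot (grad (r t) x) (grad (r t) x) * q x)) /\
  is_derive t 1 (fun s => \int[mu]_x renyi_integrand b (p s) q x)
    (- \int[mu]_x (phi2 (r t x) * dot (grad (r t) x) (grad (r t) x) * q x)).
Proof.
move=> reg d1 d2 t t0.
have [i1 D1] := rr_derive reg t0.
have [i2 i3 E] := rr_parts reg t0.
have wEx x : derive1 (renyi_gen b) (p t x / q x) = phi1 (r t x).
  rewrite derive1E.
  by rewrite (@derive_val _ _ _ _ _ _ _ (d1 _ (rel_density_gt0 x t0))).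
have wE : (fun x => derive1 (renyi_gen b) (p t x / q x)) = (fun x => phi1 (r t x)).
  exact/funext.
have dr x : differentiable (r t) x by exact: C2_differentiable (C2_rel_density t0).
have gE : (fun x => dot (grad (fun x => derive1 (renyi_gen b) (p t x / q x)) x)
    (p t x *: grad V x + grad (p t) x)) =
    (fun x => phi2 (r t x) * dot (grad (r t) x) (grad (r t) x) * q x).
  apply/funext => x; rewrite wE flux_rel_density//.
  rewrite (grad_comp (dr x) (d2 _ (rel_density_gt0 x t0))).
  by rewrite dotZl dotZr [RHS]mulrAC mulrA.
have tE : (fun x => derive1 (fun s => renyi_integrand b (p s) q x) t) =
    (fun x => derive1 (renyi_gen b) (p t x / q x) *
      divergence (fun y => p t y *: grad V y + grad (p t) y) x).
  apply/funext => x; rewrite -(flux_divergence x t0) wEx.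
  have dp : derivable (fun s => p s x) t 1 by exact: derivable_solution.
  have dpt : is_derive t 1 (fun s => p s x) (derive1 (fun s => p s x) t).
    by rewrite derive1E; exact: DeriveDef.
  have dr' : is_derive t 1 (fun s => r s x) (derive1 (fun s => p s x) t / q x).
    by apply: is_derive_eq; rewrite /GRing.scale /= mulr0 add0r mulrC.
  have dc := @is_derive1_comp _ (renyi_gen b) (fun s => r s x) t _ _
    (d1 _ (rel_density_gt0 x t0)) dr'.
  have dd : is_derive t 1 (fun s => renyi_gen b (r s x) * q x)
      (phi1 (r t x) * derive1 (fun s => p s x) t).
    apply: is_derive_eq; rewrite /GRing.scale /= mulr0 add0r mulrC -mulrA divfK//.
    by rewrite gt_eqF.
  by rewrite derive1E (@derive_val _ _ _ _ _ _ _ dd).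
rewrite /= gE in i3; split; first exact: i3.
by move: D1; rewrite /= tE E gE.
Qed.

Lemma integrable_rel_density t : 0 <= t ->
  mu.-integrable setT (EFin \o (fun x => r t x * q x)) /\
  \int[mu]_x (r t x * q x) = 1.
Proof.
move=> t0; have -> : (fun x => r t x * q x) = p t.
  by apply/funext => x; exact: rel_densityK.
exact: integrable_density (fp_density p_sol t0).
Qed.

(** The dissipation of y ln y is int |grad r|^2 / r q, at least 2K times the
   entropy by the logarithmic Sobolev inequality. *)
Lemma entropy_decay : renyi_regular V p 1 -> forall t, 0 <= t ->
  \int[mu]_x renyi_integrand 1 (p t) q x <=
  (\int[mu]_x renyi_integrand 1 (p 0) q x) * expR (- (2 * K * t)).
Proof.
move=> reg t; rewrite le_eqVlt => /predU1P[<-|]; first by rewrite mulr0 oppr0 expR0 mulr1.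
have D s (s0 : 0 < s) := flow_derive reg (@is_derive_renyi_gen1 R) (@is_derive_lnD1 R) s0.
apply: (gronwall_decay (fun s s0 => (D s s0).2) _ (rr_cvg0 reg)) => s s0.
rewrite mulNr lerN2.
have [i1 E1] := integrable_rel_density (ltW s0).
have i2 := rr_integrable reg (ltW s0).
have [i3 _] := D s s0.
have gE : (fun x => renyi_integrand 1 (p s) q x) = (fun x => r s x * ln (r s x) * q x).
  by apply/funext => x; rewrite /renyi_integrand /renyi_gen eqxx.
have dE : (fun x => (r s x)^-1 * dot (grad (r s) x) (grad (r s) x) * q x) =
    (fun x => dot (grad (r s) x) (grad (r s) x) / r s x * q x).
  by apply/funext => x; rewrite [_^-1 * _]mulrC.
rewrite dE in i3 *.
have := @log_sobolev R d V K (grad V) K_gt0 cV convV V_norm (r s) (C2_rel_density s0)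
  (fun x => rel_density_gt0 x s0) i1.
rewrite -gE E1 => /(_ i2 i3 ltr01 1 erefl).
by rewrite ln1 mulr0 subr0 ler_pdivlMr ?mulr_gt0// mulrC.
Qed.

(** The dissipation of y^2 is 2 int |grad r|^2 q, at least 2K times the variance
   of r by the Poincare inequality. *)
Lemma chi_square_decay : renyi_regular V p 2 -> forall t, 0 <= t ->
  \int[mu]_x renyi_integrand 2 (p t) q x - 1 <=
  (\int[mu]_x renyi_integrand 2 (p 0) q x - 1) * expR (- (2 * K * t)).
Proof.
move=> reg t; rewrite le_eqVlt => /predU1P[<-|]; first by rewrite mulr0 oppr0 expR0 mulr1.
have n21 : 2 != 1 :> R by rewrite -subr_eq0 (_ : 2 - 1 = 1 :> R) ?oner_eq0//; ring.
have D s (s0 : 0 < s) := flow_derive reg (fun y => is_derive_renyi_gen n21)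
  (fun y => @is_derive_powRZ R 2 (2 - 1) y) s0.
have E21 : 2 - 1 = 1 :> R by ring.
have phiE (y : R) : 0 < y -> 2 * ((2 - 1) * y `^ (2 - 1 - 1)) = 2 :> R.
  by move=> y0; rewrite E21 subrr powRr0 !mulr1.
have D' (s : R) : 0 < s -> is_derive s 1 (fun s => \int[mu]_x renyi_integrand 2 (p s) q x - 1)
   (- (2 * \int[mu]_x (dot (grad (r s) x) (grad (r s) x) * q x))) /\
  mu.-integrable setT (EFin \o (fun x => dot (grad (r s) x) (grad (r s) x) * q x)).
  move=> s0; have [i ds] := D s s0.
  have gE : (fun x => 2 * ((2 - 1) * r s x `^ (2 - 1 - 1)) *
       dot (grad (r s) x) (grad (r s) x) * q x) =
    (fun x => 2 * (dot (grad (r s) x) (grad (r s) x) * q x)).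
    by apply/funext => x; rewrite phiE ?mulrA// rel_density_gt0.
  rewrite gE in i ds.
  have i' : mu.-integrable setT (EFin \o (fun x => dot (grad (r s) x) (grad (r s) x) * q x)).
    have := integrableZl measurableT 2^-1 i.
    by under [X in mu.-integrable setT X -> _]eq_fun do rewrite /= -EFinM mulKf ?pnatr_eq0//.
  split => //; rewrite -RintegralZl//.
  exact: is_derive_subr.
apply: (gronwall_decay (fun s s0 => (D' s s0).1)).
- move=> s s0; rewrite mulNr lerN2.
  have [i1 E1] := integrable_rel_density (ltW s0).
  have i2 := rr_integrable reg (ltW s0).
  have [_ i3] := D' s s0.
  have gE : (fun x => renyi_integrand 2 (p s) q x) = (fun x => r s x ^+ 2 * q x).
    apply/funext => x; rewrite /renyi_integrand /renyi_gen (negbTE n21).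
    by rewrite powR_mulrn// ltW// rel_density_gt0.
  have := @poincare R d V K (grad V) K_gt0 cV convV V_norm (r s) (C2_rel_density s0) i1.
  rewrite -gE E1 => /(_ i2 i3).
  by rewrite expr1n ler_pdivlMr// -mulrA ler_pM2l// mulrC.
- apply: cvgB; [exact: (rr_cvg0 reg)|exact: cvg_cst].
Qed.

End flow.

(** * Hypercontractivity *)



Section power_inequalities.
Context {R : realType}.
Implicit Types (a b c x y r : R).

Lemma renyi_gen_expR a x : renyi_gen a (expR x) =
  if a == 1 then x * expR x else expR (a * x).
Proof.
rewrite /renyi_gen; case: ifP => _; first by rewrite expRK mulrC.
by rewrite /powR gt_eqF ?expR_gt0// expRK.
Qed.

(** Strict form of the convexity of exp, from the strict tangent inequality at
   a x applied at the two points x and 0. *)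
Lemma expR_strict_convex a x : 0 < a -> a < 1 -> x != 0 ->
  expR (a * x) < a * expR x + (1 - a).
Proof.
move=> a0 a1 x0.
have e0 := expR_gt0 (a * x).
have h1 : expR (a * x) * (1 + (1 - a) * x) < expR x.
  have -> : expR x = expR (a * x) * expR ((1 - a) * x).
    by rewrite -expRD; congr expR; ring.
  by rewrite ltr_pM2l// expR_gt1Dx// mulf_neq0// subr_eq0 eq_sym lt_eqF.
have h2 : expR (a * x) * (1 + - (a * x)) < 1.
  rewrite -[ltRHS](_ : expR (a * x) * expR (- (a * x)) = 1).
    by rewrite ltr_pM2l// expR_gt1Dx// oppr_eq0 mulf_neq0// gt_eqF.
  by rewrite -expRD subrr expR0.
have h3 : 0 < 1 - a by lra.
move: h1 h2; rewrite -(ltr_pM2l a0) -(ltr_pM2l h3 _ 1) mulr1 => h1 h2.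
have -> : expR (a * x) = a * (expR (a * x) * (1 + (1 - a) * x)) +
   (1 - a) * (expR (a * x) * (1 + - (a * x))) by ring.
exact: ltrD.
Qed.

Lemma expR_surj y : 0 < y -> y != 1 -> exists2 x, x != 0 & y = expR x.
Proof.
by move=> y0 y1; exists (ln y); [rewrite ln_eq0|rewrite lnK].
Qed.

Lemma renyi_gen_lt_tangent a y : 0 < a -> a < 1 -> 0 <= y -> y != 1 ->
  renyi_gen a y < 1 + a * (y - 1).
Proof.
move=> a0 a1; rewrite le_eqVlt => /predU1P[<- _|y0 y1].
  by rewrite /renyi_gen (lt_eqF a1) powR0 ?gt_eqF//; lra.
have [x x0 ->] := expR_surj y0 y1.
rewrite renyi_gen_expR (lt_eqF a1).
have := expR_strict_convex a0 a1 x0; lra.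
Qed.

Lemma renyi_gen_gt_tangent a y : 1 < a -> 0 <= y -> y != 1 ->
  1 + a * (y - 1) < renyi_gen a y.
Proof.
move=> a1; have a0 : 0 < a by lra.
rewrite le_eqVlt => /predU1P[<- _|y0 y1].
  by rewrite /renyi_gen (gt_eqF a1) powR0 ?gt_eqF//; lra.
have [x x0 ->] := expR_surj y0 y1.
rewrite renyi_gen_expR (gt_eqF a1).
have ia0 : 0 < a^-1 by rewrite invr_gt0.
have ia1 : a^-1 < 1 by rewrite invf_lt1.
have ax0 : a * x != 0 by rewrite mulf_neq0// gt_eqF.
have := expR_strict_convex ia0 ia1 ax0.
rewrite mulKf ?gt_eqF// -(ltr_pM2l a0) mulrDr mulrA mulfV ?gt_eqF// mul1r.
rewrite mulrBr mulr1 mulfV ?gt_eqF//; lra.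
Qed.

Lemma renyi_gen1_gt_tangent y : 0 <= y -> y != 1 -> y - 1 < renyi_gen 1 y.
Proof.
rewrite le_eqVlt => /predU1P[<- _|y0 y1].
  by rewrite /renyi_gen eqxx mul0r; lra.
have [x x0 ->] := expR_surj y0 y1.
rewrite renyi_gen_expR eqxx.
have := @expR_gt1Dx _ (- x); rewrite oppr_eq0 => /(_ x0) h.
have e0 := expR_gt0 x.
have h2 : expR x * expR (- x) = 1 by rewrite -expRD subrr expR0.
have : expR x * (1 + - x) < expR x * expR (- x) by rewrite ltr_pM2l.
rewrite h2; lra.
Qed.

Lemma renyi_gen_ge_tangent a y : 1 < a -> 0 <= y -> 1 + a * (y - 1) <= renyi_gen a y.
Proof.
move=> a1 y0; have [->|y1] := eqVneq y 1.
  by rewrite /renyi_gen (gt_eqF a1) powR1; lra.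
exact: ltW (renyi_gen_gt_tangent a1 y0 y1).
Qed.

(** Convexity of the exponent in r^a, as the weighted arithmetic-geometric inequality. *)
Lemma powR_chord r a b c : 0 < r -> b < a -> a <= c ->
  r `^ a <= r `^ b + (a - b) / (c - b) * (r `^ c - r `^ b).
Proof.
move=> r0 ba; rewrite le_eqVlt => /predU1P[<-|ac].
  by rewrite divff ?mul1r ?subr_eq0 ?gt_eqF// addrC subrK.
have cb : 0 < c - b by lra.
have cb0 : c - b != 0 by rewrite gt_eqF.
have t0 : 0 < (c - a) / (c - b) by rewrite divr_gt0//; lra.
have s0 : 0 < (a - b) / (c - b) by rewrite divr_gt0//; lra.
have ts : (c - a) / (c - b) + (a - b) / (c - b) = 1 by field.
have := weighted_AMGM t0 s0 ts (powR_ge0 r b) (powR_ge0 r c).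
rewrite -!powRrM -powRD; last by rewrite (gt_eqF r0) implybT.
have -> : b * ((c - a) / (c - b)) + c * ((a - b) / (c - b)) = a by field.
move/le_trans; apply.
by rewrite le_eqVlt; apply/orP; left; apply/eqP; field.
Qed.

(** Difference quotient of r^c in the exponent. It increases with [c] and tends to
   r^b ln r as [c] decreases to [b]. *)
Definition powR_slope r b c := (r `^ c - r `^ b) / (c - b).

Lemma powR_slope_le r a b c : 0 < r -> b < c -> c <= a ->
  powR_slope r b c <= powR_slope r b a.
Proof.
move=> r0 bc ca; rewrite /powR_slope ler_pdivrMr ?subr_gt0//.
rewrite lerBlDl mulrC [_ / (a - b)]mulrC mulrA.
exact: powR_chord.
Qed.

Lemma powR_slope_ge r b c : 0 < r -> b < c -> r `^ b * ln r <= powR_slope r b c.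
Proof.
move=> r0 bc; rewrite /powR_slope ler_pdivlMr ?subr_gt0//.
have -> : r `^ c = r `^ b * expR ((c - b) * ln r).
  have -> : expR ((c - b) * ln r) = r `^ (c - b) by rewrite /powR gt_eqF.
  by rewrite -powRD ?(gt_eqF r0) ?implybT//; congr powR; lra.
rewrite -mulrA -[X in _ <= _ - X](mulr1 (r `^ b)) -mulrBr ler_pM2l ?powR_gt0//.
by rewrite lerBrDl mulrC expR_ge1Dx.
Qed.

Lemma powR_ln_ge r b : 0 < r -> 1 <= b -> -1 <= r `^ b * ln r.
Proof.
move=> r0 b1; set x := ln r.
have -> : r `^ b = expR (b * x) by rewrite /powR gt_eqF.
have [x0|x0] := leP 0 x.
  by rewrite (le_trans (y := 0)) ?lerN10// mulr_ge0// expR_ge0.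
have h : - x <= expR (- (b * x)) by have := expR_ge1Dx (- (b * x)); nra.
have : expR (b * x) * - x <= expR (b * x) * expR (- (b * x)) by rewrite ler_pM2l ?expR_gt0.
rewrite -expRD subrr expR0; lra.
Qed.

(** The slopes for c in ]b, a] lie between r^b ln r >= -1 and the slope at a: this
   is the domination in [power_integral_slope]. *)
Lemma powR_slope_abs_le r a b c : 0 < r -> 1 <= b -> b < c -> c <= a ->
  `|powR_slope r b c| <= 1 + `|powR_slope r b a|.
Proof.
move=> r0 b1 bc ca; have h1 := powR_slope_le r0 bc ca.
have h2 := powR_slope_ge r0 bc; have h3 := powR_ln_ge r0 b1.
have h4 := ler_norm (powR_slope r b a); have h5 := normr_ge0 (powR_slope r b a).
by rewrite ler_norml; apply/andP; split; lra.
Qed.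

Lemma is_derive_cvg (f : R -> R) x df : is_derive x 1 f df ->
  h^-1 * (f (x + h) - f x) @[h --> 0^'] --> df.
Proof.
case=> dfx <-; have := dfx; rewrite /derivable /derive.
have -> : (fun h : R => h^-1 *: ((f \o shift x) (h *: (1 : R)) - f x)) =
    (fun h => h^-1 * (f (x + h) - f x)).
  by apply/funext => h /=; rewrite [h%:A]mulr1 [h + x]addrC.
by [].
Qed.

Lemma powR_slope_cvg r b (h : nat -> R) : 0 < r -> (forall n, h n != 0) ->
  h n @[n --> \oo] --> 0 ->
  powR_slope r b (b + h n) @[n --> \oo] --> r `^ b * ln r.
Proof.
move=> r0 h0 hc.
have dl : is_derive b 1 (fun c : R => c * ln r) (ln r).
  by apply: is_derive_eq; rewrite /GRing.scale /= ?mulr0 ?add0r ?mulr1.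
have dE := @is_derive1_comp _ expR (fun c : R => c * ln r) b _ _ (is_derive_expR _) dl.
have rE c : r `^ c = expR (c * ln r) by rewrite /powR gt_eqF.
have := is_derive_cvg dE => /cvgr_dnbhsP /(_ h (conj h0 hc)).
rewrite -rE; apply: cvg_trans; apply: near_eq_cvg; apply: nearW => n.
by rewrite /powR_slope addrAC subrr add0r !rE mulrC.
Qed.

Lemma derive_right_le (f : R -> R) (x df e : R) : is_derive x 1 f df -> df < e ->
  exists2 del : R, 0 < del & forall h, 0 < h -> h < del -> f (x + h) <= f x + e * h.
Proof.
move=> dfx dfe; have /cvgr_lt/(_ _ dfe) := is_derive_cvg dfx.
case=> del /= del0 H; exists del => // h h0 hd.
have := H h; rewrite /= sub0r normrN gtr0_norm// => /(_ hd).
rewrite gt_eqF// => /(_ isT).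
rewrite mulrC ltr_pdivrMr// => H1.
by rewrite -lerBlDl ltW.
Qed.

(** A function with nonpositive upper right Dini derivative may still jump upwards
   unless it is controlled from the left; the second hypothesis is a weak form
   of lower semicontinuity from the left. The proof takes the supremum of
   the points up to which f v <= f 0 + e v. *)
Lemma dini_nonincreasing (f : R -> R) (T : R) : 0 <= T ->
  (forall u e, 0 <= u -> u < T -> 0 < e -> exists2 del : R, 0 < del &
    forall h, 0 < h -> h < del -> f (u + h) <= f u + e * h) ->
  (forall u M, 0 < u -> u <= T -> (forall v, 0 <= v -> v < u -> f v <= M) -> f u <= M) ->
  f T <= f 0.
Proof.
move=> T0 right left.
have key e : 0 < e -> f T <= f 0 + e * T.
  move=> e0.
  pose S := [set u : R | 0 <= u <= T /\ forall v, 0 <= v -> v <= u -> f v <= f 0 + e * v].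
  have S0 : S 0.
    split; first by rewrite lexx T0.
    move=> v v0 v1; have -> : v = 0 by apply/eqP; rewrite eq_le v0 v1.
    by rewrite mulr0 addr0.
  have supS : has_sup S by split; [exists 0|exists T => u [/andP[]]].
  set s := sup S.
  have s0 : 0 <= s by exact: (ub_le_sup supS.2 S0).
  have sT : s <= T by apply: ge_sup; [exists 0|move=> u [/andP[]]].
  have below v : 0 <= v -> v < s -> f v <= f 0 + e * v.
    move=> v0 vs; have [u [_ Su] vu] := sup_gt supS.1 vs.
    by apply: Su => //; exact: ltW.
  have Ss : f s <= f 0 + e * s.
    move: s0; rewrite le_eqVlt => /predU1P[<-|s0]; first by rewrite mulr0 addr0.
    apply: left => // v v0 vs; apply: (le_trans (below v v0 vs)).
    by rewrite lerD2l ler_pM2l// ltW.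
  move: sT; rewrite le_eqVlt => /predU1P[<-//|sT].
  have [del del0 Hdel] := right s e s0 sT e0.
  pose u := Num.min (s + del / 2) T.
  have su : s < u by rewrite lt_min sT andbT; lra.
  have : S u.
    split; first by rewrite ge_min lexx orbT andbT (le_trans s0)// ltW.
    move=> v v0 vu; have [vs|vs|->//] := ltgtP v s; first exact: below.
    have vd : v <= s + del / 2 by rewrite (le_trans vu)// ge_min lexx.
    have E : s + (v - s) = v by rewrite addrC subrK.
    have := Hdel (v - s); rewrite E.
    have h1 : 0 < v - s by lra.
    have h2 : v - s < del by lra.
    move=> /(_ h1 h2) h3; apply: (le_trans h3).
    apply: (le_trans (y := f 0 + e * s + e * (v - s))); first by rewrite lerD2r.
    by rewrite le_eqVlt; apply/orP; left; apply/eqP; ring.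
  by move=> /(ub_le_sup supS.2); rewrite leNgt su.
apply/ler_addgt0Pr => e e0.
have T1 : 0 < T + 1 by lra.
apply: (le_trans (key (e / (T + 1)) (divr_gt0 e0 T1))).
rewrite lerD2l mulrAC ler_pdivrMr// ler_pM2l//; lra.
Qed.

End power_inequalities.

(** Derivative at [u] of the majorant of [log_norm] used in [log_norm_right]; A and
   C are integrals of fixed orders, so only derivatives in time occur. *)
Lemma is_derive_log_ratio {R : realType} (A C be : R -> R) (u dA dC dbe b k : R) :
  is_derive u 1 A dA -> is_derive u 1 C dC -> is_derive u 1 be dbe ->
  be u = b -> 0 < b -> 0 < A u ->
  is_derive u 1 (fun v => ln (A v + (be v - b) * k * (C v - A v)) / be v)
    ((dA + dbe * (k * (C u - A u))) / A u / b - ln (A u) * dbe / b ^+ 2).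
Proof.
move=> hA hC hb bE b0 A0.
have Mu : A u + (be u - b) * k * (C u - A u) = A u by rewrite bE subrr !mul0r addr0.
have dM : is_derive u 1 (fun v => A v + (be v - b) * k * (C v - A v))
    (dA + dbe * (k * (C u - A u))).
  by apply: is_derive_eq; rewrite /GRing.scale /= bE; ring.
have dln : is_derive (A u + (be u - b) * k * (C u - A u)) 1 (@ln R) (A u)^-1.
  by rewrite Mu; exact: is_derive1_ln.
have dN := @is_derive1_comp _ (@ln R) (fun v => A v + (be v - b) * k * (C v - A v)) u _ _ dln dM.
have be0 : be u != 0 by rewrite bE gt_eqF.
have dV := is_deriveV be0 hb.
apply: is_derive_eq.
rewrite /GRing.scale /= Mu bE; field.
by rewrite !gt_eqF.
Qed.

(** The balance of terms behind hypercontractivity. The order grows at speed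
   2K (b - 1), which makes the entropy term equal to the bound of the
   dissipation term by the logarithmic Sobolev inequality; the slope [Q] exceeds
   its limit [L] by an amount that costs less than [e]. *)
Lemma log_ratio_arith {R : realType} (K b D A L Q e l : R) : 0 < K -> 1 < b -> 0 < A -> 0 < e ->
  b * L - A * l <= b / (b - 1) * D / (2 * K) ->
  Q <= L + e * A * b / (2 * (2 * K * (b - 1))) ->
  (- D + 2 * K * (b - 1) * Q) / A / b - l * (2 * K * (b - 1)) / b ^+ 2 < e.
Proof.
move=> K0 b1 A0 e0 H1 H2.
have b0 : 0 < b by lra.
have b10 : 0 < b - 1 by lra.
set B := 2 * K * (b - 1) in H2 *.
have B0 : 0 < B by rewrite /B !mulr_gt0.
have H3 : B * (b * L - A * l) <= b * D.
  have -> : b * D = B * (b / (b - 1) * D / (2 * K)).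
    by rewrite /B; field; rewrite !gt_eqF.
  by rewrite ler_pM2l.
have H4 : b * B * Q <= b * B * L + e / 2 * (A * b ^+ 2).
  have -> : b * B * L + e / 2 * (A * b ^+ 2) = b * B * (L + e * A * b / (2 * B)).
    by field; rewrite gt_eqF.
  by rewrite ler_pM2l// mulr_gt0.
have -> : (- D + B * Q) / A / b - l * B / b ^+ 2 =
    (- (b * D) + b * B * Q - A * l * B) / (A * b ^+ 2).
  by field; rewrite !gt_eqF.
have P0 : 0 < A * b ^+ 2 by rewrite mulr_gt0// exprn_gt0.
rewrite ltr_pdivrMr//.
have P1 : 0 < e / 2 * (A * b ^+ 2) by rewrite mulr_gt0// divr_gt0.
have -> : e * (A * b ^+ 2) = e / 2 * (A * b ^+ 2) + e / 2 * (A * b ^+ 2) by field.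
move: H3; rewrite mulrBr.
have -> : B * (b * L) = b * B * L by ring.
have -> : B * (A * l) = A * l * B by ring.
move: (b * B * L) (A * l * B) (b * B * Q) (b * D) (e / 2 * (A * b ^+ 2)) H4 P1.
move=> ? ? ? ? ? *; lra.
Qed.

Lemma cvg_continuous_seq {R : realType} (f : R -> R) (u : nat -> R) (l : R) :
  {for l, continuous f} -> u n @[n --> \oo] --> l -> f (u n) @[n --> \oo] --> f l.
Proof. by move=> cf ul; exact: (cvg_comp u f ul cf). Qed.

Section hypercontractivity.
Context {R : realType} {d : nat}.
Local Notation Vt := 'rV[R]_d.
Local Notation mu := (@lebesgue_rV R d).
Variables (V : Vt -> R) (p0 : Vt -> R) (p : R -> Vt -> R) (K a : R).
Hypothesis V_smooth : smooth_on setT V.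
Hypothesis V_norm : (\int[mu]_x (gibbs V x)%:E = 1)%E.
Hypothesis K_gt0 : 0 < K.
Hypothesis V_convex : forall x, loewner_le K%:M (hessian V x).
Hypothesis p_sol : fokker_planck_solution V p0 p.
Hypothesis reg : forall b, 2 <= b -> b <= a -> renyi_regular V p b.
Local Notation q := (gibbs V).
Local Notation r := (rel_density V p).

Let CV : C2 V. Proof. exact: smooth_C2. Qed.
Let cV : continuous V. Proof. exact: C2_continuous. Qed.
Let convV x z := strongly_convex_ge CV V_convex x z.
Let q0 x : 0 < q x. Proof. exact: gibbs_gt0. Qed.
Let mq : measurable_fun setT q. Proof. exact: measurable_gibbs. Qed.
Let iq : mu.-integrable setT (EFin \o q). Proof. exact: (integrable_gibbs cV V_norm). Qed.

Definition power_integral b t := \int[mu]_x renyi_integrand b (p t) q x.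
Local Notation Phi := power_integral.

Let integrandE b t : 2 <= b -> renyi_integrand b (p t) q = fun x => r t x `^ b * q x.
Proof.
move=> b2; apply/funext => x; rewrite /renyi_integrand /renyi_gen.
by rewrite gt_eqF//; lra.
Qed.

Let iPhi b t : 2 <= b -> b <= a -> 0 <= t ->
  mu.-integrable setT (EFin \o (fun x => r t x `^ b * q x)).
Proof. by move=> b2 ba t0; rewrite -(integrandE t b2); exact: (rr_integrable (reg b2 ba) t0). Qed.

Let PhiE b t : 2 <= b -> Phi b t = \int[mu]_x (r t x `^ b * q x).
Proof. by move=> b2; rewrite /Phi integrandE. Qed.

Lemma power_integral_ge1 b t : 2 <= b -> b <= a -> 0 <= t -> 1 <= Phi b t.
Proof.
move=> b2 ba t0; have [ir E] := integrable_rel_density p_sol t0.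
have [i1 E1] := Rintegral_linear (1 - b) b iq ir.
rewrite (_ : 1 = \int[mu]_x ((1 - b) * q x + b * (r t x * q x))).
  apply: le_Rintegral => //; first exact: (rr_integrable (reg b2 ba) t0).
  move=> x _; rewrite /renyi_integrand mulrA -mulrDl ler_pM2r//.
  have -> : 1 - b + b * r t x = 1 + b * (r t x - 1) by ring.
  apply: renyi_gen_ge_tangent; first lra.
  by rewrite divr_ge0 ?(ltW (q0 x))//; have [] := fp_density p_sol t0.
by rewrite E1 E (Rintegral_gibbs V_norm); ring.
Qed.

(** In the limit the slope of the integrals in the order is int r^b ln r q; both
   this and the integrability of r^b ln r are obtained by domination from the
   integrability for orders slightly above [b]. *)
Lemma power_integral_slope b t e : 2 <= b -> b < a -> 0 < t -> 0 < e ->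
  mu.-integrable setT (EFin \o (fun x => r t x `^ b * ln (r t x) * q x)) /\
  exists c, [/\ b < c, c <= a & (c - b)^-1 * (Phi c t - Phi b t) <=
    \int[mu]_x (r t x `^ b * ln (r t x) * q x) + e].
Proof.
move=> b2 ba t0 e0.
have r0 x : 0 < r t x by exact: (rel_density_gt0 p_sol).
have mr : measurable_fun setT (r t).
  exact: continuous_measurable_rV (C2_continuous (C2_rel_density V_smooth p_sol t0)).
pose h n : R := (a - b) / n.+1%:R.
have ab0 : 0 < a - b by rewrite subr_gt0.
have h0 n : 0 < h n by rewrite divr_gt0.
have ha n : b + h n <= a.
  by rewrite -lerBrDl ler_pdivrMr// ler_peMr ?ler1n// ltW.
have hc : h n @[n --> \oo] --> 0.
  rewrite -[0](mulr0 (a - b)); apply: cvgM; first exact: cvg_cst.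
  exact: cvg_harmonic.
have bh n : b < b + h n by rewrite ltrDl.
have islope c : b < c -> c <= a ->
    mu.-integrable setT (EFin \o (fun x => powR_slope (r t x) b c * q x)) /\
    \int[mu]_x (powR_slope (r t x) b c * q x) = (c - b)^-1 * (Phi c t - Phi b t).
  move=> bc ca.
  have c2 : 2 <= c by rewrite (le_trans b2)// ltW.
  have [i E] := Rintegral_linear (c - b)^-1 (- (c - b)^-1) (iPhi c2 ca (ltW t0))
    (iPhi b2 (ltW ba) (ltW t0)).
  have -> : (fun x => powR_slope (r t x) b c * q x) =
     (fun x => (c - b)^-1 * (r t x `^ c * q x) + - (c - b)^-1 * (r t x `^ b * q x)).
    by apply/funext => x; rewrite /powR_slope; ring.
  by split => //; rewrite E !PhiE//; ring.
have [ia _] := islope a ba (lexx _).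
have [il lim] : mu.-integrable setT (EFin \o (fun x => r t x `^ b * ln (r t x) * q x)) /\
    \int[mu]_x (powR_slope (r t x) b (b + h n) * q x) @[n --> \oo] -->
    \int[mu]_x (r t x `^ b * ln (r t x) * q x).
  have mpow c : measurable_fun setT (fun x => r t x `^ c).
    by apply: (measurableT_comp (f := fun y : R => y `^ c)) => //; exact: measurable_powR.
  apply: (@Rdominated_convergence _ _ _ mu (fun n x => powR_slope (r t x) b (b + h n) * q x)
    (fun x => r t x `^ b * ln (r t x) * q x)
    (fun x => 1 * q x + 1 * `|powR_slope (r t x) b a * q x|)).
  - by move=> n; have [/integrableP[/measurable_EFinP]] := islope _ (bh n) (ha n).
  - apply: measurable_funM => //; apply: measurable_funM; first exact: mpow.
    exact: measurableT_comp.
  - move=> x; apply: cvgM; last exact: cvg_cst.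
    by apply: powR_slope_cvg => // n; rewrite gt_eqF.
  - have in_ := integrable_norm ia.
    by have [] := Rintegral_linear 1 1 iq in_.
  - move=> n x; have nq y : `|y * q x| = `|y| * q x by rewrite normrM (gtr0_norm (q0 x)).
    rewrite !nq !mul1r.
    have -> : q x + `|powR_slope (r t x) b a| * q x =
      (1 + `|powR_slope (r t x) b a|) * q x by ring.
    rewrite ler_pM2r//; apply: powR_slope_abs_le => //; lra.
split => //.
set L := \int[mu]_x (r t x `^ b * ln (r t x) * q x) in lim *.
have Le : L < L + e by rewrite ltrDl.
have [N _ H] := @cvgr_le _ _ _ _ _ _ lim _ Le.
exists (b + h N); split => //.
have [_ <-] := islope _ (bh N) (ha N).
exact: (H N (leqnn N)).
Qed.

(** Minus the time derivative of [power_integral]. *)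
Definition power_dissipation b t :=
  \int[mu]_x (b * ((b - 1) * r t x `^ (b - 1 - 1)) *
    dot (grad (r t) x) (grad (r t) x) * q x).
Local Notation J := power_dissipation.

Lemma power_integral_derive b t : 2 <= b -> b <= a -> 0 < t ->
  mu.-integrable setT (EFin \o (fun x => b * ((b - 1) * r t x `^ (b - 1 - 1)) *
    dot (grad (r t) x) (grad (r t) x) * q x)) /\
  is_derive t 1 (Phi b) (- J b t).
Proof.
move=> b2 ba t0; have b1 : b != 1 by rewrite gt_eqF//; lra.
exact: (flow_derive V_smooth p_sol (reg b2 ba) (fun y => is_derive_renyi_gen b1)
  (fun y => @is_derive_powRZ R b (b - 1) y) t0).
Qed.

(** The logarithmic Sobolev inequality for f = r^b, for which
   |grad f|^2 / f = b^2 r^(b-2) |grad r|^2. *)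
Lemma power_log_sobolev b t : 2 <= b -> b < a -> 0 < t ->
  b * \int[mu]_x (r t x `^ b * ln (r t x) * q x) - Phi b t * ln (Phi b t) <=
  b / (b - 1) * J b t / (2 * K).
Proof.
move=> b2 ba t0.
have b10 : b - 1 != 0 by rewrite gt_eqF//; lra.
have r0 x : 0 < r t x by exact: (rel_density_gt0 p_sol).
have Cr := C2_rel_density V_smooth p_sol t0.
have d1 x : is_derive (r t x) 1 (fun y => y `^ b) (b * r t x `^ (b - 1)) := @is_derive1_powR R b _ (r0 x).
have d2 (y : R) : 0 < y -> is_derive y 1 (fun y => b * y `^ (b - 1)) (b * ((b - 1) * y `^ (b - 1 - 1))).
  by move=> y0; exact: is_derive_powRZ.
have Cf : C2 (fun x => r t x `^ b).
  apply: (C2_comp (phi := fun y => y `^ b) (phi1 := fun y => b * y `^ (b - 1))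
    (phi2 := fun y => b * ((b - 1) * y `^ (b - 1 - 1))) Cr d1 (fun x => d2 _ (r0 x))) => x.
  apply: differentiable_continuous; apply/derivable1_diffP.
  have := @is_derive_powRZ R (b * (b - 1)) (b - 1 - 1) _ (r0 x).
  have -> : (fun y : R => b * (b - 1) * y `^ (b - 1 - 1)) =
    (fun y => b * ((b - 1) * y `^ (b - 1 - 1))) by apply/funext => y; rewrite mulrA.
  by case.
have f0 x : 0 < r t x `^ b by rewrite powR_gt0.
have [e _] := power_integral_slope b2 ba t0 ltr01.
have [iJ _] := power_integral_derive b2 (ltW ba) t0.
have gE x : dot (grad (fun x => r t x `^ b) x) (grad (fun x => r t x `^ b) x) / r t x `^ b =
    b / (b - 1) * (b * ((b - 1) * r t x `^ (b - 1 - 1)) * dot (grad (r t) x) (grad (r t) x)).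
  have -> : grad (fun x => r t x `^ b) x = (b * r t x `^ (b - 1)) *: grad (r t) x.
    exact: (grad_comp (phi := fun y => y `^ b) (phi1 := fun y => b * y `^ (b - 1))
      (C2_differentiable x Cr) (d1 x)).
  rewrite dotZl dotZr.
  have D c : r t x `^ (c + 1) = r t x `^ c * r t x.
    by rewrite powRD ?powRr1 ?(ltW (r0 x))// (gt_eqF (r0 x)) implybT.
  have y0 : r t x `^ (b - 1 - 1) != 0 by rewrite gt_eqF// powR_gt0.
  have Eb1 : r t x `^ (b - 1) = r t x `^ (b - 1 - 1) * r t x by rewrite -D subrK.
  have Eb : r t x `^ b = r t x `^ (b - 1) * r t x by rewrite -D subrK.
  rewrite Eb Eb1; move: (r t x `^ (b - 1 - 1)) y0 (dot _ _) => y y0 D2.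
  by field; rewrite y0 b10 gt_eqF// r0.
have lE x : ln (r t x `^ b) = b * ln (r t x) by rewrite ln_powR.
have i1 := iPhi b2 (ltW ba) (ltW t0).
have i2E : (fun x => r t x `^ b * ln (r t x `^ b) * q x) =
    (fun x => b * (r t x `^ b * ln (r t x) * q x)).
  by apply/funext => x; rewrite lE; ring.
have i3E : (fun x => dot (grad (fun x => r t x `^ b) x) (grad (fun x => r t x `^ b) x) /
      r t x `^ b * q x) = (fun x => b / (b - 1) * (b * ((b - 1) * r t x `^ (b - 1 - 1)) *
      dot (grad (r t) x) (grad (r t) x) * q x)).
  by apply/funext => x; rewrite gE; ring.
have i2 := integrableZl measurableT b e.
have i3 := integrableZl measurableT (b / (b - 1)) iJ.
have Phi0 : 0 < \int[mu]_x (r t x `^ b * q x).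
  by rewrite -PhiE//; apply: lt_le_trans (power_integral_ge1 b2 (ltW ba) (ltW t0)).
have := @log_sobolev R d V K (grad V) K_gt0 cV convV V_norm _ Cf f0 i1.
rewrite i2E i3E => /(_ i2 i3 Phi0 _ erefl).
by rewrite !RintegralZl// -PhiE.
Qed.

(** Logarithm of the norm of r_(s+u) in L^b(q) for b = 1 + e^(2Ku). *)
Definition log_norm s u :=
  ln (Phi (1 + expR (2 * K * u)) (s + u)) / (1 + expR (2 * K * u)).

Lemma is_derive_order (u : R) :
  is_derive u 1 (fun u => 1 + expR (2 * K * u)) (2 * K * (1 + expR (2 * K * u) - 1)).
Proof.
have dl : is_derive u 1 (fun s : R => 2 * K * s) (2 * K).
  by apply: is_derive_eq; rewrite /GRing.scale /= mulr1 ?mulr0 ?addr0.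
have := @is_derive1_comp _ expR (fun s : R => 2 * K * s) u _ _ (is_derive_expR _) dl.
move=> dE; have -> : 1 + expR (2 * K * u) - 1 = expR (2 * K * u) by ring.
have -> : (fun u => 1 + expR (2 * K * u)) = (fun u => (expR \o (fun s => 2 * K * s)) u + 1).
  by apply/funext => x; rewrite addrC.
by apply: is_derive_eq; rewrite addr0 mulrC.
Qed.

(** Nothing is known about the joint regularity of int r_t^b q in (b, t). For an
   upper bound to the right of [u] it suffices to replace r^b' with b' > b by the
   chord between the fixed orders b and c: the majorant is differentiable at
   [u], agrees with [log_norm] there, and its derivative is arbitrarily close to
   a nonpositive number when c is close to b. *)
Lemma log_norm_right s u e : 0 < s -> 0 <= u -> 1 + expR (2 * K * u) < a -> 0 < e ->
  exists2 del : R, 0 < del &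
  forall h, 0 < h -> h < del -> log_norm s (u + h) <= log_norm s u + e * h.
Proof.
move=> s0 u0; set b := 1 + expR (2 * K * u) => ba e0.
have K20 : 0 < 2 * K by rewrite mulr_gt0.
have E1 : 1 <= expR (2 * K * u).
  by apply: le_trans (expR_ge1Dx _); rewrite lerDl mulr_ge0// ltW.
have b2 : 2 <= b by rewrite /b; lra.
have t0 : 0 < s + u by rewrite ltr_pwDl.
have A1 := power_integral_ge1 b2 (ltW ba) (ltW t0).
have A0 : 0 < Phi b (s + u) by apply: lt_le_trans A1.
have b0 : 0 < b by lra.
have b1 : 1 < b by lra.
(* the admissible excess in [log_ratio_arith] *)
pose e' := e * Phi b (s + u) * b / (2 * (2 * K * (b - 1))).
have e'0 : 0 < e'.
  by rewrite divr_gt0 ?mulr_gt0// subr_gt0.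
have [_ [c [bc ca HQ]]] := power_integral_slope b2 ba t0 e'0.
have c2 : 2 <= c by rewrite (le_trans b2)// ltW.
have shift_derive c' : 2 <= c' -> c' <= a ->
    is_derive u 1 (fun v => Phi c' (s + v)) (- J c' (s + u)).
  move=> c'2 c'a; have [_ dP] := power_integral_derive c'2 c'a t0.
  have ds : is_derive u 1 (fun v : R => s + v) 1.
    by have := is_deriveD (is_derive_cst s u 1) (is_derive_id u (1 : R)); rewrite add0r.
  by have := @is_derive1_comp _ (Phi c') (fun v => s + v) u _ _ dP ds; rewrite mulr1.
have dN := is_derive_log_ratio (c - b)^-1 (shift_derive b b2 (ltW ba))
  (shift_derive c c2 ca) (is_derive_order u) erefl b0 A0.
have ve := log_ratio_arith K_gt0 b1 A0 e0 (power_log_sobolev b2 ba t0) HQ.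
have [del1 del10 H1] := derive_right_le dN ve.
(* up to u + del2 the order 1 + e^(2Kv) stays below c *)
pose del2 := ln (c - 1) / (2 * K) - u.
have c10 : 0 < c - 1 by rewrite subr_gt0 (lt_trans b1).
have del20 : 0 < del2.
  rewrite subr_gt0 ltr_pdivlMr// mulrC -ltr_expR lnK ?posrE//.
  by rewrite ltrBrDl.
exists (Num.min del1 del2); first by rewrite lt_min del10.
move=> h h0; rewrite lt_min => /andP[hd1 hd2].
have := H1 h h0 hd1.
set M := (X in ln X / _ <= _).
rewrite subrr !mul0r addr0 -/(log_norm s u) => HM.
apply: le_trans HM; rewrite /log_norm ler_pM2r ?invr_gt0; last first.
  by rewrite addr_gt0// expR_gt0.
set b' := 1 + expR (2 * K * (u + h)).
have bb' : b < b' by rewrite /b /b' ltrD2l ltr_expR ltr_pM2l// ltrDl.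
have b'c : b' <= c.
  rewrite /b' -lerBrDl -[leRHS]lnK ?posrE// ler_expR mulrC -ler_pdivlMr//.
  by rewrite -lerBrDl ltW.
have b'2 : 2 <= b' by rewrite (le_trans b2)// ltW.
have t'0 : 0 < s + (u + h) by rewrite addrA addr_gt0.
have b'a := le_trans b'c ca.
have PM : Phi b' (s + (u + h)) <= M.
  have [i E] := Rintegral_linear (1 - (b' - b) / (c - b)) ((b' - b) / (c - b))
    (iPhi b2 (ltW ba) (ltW t'0)) (iPhi c2 ca (ltW t'0)).
  have -> : M = \int[mu]_x ((1 - (b' - b) / (c - b)) * (r (s + (u + h)) x `^ b * q x) +
      (b' - b) / (c - b) * (r (s + (u + h)) x `^ c * q x)).
    rewrite E /M -!PhiE// -/b' -/b.
    by move: (Phi b _) (Phi c _) (_ / _) => P1 P2 k; ring.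
  rewrite PhiE//; apply: le_Rintegral => //; first exact: iPhi b'2 b'a (ltW t'0).
  move=> x _.
  have -> : (1 - (b' - b) / (c - b)) * (r (s + (u + h)) x `^ b * q x) +
      (b' - b) / (c - b) * (r (s + (u + h)) x `^ c * q x) =
    (r (s + (u + h)) x `^ b + (b' - b) / (c - b) *
      (r (s + (u + h)) x `^ c - r (s + (u + h)) x `^ b)) * q x by ring.
  rewrite ler_pM2r//; apply: powR_chord => //.
  exact: (rel_density_gt0 p_sol).
have P'0 : 0 < Phi b' (s + (u + h)).
  by apply: lt_le_trans (power_integral_ge1 b'2 b'a (ltW t'0)).
by rewrite ler_ln ?posrE//; exact: lt_le_trans PM.
Qed.

(** Fatou's lemma along times increasing to [u]. *)
Lemma log_norm_left s u M : 0 < s -> 0 < u -> 1 + expR (2 * K * u) <= a ->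
  (forall v, 0 <= v -> v < u -> log_norm s v <= M) -> log_norm s u <= M.
Proof.
move=> s0 u0 ua HM.
have K20 : 0 < 2 * K by rewrite mulr_gt0.
pose v n : R := u - u / n.+1%:R.
have vu n : v n < u by rewrite ltrBlDr ltrDl divr_gt0.
have v0 n : 0 <= v n by rewrite subr_ge0 ler_pdivrMr// ler_peMr ?ler1n// ltW.
have vc : v n @[n --> \oo] --> u.
  rewrite -[X in _ --> X]subr0 -[X in _ --> _ - X](mulr0 u).
  apply: cvgB; first exact: cvg_cst.
  by apply: cvgM; [exact: cvg_cst|exact: cvg_harmonic].
pose be (w : R) := 1 + expR (2 * K * w).
have be2 w : 0 <= w -> 2 <= be w.
  move=> w0; have : 1 <= expR (2 * K * w).
    by apply: le_trans (expR_ge1Dx _); rewrite lerDl mulr_ge0// ltW.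
  rewrite /be; lra.
have bea w : w <= u -> be w <= a.
  by move=> wu; apply: le_trans ua; rewrite lerD2l ler_expR ler_pM2l.
have bec : be (v n) @[n --> \oo] --> be u.
  apply: cvgD; first exact: cvg_cst.
  apply: (cvg_continuous_seq (f := expR)); first exact: continuous_expR.
  by apply: cvgM => //; exact: cvg_cst.
have sv0 n : 0 < s + v n by rewrite ltr_pwDl.
have su0 : 0 < s + u by rewrite addr_gt0.
have be0 w : 0 < be w by rewrite addr_gt0// expR_gt0.
have Phi0 w : 0 <= w -> w <= u -> 0 < Phi (be w) (s + w).
  move=> w0 wu; apply: (lt_le_trans ltr01).
  by apply: power_integral_ge1; [exact: be2|exact: bea|rewrite addr_ge0// ltW].
have conv x : r (s + v n) x `^ be (v n) * q x @[n --> \oo] --> r (s + u) x `^ be u * q x.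
  apply: cvgM; last exact: cvg_cst.
  have E t b : 0 < t -> r t x `^ b = expR (b * ln (r t x)).
    by move=> t0; rewrite /powR gt_eqF// (rel_density_gt0 p_sol).
  rewrite E//; under eq_fun do rewrite E//.
  apply: (cvg_continuous_seq (f := expR)); first exact: continuous_expR.
  apply: cvgM => //.
  apply: (cvg_continuous_seq (f := @ln R)).
    by apply: continuous_ln; exact: (rel_density_gt0 p_sol).
  apply: cvgM; last exact: cvg_cst.
  have dp : derivable (fun t => p t x) (s + u) 1 by exact: (derivable_solution p_sol).
  have cp : {for s + u, continuous (fun t => p t x)}.
    by apply: differentiable_continuous; exact/derivable1_diffP.
  apply: (cvg_continuous_seq (f := fun t => p t x)) => //.
  by apply: cvgD => //; exact: cvg_cst.
have Phile n : \int[mu]_x (r (s + v n) x `^ be (v n) * q x) <= expR (be (v n) * M).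
  rewrite -PhiE ?be2//.
  have := HM _ (v0 n) (vu n); rewrite /log_norm -/(be (v n)) ler_pdivrMr// mulrC.
  by rewrite -ler_expR lnK// posrE Phi0// ltW.
have expc : expR (be (v n) * M) @[n --> \oo] --> expR (be u * M).
  apply: (cvg_continuous_seq (f := expR)); first exact: continuous_expR.
  by apply: cvgM => //; exact: cvg_cst.
have := @Rfatou R _ _ mu (fun n x => r (s + v n) x `^ be (v n) * q x)
  (fun x => r (s + u) x `^ be u * q x) (fun n => expR (be (v n) * M)) (expR (be u * M))
  _ _ conv _ Phile expc.
move=> H; rewrite /log_norm -/(be u) ler_pdivrMr// mulrC.
rewrite -ler_expR lnK ?posrE ?Phi0 ?(ltW u0)// PhiE ?be2 ?(ltW u0)//.
apply: H.
- move=> n; apply: iPhi; [exact: be2|apply: bea; exact: ltW|exact: ltW].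
- by move=> n x; rewrite mulr_ge0 ?powR_ge0// ltW.
- by apply: iPhi; [apply: be2; exact: ltW|exact: bea|exact: ltW].
Qed.

Lemma hypercontractive s u : 0 < s -> 0 <= u -> a = 1 + expR (2 * K * u) ->
  ln (Phi a (s + u)) / a <= ln (Phi 2 s) / 2.
Proof.
move=> s0 u0 aE.
have K20 : 0 < 2 * K by rewrite mulr_gt0.
suff : log_norm s u <= log_norm s 0.
  have E2 : 1 + expR (2 * K * 0) = 2 by rewrite mulr0 expR0 -[RHS]natr1.
  by rewrite /log_norm E2 addr0; move: (1 + expR (2 * K * u)) aE => b <-.
apply: dini_nonincreasing => //.
- move=> v e v0 vu e0; apply: log_norm_right => //.
  by rewrite aE ltrD2l ltr_expR ltr_pM2l.
- move=> v M v0 vu; apply: log_norm_left => //.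
  by rewrite aE lerD2l ler_expR ler_pM2l.
Qed.

End hypercontractivity.

(** * Comparison of Renyi divergences *)

Section renyi_comparison.
Context {R : realType} {d : nat}.
Local Notation Vt := 'rV[R]_d.
Local Notation mu := (@lebesgue_rV R d).

(** Nonempty open sets have positive Lebesgue measure. *)
Lemma Rintegral_gt0_open (g : Vt -> R) (U : set Vt) x0 :
  mu.-integrable setT (EFin \o g) -> (forall x, 0 <= g x) ->
  open U -> U x0 -> (forall x, U x -> 0 < g x) -> 0 < \int[mu]_x g x.
Proof.
move=> ig g0 oU Ux0 gU.
rewrite lt_neqAle Rintegral_ge0// andbT eq_sym; apply/negP => /eqP I0.
have mg : measurable_fun setT (EFin \o g) by case/integrableP: ig.
have : (\int[mu]_x `|(EFin \o g) x| = 0)%E.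
  rewrite (_ : (\int[mu]_x `|(EFin \o g) x|)%E = (\int[mu]_x (g x)%:E)%E); last first.
    by apply: eq_integral => x _; rewrite /= ger0_norm.
  by rewrite -[LHS]fineK ?integrable_fin_num//; congr EFin.
move/(ae_eq_integral_abs mu measurableT mg) => [N [mN N0 sub]].
have : (mu U <= mu N)%E.
  apply: le_measure; rewrite ?inE//; first exact: open_measurable_rV.
  move=> x Ux; apply: sub => /= /(_ I) [] gx.
  by have := gU x Ux; rewrite gx ltxx.
by rewrite N0 leNgt (lebesgue_rV_open_gt0 oU Ux0).
Qed.

Variable V : Vt -> R.
Hypothesis cV : continuous V.
Hypothesis V_norm : (\int[mu]_x (gibbs V x)%:E = 1)%E.
Local Notation q := (gibbs V).

Let q0 x : 0 < q x. Proof. exact: gibbs_gt0. Qed.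
Let mq : measurable_fun setT q. Proof. exact: measurable_gibbs. Qed.
Let iq : mu.-integrable setT (EFin \o q). Proof. exact: (integrable_gibbs cV V_norm). Qed.

(** A null set of a positive density is Lebesgue null. *)
Lemma density_measure_dominated (p : Vt -> R) : measurable_fun setT p ->
  density_measure p `<< density_measure q.
Proof.
move=> mp A qA B mB BA.
have mBq : measurable_fun B (fun x => (q x)%:E).
  by apply/measurable_EFinP; exact: measurable_funTS.
have mBp : measurable_fun B (fun x => (p x)%:E).
  by apply/measurable_EFinP; exact: measurable_funTS.
have : (\int[mu]_(x in B) `|(q x)%:E| = 0)%E.
  rewrite -[RHS](qA B mB BA); apply: eq_integral => x _.
  by rewrite /= ger0_norm// ltW.
move/(ae_eq_integral_abs mu mB mBq) => [N [mN N0 sub]].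
have B0 : mu B = 0%E.
  apply/eqP; rewrite -measure_le0 -N0; apply: le_measure; rewrite ?inE//.
  move=> x Bx; apply: sub => /= /(_ Bx) [] gx.
  by have := q0 x; rewrite gx ltxx.
have := integral_abs_eq0 mB mBp B0.
move/(ae_eq_integral_abs mu mB mBp) => H.
by rewrite /density_measure (ae_eq_integral (cst 0%E))// integral0.
Qed.

(** The value of [renyi] as a real number, when the integral is finite and, for
   a <> 1, positive ([renyiE]). *)
Definition renyi_value (a : R) (p : Vt -> R) : R :=
  if a == 1 then \int[mu]_x renyi_integrand 1 p q x
  else (a - 1)^-1 * ln (\int[mu]_x renyi_integrand a p q x).

Section density.
Variable p : Vt -> R.
Hypothesis dp : is_density p.

Let mp : measurable_fun setT p. Proof. by case: dp. Qed.
Let p_ge0 x : 0 <= p x. Proof. by case: dp. Qed.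
Let r_ge0 x : 0 <= p x / q x. Proof. by rewrite divr_ge0// ltW. Qed.
Let rqE x : p x / q x * q x = p x. Proof. by rewrite divfK// gt_eqF. Qed.

Let ip := integrable_density dp.

Local Notation integrable_order a :=
  (mu.-integrable setT (EFin \o renyi_integrand a p q)).
Local Notation I a := (\int[mu]_x renyi_integrand a p q x).

Lemma renyiE a : integrable_order a -> (a != 1 -> 0 < I a) ->
  renyi a p q = (renyi_value a p)%:E.
Proof.
move=> ia I0; rewrite /renyi /renyi_value asboolT; last exact: density_measure_dominated.
have E : (\int[mu]_x (renyi_integrand a p q x)%:E)%E = (I a)%:E.
  by rewrite -[LHS]fineK// integrable_fin_num.
rewrite E; case: ifPn => [/eqP a1|a1]; first by rewrite a1.
by rewrite lne_EFin ?I0// EFinM.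
Qed.

Let int_affine (c0 c1 : R) :
  mu.-integrable setT (EFin \o (fun x => c0 * q x + c1 * p x)) /\
  \int[mu]_x (c0 * q x + c1 * p x) = c0 + c1.
Proof.
have [i1 E1] := ip; have [i E] := Rintegral_linear c0 c1 iq i1.
by split => //; rewrite E E1 (Rintegral_gibbs V_norm) !mulr1.
Qed.

(** An affine function of p / q has the same integral for all densities. If phi
   lies strictly above it except at 1, the integrals differ, since p / q differs
   from 1 on a nonempty open set. *)
Lemma affine_minorant_lt (c0 c1 : R) (phi : R -> R) :
  mu.-integrable setT (EFin \o (fun x => phi (p x / q x) * q x)) ->
  continuous p -> p <> q ->
  (forall y, 0 <= y -> y != 1 -> c0 + c1 * y < phi y) -> phi 1 = c0 + c1 ->
  c0 + c1 < \int[mu]_x (phi (p x / q x) * q x).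
Proof.
move=> iphi cp pq lt phi1; have [il El] := int_affine c0 c1.
have [i E] := Rintegral_linear 1 (-1) iphi il.
have gE x : 1 * (phi (p x / q x) * q x) + -1 * (c0 * q x + c1 * p x) =
    (phi (p x / q x) - (c0 + c1 * (p x / q x))) * q x.
  by rewrite -[in c1 * p x](rqE x); ring.
have [x0 px0] : exists x0, p x0 != q x0.
  apply/not_existsP => H; apply: pq; apply/funext => x.
  by apply/eqP; apply: contrapT => /negP; exact: H.
have cq : continuous q.
  move=> x; apply: (@continuous_comp _ _ _ (fun x => - V x) expR).
    by apply: continuousN; exact: cV.
  exact: continuous_expR.
rewrite -subr_gt0 -El; have -> : \int[mu]_x (phi (p x / q x) * q x) -
    \int[mu]_x (c0 * q x + c1 * p x) =
    \int[mu]_x (1 * (phi (p x / q x) * q x) + -1 * (c0 * q x + c1 * p x)).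
  by rewrite E; ring.
apply: (@Rintegral_gt0_open _ [set x | p x != q x] x0) => //.
- move=> x; rewrite gE mulr_ge0 ?(ltW (q0 x))// subr_ge0.
  have [->|y1] := eqVneq (p x / q x) 1; first by rewrite phi1 mulr1.
  exact: ltW (lt _ (r_ge0 x) y1).
- have -> : [set x | p x != q x] = (fun x => p x - q x) @^-1` [set y | y != 0].
    by apply/seteqP; split => x /=; rewrite subr_eq0.
  apply: open_comp; last exact: open_neq.
  by move=> x _; apply: continuousB; [exact: cp|exact: cq].
- move=> x /= pqx; rewrite gE mulr_gt0// subr_gt0 lt//.
  by apply: contra pqx => /eqP y1; rewrite -(rqE x) y1 mul1r.
Qed.

(** [affine_minorant_lt] with the tangent at 1 of the generator, or of its opposite
   for a < 1. *)
Lemma renyi_value_gt0 a : 0 < a -> integrable_order a -> (a != 1 -> 0 < I a) ->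
  continuous p -> p <> q -> 0 < renyi_value a p.
Proof.
move=> a0 ia I0 cp pq; rewrite /renyi_value; case: ifPn => [/eqP a1|a1].
  rewrite a1 in ia; rewrite -[ltLHS](_ : -1 + 1 = 0); last by ring.
  apply: affine_minorant_lt => //.
    by move=> y y0 y1; rewrite mul1r addrC renyi_gen1_gt_tangent.
  by rewrite /renyi_gen eqxx ln1; ring.
have [aleq|agt|aeq] := ltgtP a 1; last by rewrite aeq eqxx in a1.
  rewrite nmulr_rgt0 ?invr_lt0 ?subr_lt0// ln_lt0// I0//=.
  have := @affine_minorant_lt (- (1 - a)) (- a) (fun y => - renyi_gen a y).
  have iN := integrableZl measurableT (-1) ia.
  have EN : (fun x => - renyi_gen a (p x / q x) * q x) = (fun x => -1 * renyi_integrand a p q x).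
    by apply/funext => x; rewrite mulN1r mulNr.
  rewrite EN RintegralZl// mulN1r.
  have -> : - (1 - a) + - a = -1 by ring.
  rewrite ltrN2; apply => //; last by rewrite /renyi_gen (negbTE a1) powR1.
  move=> y y0 y1; rewrite ltrNr; have := renyi_gen_lt_tangent a0 aleq y0 y1; lra.
rewrite mulr_gt0 ?invr_gt0 ?subr_gt0// ln_gt0//.
rewrite -[ltLHS](_ : (1 - a) + a = 1); last by ring.
apply: affine_minorant_lt => //.
  move=> y y0 y1; have := renyi_gen_gt_tangent agt y0 y1; lra.
by rewrite /renyi_gen (negbTE a1) powR1; ring.
Qed.

(** Jensen's inequality for exp under the measure p: the integral is the
   expectation of (p/q)^(a-1) = exp ((a-1) ln (p/q)), bounded below through the
   tangent of exp at (a-1) D_1. *)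
Lemma renyi_integral_ge_expR a : 0 < a -> a < 1 -> integrable_order a -> integrable_order 1 ->
  expR ((a - 1) * I 1) <= I a.
Proof.
move=> a0 a1 ia i1; set B := I 1; set E := expR _.
have [ip1 Ep] := ip.
have [i Ei] := Rintegral_linear (E * (1 - (a - 1) * B)) (E * (a - 1)) ip1 i1.
have -> : E = \int[mu]_x (E * (1 - (a - 1) * B) * p x + E * (a - 1) * renyi_integrand 1 p q x).
  by rewrite Ei Ep -/B; ring.
apply: le_Rintegral => // x _; rewrite /renyi_integrand.
have := r_ge0 x; have := rqE x; move: (p x / q x) => y <- y0.
rewrite !mulrA -mulrDl ler_pM2r// /renyi_gen eqxx (lt_eqF a1).
move: y0; rewrite le_eqVlt => /predU1P[<-|y0]; first by rewrite !(mulr0, mul0r) addr0 powR_ge0.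
have -> : y `^ a = y * (E * expR ((a - 1) * (ln y - B))).
  transitivity (expR (ln y) * (E * expR ((a - 1) * (ln y - B)))); last by rewrite lnK.
  by rewrite /E -!expRD /powR gt_eqF//; congr expR; ring.
have E0 : 0 < E by exact: expR_gt0.
have -> : E * (1 - (a - 1) * B) * y + E * (a - 1) * (y * ln y) =
    y * (E * (1 + (a - 1) * (ln y - B))) by ring.
by rewrite ler_pM2l// ler_pM2l// expR_ge1Dx.
Qed.

Lemma renyi_integral_ge1 a : 1 < a -> integrable_order a -> 1 <= I a.
Proof.
move=> a1 ia; have [i E] := int_affine (1 - a) a.
rewrite -[leLHS](_ : (1 - a) + a = 1); last by ring.
rewrite -E; apply: le_Rintegral => // x _.
rewrite -[in leLHS](rqE x) /renyi_integrand mulrA -mulrDl ler_pM2r//.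
have := renyi_gen_ge_tangent a1 (r_ge0 x); lra.
Qed.

Lemma renyi_integral_gt0 a : 0 < a -> a != 1 -> integrable_order a ->
  (a <= 1 -> integrable_order 1) -> 0 < I a.
Proof.
move=> a0 a1 ia i1; have [al|ag] := ltP a 1.
  exact: lt_le_trans (expR_gt0 _) (renyi_integral_ge_expR a0 al ia (i1 (ltW al))).
apply: (lt_le_trans ltr01); apply: renyi_integral_ge1 => //.
by rewrite lt_neqAle eq_sym a1.
Qed.

Lemma renyi_value_le1 a : 0 < a -> a <= 1 -> integrable_order a -> integrable_order 1 ->
  renyi_value a p <= I 1.
Proof.
move=> a0 + ia i1; rewrite /renyi_value le_eqVlt => /predU1P[->|a1].
  by rewrite eqxx.
rewrite (lt_eqF a1) mulrC ler_ndivrMr ?subr_lt0// mulrC.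
have h := renyi_integral_ge_expR a0 a1 ia i1.
by rewrite -ler_expR lnK// posrE (lt_le_trans (expR_gt0 _) h).
Qed.

(** Jensen's inequality for the concave power a - 1 under the measure p, bounded
   above through the tangent at m = int (p/q)^2 q. *)
Lemma renyi_value_le2 a : 1 < a -> a <= 2 -> integrable_order a -> integrable_order 2 ->
  renyi_value a p <= ln (I 2).
Proof.
move=> a1 + ia i2; have I2 := renyi_integral_ge1 (ltr1n _ 2) i2.
have n21 : 2 != 1 :> R by rewrite pnatr_eq1.
rewrite /renyi_value gt_eqF// le_eqVlt => /predU1P[->|a2].
  by rewrite (_ : 2 - 1 = 1) ?invr1 ?mul1r//; ring.
set m := I 2 in I2 *.
have m0 : 0 < m by exact: lt_le_trans I2.
have [ip1 Ep] := ip.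
have a10 : 0 < a - 1 by lra.
have a11 : a - 1 < 1 by lra.
have [i Ei] := Rintegral_linear (m `^ (a - 1) * (2 - a)) (m `^ (a - 1) * (a - 1) / m) ip1 i2.
rewrite mulrC ler_pdivrMr// mulrC -ln_powR ler_ln ?posrE ?powR_gt0//; last first.
  by apply: lt_le_trans (renyi_integral_ge1 a1 ia).
have -> : m `^ (a - 1) = \int[mu]_x (m `^ (a - 1) * (2 - a) * p x +
    m `^ (a - 1) * (a - 1) / m * renyi_integrand 2 p q x).
  by rewrite Ei Ep -/m divfK ?gt_eqF//; ring.
apply: le_Rintegral => // x _; rewrite /renyi_integrand.
have := r_ge0 x; have := rqE x; move: (p x / q x) => y <- y0.
rewrite !mulrA -mulrDl ler_pM2r// /renyi_gen (negbTE n21) (gt_eqF a1).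
rewrite powR_mulrn//.
move: y0; rewrite le_eqVlt => /predU1P[<-|y0].
  by rewrite powR0 ?gt_eqF ?(lt_trans ltr01)// expr0n mulr0 mulr0 addr0.
have z0 : 0 < y / m by rewrite divr_gt0.
have zle : (y / m) `^ (a - 1) <= 1 + (a - 1) * (y / m - 1).
  have [->|z1] := eqVneq (y / m) 1; first by rewrite powR1 subrr mulr0 addr0.
  have := renyi_gen_lt_tangent a10 a11 (ltW z0) z1.
  by rewrite /renyi_gen (lt_eqF a11) => /ltW.
have -> : y `^ a = y * (m `^ (a - 1) * (y / m) `^ (a - 1)).
  rewrite -powRM ?ltW// mulrCA mulfV ?gt_eqF// mulr1.
  by rewrite -{2}[y]powRr1 ?ltW// -powRD ?(gt_eqF y0) ?implybT//; congr powR; ring.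
have -> : m `^ (a - 1) * (2 - a) * y + m `^ (a - 1) * (a - 1) / m * y ^+ 2 =
    y * (m `^ (a - 1) * (1 + (a - 1) * (y / m - 1))).
  by move: (m `^ (a - 1)) => w; field; rewrite gt_eqF.
by rewrite ler_pM2l// ler_pM2l// powR_gt0.
Qed.

End density.

End renyi_comparison.

(** * Decay of Renyi divergences *)

Section decay.
Context {R : realType} {d : nat}.
Local Notation Vt := 'rV[R]_d.
Local Notation mu := (@lebesgue_rV R d).
Variables (V : Vt -> R) (p0 : Vt -> R) (p : R -> Vt -> R) (K a : R).
Hypothesis V_smooth : smooth_on setT V.
Hypothesis V_norm : (\int[mu]_x (gibbs V x)%:E = 1)%E.
Hypothesis K_gt0 : 0 < K.
Hypothesis V_convex : forall x, loewner_le K%:M (hessian V x).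
Hypothesis p_sol : fokker_planck_solution V p0 p.
Local Notation q := (gibbs V).
Local Notation I b t := (\int[mu]_x renyi_integrand b (p t) q x).

Let cV : continuous V. Proof. exact: C2_continuous (smooth_C2 V_smooth). Qed.

Lemma renyi_value_decay_le1 : 0 < a -> a <= 1 ->
  renyi_regular V p a -> renyi_regular V p 1 -> forall t, 0 <= t ->
  renyi_value V a (p t) <= I 1 0 * expR (- (2 * K * t)).
Proof.
move=> a0 a1 ra r1 t t0.
apply: le_trans (entropy_decay V_smooth V_norm K_gt0 V_convex p_sol r1 t0).
by apply: (renyi_value_le1 (fp_density p_sol t0) a0 a1);
  [exact: (rr_integrable ra t0)|exact: (rr_integrable r1 t0)].
Qed.

Lemma ln_power_integral_decay : renyi_regular V p 2 -> forall t, 0 <= t ->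
  0 <= ln (I 2 t) <= (I 2 0 - 1) * expR (- (2 * K * t)).
Proof.
move=> r2 t t0.
have I1 := renyi_integral_ge1 cV V_norm (fp_density p_sol t0) (ltr1n _ 2)
  (rr_integrable r2 t0).
rewrite ln_ge0//=.
apply: le_trans (chi_square_decay V_smooth V_norm K_gt0 V_convex p_sol r2 t0).
by rewrite ln_le_sub1// (lt_le_trans ltr01).
Qed.

Lemma renyi_value_decay_le2 : 1 < a -> a <= 2 ->
  renyi_regular V p a -> renyi_regular V p 2 -> forall t, 0 <= t ->
  renyi_value V a (p t) <= (I 2 0 - 1) * expR (- (2 * K * t)).
Proof.
move=> a1 a2 ra r2 t t0.
have /andP[_] := ln_power_integral_decay r2 t0; apply: le_trans.
by apply: (renyi_value_le2 cV V_norm (fp_density p_sol t0) a1 a2);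
  [exact: (rr_integrable ra t0)|exact: (rr_integrable r2 t0)].
Qed.

(** Hypercontractivity transports the bound for D_2 at time t - tau to D_alpha at
   time t when t > tau; the endpoint t = tau follows by continuity in time,
   because hypercontractivity starts from positive times only. *)
Lemma renyi_value_decay_gt2 : 2 < a ->
  (forall b, 2 <= b -> b <= a -> renyi_regular V p b) ->
  forall t, ln (a - 1) / (2 * K) <= t ->
  renyi_value V a (p t) <= (a - 1) * (I 2 0 - 1) * expR (- (2 * K * t)).
Proof.
move=> a2 reg; set tau := ln (a - 1) / (2 * K).
have K20 : 0 < 2 * K by rewrite mulr_gt0.
have a10 : 0 < a - 1 by lra.
have tau0 : 0 < tau by rewrite divr_gt0// ln_gt0//; lra.
have Etau : expR (2 * K * tau) = a - 1.
  by rewrite mulrC divfK ?gt_eqF// lnK.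
have aE : a = 1 + expR (2 * K * tau) by rewrite Etau; ring.
have r2 := reg 2 (lexx _) (ltW a2).
have ra := reg a (ltW a2) (lexx _).
have valE t : renyi_value V a (p t) = (a - 1)^-1 * ln (I a t).
  by rewrite /renyi_value gt_eqF//; lra.
have later t : tau < t -> renyi_value V a (p t) <=
    (a - 1) * (I 2 0 - 1) * expR (- (2 * K * t)).
  move=> taut; have s0 : 0 < t - tau by rewrite subr_gt0.
  have := hypercontractive V_smooth V_norm K_gt0 V_convex p_sol reg s0 (ltW tau0) aE.
  rewrite /power_integral subrK => H.
  have /andP[l0 l1] := ln_power_integral_decay r2 (ltW s0).
  have Ee : expR (- (2 * K * (t - tau))) = (a - 1) * expR (- (2 * K * t)).
    by rewrite -Etau -expRD; congr expR; ring.
  have -> : (a - 1) * (I 2 0 - 1) * expR (- (2 * K * t)) =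
    (I 2 0 - 1) * expR (- (2 * K * (t - tau))) by rewrite Ee; ring.
  apply: le_trans l1; rewrite valE ler_pdivrMl//.
  move: H; rewrite ler_pdivrMr; last lra.
  move=> /le_trans; apply; move: (ln _) l0 => l l0; nra.
move=> t; rewrite le_eqVlt => /predU1P[<-|]; last exact: later.
have [_ dP] := power_integral_derive V_smooth p_sol reg (ltW a2) (lexx a) tau0.
have cI : {for tau, continuous (fun t => I a t)}.
  by apply: differentiable_continuous; apply/derivable1_diffP; case: dP.
have I0 : 0 < I a tau.
  apply: (lt_le_trans ltr01).
  apply: (renyi_integral_ge1 cV V_norm (fp_density p_sol (ltW tau0))); first lra.
  exact: (rr_integrable ra (ltW tau0)).
have l : renyi_value V a (p t') @[t' --> tau^'+] --> renyi_value V a (p tau).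
  apply: cvg_at_right_filter; rewrite valE; under eq_fun do rewrite valE.
  apply: cvgM; first exact: cvg_cst.
  by apply: (continuous_comp (f := fun t => I a t)) => //; exact: continuous_ln.
have rr : (a - 1) * (I 2 0 - 1) * expR (- (2 * K * t')) @[t' --> tau^'+] -->
    (a - 1) * (I 2 0 - 1) * expR (- (2 * K * tau)).
  apply: cvg_at_right_filter; apply: cvgM; first exact: cvg_cst.
  apply: (continuous_comp (f := fun t' : R => - (2 * K * t'))); last exact: continuous_expR.
  by apply: continuousN; exact: mulrl_continuous.
apply: (ler_cvg_to l rr).
near=> t'; apply: later; near: t'; exact: nbhs_right_gt.
Unshelve. all: by end_near. Qed.

End decay.

Unset Implicit Arguments.
Set Strict Implicit.

Theorem theorem1p2 (R : realType) (d : nat) (V : 'rV[R]_d -> R) (K alpha : R)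
    (p0 : 'rV[R]_d -> R) (p : R -> 'rV[R]_d -> R)
    (V_smooth : smooth_on setT V)
    (V_norm : (\int[lebesgue_rV d]_x (gibbs V x)%:E = 1)%E)
    (K_gt0 : 0 < K)
    (V_convex : forall x, loewner_le K%:M (hessian V x))
    (alpha_gt0 : 0 < alpha)
    (p0_smooth : smooth_on setT p0)
    (p0_density : is_density p0)
    (p0_neq : p0 <> gibbs V)
    (p_sol : fokker_planck_solution V p0 p)
    (p_decay : decays_fast V p alpha) :
  let D a := renyi a p0 (gibbs V) in
  exists tau C : R,
    [/\ 0 <= tau, 0 < C,
        tau = (if alpha <= 2 then 0 else ln (alpha - 1) / (2 * K)),
        C = (if alpha <= 1 then fine (D 1) / fine (D alpha)
             else if alpha <= 2 then (expR (fine (D 2)) - 1) / fine (D alpha)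
             else (alpha - 1) * ((expR (fine (D 2)) - 1) / fine (D alpha))) &
        forall t, tau <= t ->
          (renyi alpha (p t) (gibbs V)
             <= C%:E * D alpha * (expR (- (2 * K * t)))%:E)%E].
Proof.
move=> D.
have cV : continuous V by exact: C2_continuous (smooth_C2 V_smooth).
have cp0 : continuous p0 by exact: C2_continuous (smooth_C2 p0_smooth).
have K20 : 0 < 2 * K by rewrite mulr_gt0.
have Ep0 : p 0 = p0 by exact: fp_init p_sol.
have reg := df_regular p_decay.
set c := companion_order alpha in reg.
(* the orders alpha and companion_order alpha are endpoints of the interval of
   regular orders *)
have ra : renyi_regular V p alpha.
  by apply: reg; rewrite ge_min lexx le_max lexx.
have rc : renyi_regular V p c.
  by apply: reg; rewrite ge_min lexx orbT le_max lexx orbT.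
have rcE : c = (if alpha <= 1 then 1 else 2) by [].
have i1 : alpha <= 1 -> renyi_regular V p 1 by move=> h; move: rc; rewrite rcE h.
have i2 : 1 < alpha -> renyi_regular V p 2.
  by move=> h; move: rc; rewrite rcE leNgt h.
have DE b t : 0 <= t -> 0 < b -> renyi_regular V p b ->
    (b <= 1 -> renyi_regular V p 1) ->
    renyi b (p t) (gibbs V) = (renyi_value V b (p t))%:E.
  move=> t0 b0 rb rb1; apply: (renyiE cV (fp_density p_sol t0)).
    exact: (rr_integrable rb t0).
  move=> b1; apply: (renyi_integral_gt0 cV V_norm (fp_density p_sol t0) b0 b1).
    exact: (rr_integrable rb t0).
  by move=> /rb1 r1; exact: (rr_integrable r1 t0).
have val_gt0 b : 0 < b -> renyi_regular V p b ->
    (b <= 1 -> renyi_regular V p 1) -> 0 < renyi_value V b p0.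
  move=> b0 rb rb1; rewrite -Ep0.
  have d0 := fp_density p_sol (lexx 0).
  apply: (renyi_value_gt0 cV V_norm d0 b0) => //.
  - exact: (rr_integrable rb (lexx 0)).
  - move=> b1; apply: (renyi_integral_gt0 cV V_norm d0 b0 b1).
      exact: (rr_integrable rb (lexx 0)).
    by move=> /rb1 r1; exact: (rr_integrable r1 (lexx 0)).
  - by rewrite Ep0.
  - by rewrite Ep0.
have Da0 := val_gt0 _ alpha_gt0 ra i1.
have DaE : D alpha = (renyi_value V alpha p0)%:E by rewrite /D -Ep0 DE.
suff [tau [N [tau0 N0 tauE NE H]]] : exists tau N : R,
    [/\ 0 <= tau, 0 < N,
      tau = (if alpha <= 2 then 0 else ln (alpha - 1) / (2 * K)),
      N = (if alpha <= 1 then fine (D 1) else if alpha <= 2 then expR (fine (D 2)) - 1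
           else (alpha - 1) * (expR (fine (D 2)) - 1)) &
      forall t, tau <= t -> renyi_value V alpha (p t) <= N * expR (- (2 * K * t))].
  exists tau, (N / fine (D alpha)); split => //.
  - by rewrite DaE divr_gt0.
  - by rewrite NE; case: ifP => // _; case: ifP => // _; rewrite mulrA.
  - move=> t taut; rewrite DE//; last exact: le_trans taut.
    by rewrite DaE/= -!EFinM lee_fin divfK ?gt_eqF// H.
have n2 : (2 : R) <= 1 -> renyi_regular V p 1 by rewrite lern1.
have two0 : 0 < 2 :> R by [].
have D2V (a1 : 1 < alpha) : D 2 = (renyi_value V 2 p0)%:E.
  by rewrite /D -Ep0; exact: DE (lexx 0) two0 (i2 a1) n2.
have D20 (a1 : 1 < alpha) : 0 < expR (fine (D 2)) - 1.
  have := val_gt0 2 two0 (i2 a1) n2; rewrite subr_gt0 expR_gt1 (D2V a1).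
  by move: (renyi_value V 2 p0).
have D2E (a1 : 1 < alpha) : expR (fine (D 2)) =
    \int[lebesgue_rV d]_x renyi_integrand 2 (p 0) (gibbs V) x.
  have I1 := renyi_integral_ge1 cV V_norm (fp_density p_sol (lexx 0)) (ltr1n _ 2)
    (rr_integrable (i2 a1) (lexx 0)).
  rewrite (D2V a1) -Ep0 /renyi_value pnatr_eq1 /=.
  rewrite (_ : 2 - 1 = 1); last by ring.
  by rewrite invr1 mul1r lnK// posrE (lt_le_trans ltr01).
have [a1|a1] := leP alpha 1.
  have a2 : alpha <= 2 by lra.
  have r1 := i1 a1.
  have D1E : fine (D 1) = renyi_value V 1 (p 0).
    by rewrite /D -Ep0 (DE 1 0 (lexx 0) ltr01 r1 (fun=> r1)).
  exists 0, (fine (D 1)); rewrite a2; split => //.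
    by rewrite D1E Ep0; exact: (val_gt0 1 ltr01 r1 (fun=> r1)).
  move=> t t0; rewrite D1E {2}/renyi_value eqxx.
  exact: (renyi_value_decay_le1 V_smooth V_norm K_gt0 V_convex p_sol alpha_gt0 a1 ra (i1 a1) t0).
have [a2|a2] := leP alpha 2.
  exists 0, (expR (fine (D 2)) - 1); split => //; first exact: D20.
  move=> t t0; rewrite D2E//.
  exact: (renyi_value_decay_le2 V_smooth V_norm K_gt0 V_convex p_sol a1 a2 ra (i2 a1) t0).
have a10 : 0 < alpha - 1 by lra.
exists (ln (alpha - 1) / (2 * K)), ((alpha - 1) * (expR (fine (D 2)) - 1)); split => //.
- by rewrite divr_ge0 ?ln_ge0 ?(ltW K20)//; lra.
- by rewrite mulr_gt0// D20.
move=> t taut; rewrite D2E//.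
apply: (renyi_value_decay_gt2 V_smooth V_norm K_gt0 V_convex p_sol a2) => // b b2 ba.
have cE : c = 2 by rewrite rcE leNgt a1.
apply: reg; rewrite cE.
by rewrite ge_min b2 orbT le_max ba.
Qed.
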